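(* Consider $U(\mathfrak b_+)$ as function algebra and $C(B_+)$ as enveloping algebra. (a) Certain finite dimensional differential calculi $\Gamma$ on $U(\mathfrak b_+)$ and quantum tangent spaces $L$ on $C(B_+)$ are in one-to-one correspondence to finite dimensional differential calculi on $U_q(\mathfrak b_+)$ and quantum tangent spaces on $C_q(B_+)$. Intersections correspond to intersections. (b) In particular, the $\Gamma$ and $L$ corresponding to coirreducible differential calculi on $U_q(\mathfrak b_+)$ and irreducible quantum tangent spaces on $C_q(B_+)$ (of dimension $n\ge2$) via the limiting process (see context) are given as follows. $\Gamma$ has a right invariant basis $\eta_0,\dots,\eta_{n-1}$ so that $$\mathrm dX=\eta_1,\qquad \mathrm dH=(1-n)\eta_0,$$ $$[H,\eta_i]=(1-n+i)\eta_i\quad\forall i,\qquad [X,\eta_i]=\begin{cases}\eta_{i+1}&\text{if } i<n-1,\\0&\text{if } i=n-1\end{cases}$$ holds. The braided derivations $\partial_i=\partial_{\phi_i}$ corresponding to the dual basis $\phi_0,\dots,\phi_{n-1}$ of $L$ are given by $$\partial_i{:}f{:}={:}\,T_{1-n+i,H}\,\frac1{i!}\left(\frac{\partial}{\partial X}\right)^if\,{:}\quad\forall i\ge1,\qquad \partial_0{:}f{:}={:}\,T_{1-n,H}f-f\,{:}$$ for $f\in\Bbbk[X,H]$, with the normal ordering ${:}\cdot{:}:\Bbbk[X,H]\to U(\mathfrak b_+)$ via $H^sX^m\mapsto H^sX^m$.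
   Context: $\Bbbk$ is a field of characteristic $0$. $U_q(\mathfrak b_+)$ is the Hopf algebra over $\Bbbk(q)$ generated by $X,g,g^{-1}$ with $gg^{-1}=g^{-1}g=1$, $Xg=qgX$, $\Delta X=X\otimes1+g\otimes X$, $\Delta g=g\otimes g$, $\epsilon(X)=0$, $\epsilon(g)=1$, $S X=-g^{-1}X$, $S g=g^{-1}$. It is self-dual, via the pairing $\langle X^ng^m,X^rg^s\rangle=\delta_{n,r}[n]_q!\,q^{-n(n-1)/2}q^{-ms}$, where $[n]_q=\sum_{i=0}^{n-1}q^i$ and $[n]_q!=[1]_q\cdots[n]_q$, and the same Hopf algebra is also denoted $C_q(B_+)$. $C(B_+)$ is the commutative Hopf algebra $\Bbbk[X,g,g^{-1}]$ with the same formulas for $\Delta,\epsilon,S$ (i.e. $q=1$). $U(\mathfrak b_+)$ is the enveloping algebra (with primitive generators) of the Lie algebra with generators $X,H$ and $[H,X]=X$. They are paired by $\langle X^nH^m,X^rg^s\rangle=\delta_{n,r}\,n!\,s^m$. ''Differential calculus'' on a Hopf algebra $A$ means bicovariant first order differential calculus. By Woronowicz these are in bijection with subspaces $M\subseteq\ker\epsilon\subset A$ with $AM\subseteq M$ and $\mathrm{Ad_L}(M)\subseteq A\otimes M$, where $\mathrm{Ad_L}(v)=v_{(1)}S v_{(3)}\otimes v_{(2)}$ (left crossed submodules). The calculus of $M$ is $\Gamma=(\ker\epsilon/M)\otimes A$ with right action $(v\otimes b)c=v\otimes bc$, left action $a(v\otimes b)=a_{(1)}v\otimes a_{(2)}b$,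 and $\mathrm da=\pi(\Delta a-1\otimes a)$ ($\pi$ the canonical projection on the first factor). Its dimension is $\dim(\ker\epsilon/M)$; a right invariant basis is a basis of $\ker\epsilon/M$, with $v$ identified with $v\otimes1$. $[a,\eta]=a\eta-\eta a$. $\Gamma$ is coirreducible if it is nonzero and has no proper nonzero quotient calculus. A quantum tangent space on a Hopf algebra $K$ paired with $A$ is a subspace $L\subseteq\ker\epsilon\subset K$ invariant under the left adjoint action $h\triangleright x=h_{(1)}xS h_{(2)}$ ($h\in K$) and with $x_{(1)}\otimes(x_{(2)}-\epsilon(x_{(2)})1)\in K\otimes L$ for $x\in L$; it is irreducible if it is nonzero and has no proper nonzero subspace of the same kind. The quantum tangent space corresponding to the calculus given by $M$ is the annihilator of $M$ in $\ker\epsilon\subset K$; it pairs with $\ker\epsilon/M$, and ''dual basis'' refers to this pairing. For $x\in L$ and $a\in A$ the braided derivation is $\partial_x(a)=\langle x,a_{(1)}\rangle a_{(2)}$. Limiting process: a crossed submodule $M$ of $U_q(\mathfrak b_+)$ (giving a calculus) is sent to a subspace of $U(\mathfrak b_+)$ by replacing $q$ by $e^{-t}$ and $g$ by $e^{tH}$ in a formal power series setting in $t$, writing all expressions in the form $\sum_ja_jt^j$, and keeping only the lowest order in $t$. A quantum tangent space on $C_q(B_+)$ is sent to a subspace of $C(B_+)$ by choosing an ordering of the generators and setting $q=1$. $(T_{a,x}f)(x)=f(x+a)$ for $a\in\Bbbk$. The index $i$ of $\eta_i$, $\partial_i$ runs over $0,\dots,n-1$. *)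

(* Defs.v *)
From HB Require Import structures.
From mathcomp Require Import all_boot all_order all_algebra.
From mathcomp Require Import finmap monalg.
From mathcomp Require Import classical_sets functions.

Set Implicit Arguments.
Unset Strict Implicit.
Unset Printing Implicit Defensive.

Import Order.TTheory GRing.Theory Num.Theory.

Local Open Scope classical_set_scope.
Local Open Scope ring_scope.

(** * Vector spaces with a basis

   [{malg F[B]}] is the F-vector space with basis [B]; [<<b>>] is the basis
   vector [b] and [lin f] the linear extension of [f : B -> V]. *)

Section LinearExtension.
Context {F : fieldType} {B : choiceType} {V : lmodType F}.
Implicit Types (f : B -> V) (x : {malg F[B]}).

Definition lin f x : V := \sum_(b <- msupp x) x@_b *: f b.

Lemma linE f x : lin f x = \sum_(b <- msupp x) x@_b *: f b.
Proof. by []. Qed.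

Lemma linEw (d : {fset B}) f x :
  (msupp x `<=` d)%fset -> lin f x = \sum_(b <- d) x@_b *: f b.
Proof.
move=> le; rewrite [LHS](big_fset_incl _ le) => //= b bd /mcoeff_outdom ->.
by rewrite scale0r.
Qed.

Lemma lin_is_linear f : linear (lin f).
Proof.
move=> c x y; set d := (msupp x `|` msupp y)%fset.
have lx : (msupp x `<=` d)%fset by apply: fsubsetUl.
have ly : (msupp y `<=` d)%fset by apply: fsubsetUr.
have lz : (msupp (c *: x + y) `<=` d)%fset.
  apply: fsubset_trans (msuppD_le _ _) _.
  by rewrite fsubUset ly andbT; apply: fsubset_trans (msuppZ_le _ _) lx.
rewrite (linEw _ lx) (linEw _ ly) (linEw _ lz) scaler_sumr -big_split /=.
by apply: eq_bigr => b _; rewrite mcoeffD mcoeffZ scalerDl scalerA.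
Qed.

HB.instance Definition _ f :=
  GRing.isLinear.Build F {malg F[B]} V _ (lin f) (lin_is_linear f).

Lemma linU f c b : lin f << c *g b >> = c *: f b.
Proof. by rewrite (linEw _ msuppU_le) big_seq_fset1 mcoeffUU. Qed.

Lemma linU1 f b : lin f << b >> = f b.
Proof. by rewrite linU scale1r. Qed.

Lemma eq_lin f f' : f =1 f' -> lin f =1 lin f'.
Proof. by move=> e x; apply: eq_bigr => b _; rewrite e. Qed.

Lemma lin_uniq (h : {malg F[B]} -> V) :
  linear h -> forall x, h x = lin (fun b => h << b >>) x.
Proof.
move=> hl x; pose H := GRing.isLinear.Build F {malg F[B]} V *:%R h hl.
pose h' : {linear _ -> _} := HB.pack h H.
rewrite -[h]/(h' : _ -> _) {1}[x]monalgE linear_sum /=.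
apply: eq_bigr => b _; rewrite -[RHS](linearZZ h'); congr (h _).
by apply/malgP => b'; rewrite mcoeffZ !mcoeffU mulrnAr mulr1.
Qed.

Lemma malg_ext (h h' : {malg F[B]} -> V) : linear h -> linear h' ->
  (forall b, h << b >> = h' << b >>) -> h =1 h'.
Proof.
by move=> hl hl' e x; rewrite (lin_uniq hl) (lin_uniq hl'); apply: eq_lin.
Qed.

End LinearExtension.

(** * Algebras with a basis, given by their structure constants *)

Record basedAlg (F : fieldType) := BasedAlg {
  abas :> choiceType;
  aone : {malg F[abas]};
  amul : abas -> abas -> {malg F[abas]};
  amulA : forall a b c, lin (amul a) (amul b c) = lin (amul ^~ c) (amul a b);
  amul1l : forall a, lin (amul ^~ a) aone = << a >>;
  amul1r : forall a, lin (amul a) aone = << a >> }.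

Arguments amul {F b0}.

Definition carrier (F : fieldType) (A : basedAlg F) := {malg F[abas A]}.

HB.instance Definition _ (F : fieldType) (A : basedAlg F) :=
  GRing.Lmodule.copy (carrier A) {malg F[abas A]}.

Section AlgebraStructure.
Context {F : fieldType} {A : basedAlg F}.
Implicit Types x y z : carrier A.

Definition mulA x y : carrier A := lin (fun a => lin (amul a) y) x.

Let mulA_linl y : linear (mulA^~ y : carrier A -> carrier A).
Proof. exact: (lin_is_linear (fun a => lin (amul a) y)). Qed.

Let mulA_linr x : linear (mulA x : carrier A -> carrier A).
Proof.
move=> c y y'; rewrite /mulA !(linE _ x) scaler_sumr -big_split /=.
apply: eq_bigr => a _.
have -> : lin (amul a) (c *: y + y') = c *: lin (amul a) y + lin (amul a) y'.
  exact: (lin_is_linear (amul a)).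
by rewrite scalerDr !scalerA mulrC.
Qed.

Let mulA_U a y : mulA << a >> y = lin (amul a) y.
Proof. exact: linU1. Qed.

Let mulA_Ur x b : mulA x << b >> = lin (amul^~ b) x.
Proof. by rewrite /mulA; apply: eq_lin => a; rewrite linU1. Qed.

Let mulA_UU a b : mulA << a >> << b >> = amul a b.
Proof. by rewrite mulA_U linU1. Qed.

Let linear_comp (U V W : lmodType F) (f : V -> W) (g : U -> V) :
  linear f -> linear g -> linear (f \o g).
Proof. by move=> fl gl c x y; rewrite /= gl fl. Qed.

Let mulA_assoc : associative mulA.
Proof.
move=> x y z.
apply: (malg_ext (h := mulA^~ (mulA y z)) (h' := fun x => mulA (mulA x y) z)) x.
- exact: mulA_linl.
- exact: (linear_comp (mulA_linl z) (mulA_linl y)).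
move=> a.
apply: (malg_ext (h := fun y => mulA << a >> (mulA y z))
  (h' := fun y => mulA (mulA << a >> y) z)) y.
- exact: (linear_comp (mulA_linr << a >>) (mulA_linl z)).
- exact: (linear_comp (mulA_linl z) (mulA_linr << a >>)).
move=> b.
apply: (malg_ext (h := fun z => mulA << a >> (mulA << b >> z))
  (h' := mulA (mulA << a >> << b >>))) z.
- exact: (linear_comp (mulA_linr << a >>) (mulA_linr << b >>)).
- exact: mulA_linr.
by move=> c; rewrite !mulA_UU mulA_U mulA_Ur amulA.
Qed.

Let mulA_1l : left_id (aone A : carrier A) mulA.
Proof.
apply: (malg_ext (h := mulA (aone A)) (h' := id)) => //.
by move=> a; rewrite mulA_Ur amul1l.
Qed.

Let mulA_1r : right_id (aone A : carrier A) mulA.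
Proof.
apply: (malg_ext (h := mulA^~ (aone A)) (h' := id)) => //.
by move=> a; rewrite mulA_U amul1r.
Qed.

Let mulA_Dl : left_distributive mulA +%R.
Proof. by move=> x y z; have := mulA_linl z 1 x y; rewrite !scale1r. Qed.

Let mulA_Dr : right_distributive mulA +%R.
Proof. by move=> x y z; have := mulA_linr x 1 y z; rewrite !scale1r. Qed.

HB.instance Definition _ := GRing.Zmodule_isPzRing.Build (carrier A)
  mulA_assoc mulA_1l mulA_1r mulA_Dl mulA_Dr.

Definition mono (a : A) : carrier A := << a >>.

Lemma mulE x y : x * y = lin (fun a => lin (amul a) y) x.
Proof. by []. Qed.

Lemma mul_mono (a b : A) : mono a * mono b = amul a b.
Proof. exact: mulA_UU. Qed.

Lemma one_mono : 1 = aone A :> carrier A.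
Proof. by []. Qed.

Lemma mul_linl y : linear (fun x => x * y : carrier A).
Proof. exact: mulA_linl. Qed.

Lemma mul_linr x : linear (fun y => x * y : carrier A).
Proof. exact: mulA_linr. Qed.

End AlgebraStructure.

(** * Tensor products: the pairs of basis vectors are a basis *)

Section Tensor.
Context {F : fieldType}.

Definition tns {A B : choiceType} (x : {malg F[A]}) (y : {malg F[B]}) :
    {malg F[(A * B)%type]} :=
  lin (fun a => lin (fun b => << (a, b) >>) y) x.

Lemma tns_linl (A B : choiceType) (y : {malg F[B]}) :
  linear (fun x : {malg F[A]} => tns x y).
Proof. exact: lin_is_linear. Qed.

Lemma tns_linr (A B : choiceType) (x : {malg F[A]}) :
  linear (fun y : {malg F[B]} => tns x y).
Proof.
move=> c y y'; rewrite /tns !(linE _ x) scaler_sumr -big_split /=.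
apply: eq_bigr => a _.
by rewrite linearP scalerDr !scalerA mulrC.
Qed.

Lemma tnsUU (A B : choiceType) (a : A) (b : B) :
  tns << a >> << b >> = << (a, b) >>.
Proof. by rewrite /tns !linU1. Qed.

Context (A B : basedAlg F).

Definition tns_mul (p r : A * B) : {malg F[(A * B)%type]} :=
  tns (amul p.1 r.1) (amul p.2 r.2).

Lemma lin_tns_mull (p : A * B) x y :
  lin (tns_mul p) (tns x y) = tns (lin (amul p.1) x) (lin (amul p.2) y).
Proof.
apply: (malg_ext (h := fun x => lin (tns_mul p) (tns x y))
  (h' := fun x => tns (lin (amul p.1) x) (lin (amul p.2) y))) x.
- by move=> c x x'; rewrite tns_linl linearP.
- by move=> c x x'; rewrite linearP tns_linl.
move=> a.
apply: (malg_ext (h := fun y => lin (tns_mul p) (tns << a >> y))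
  (h' := fun y => tns (lin (amul p.1) << a >>) (lin (amul p.2) y))) y.
- by move=> c x x'; rewrite tns_linr linearP.
- by move=> c x x'; rewrite linearP tns_linr.
by move=> b; rewrite tnsUU !linU1.
Qed.

Lemma lin_tns_mulr (p : A * B) x y :
  lin (tns_mul ^~ p) (tns x y) = tns (lin (amul ^~ p.1) x) (lin (amul ^~ p.2) y).
Proof.
apply: (malg_ext (h := fun x => lin (tns_mul^~ p) (tns x y))
  (h' := fun x => tns (lin (amul^~ p.1) x) (lin (amul^~ p.2) y))) x.
- by move=> c x x'; rewrite tns_linl linearP.
- by move=> c x x'; rewrite linearP tns_linl.
move=> a.
apply: (malg_ext (h := fun y => lin (tns_mul^~ p) (tns << a >> y))
  (h' := fun y => tns (lin (amul^~ p.1) << a >>) (lin (amul^~ p.2) y))) y.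
- by move=> c x x'; rewrite tns_linr linearP.
- by move=> c x x'; rewrite linearP tns_linr.
by move=> b; rewrite tnsUU !linU1.
Qed.

Lemma tns_mulA (p r s : A * B) :
  lin (tns_mul p) (tns_mul r s) = lin (tns_mul ^~ s) (tns_mul p r).
Proof.
transitivity
  (tns (lin (amul p.1) (amul r.1 s.1)) (lin (amul p.2) (amul r.2 s.2))).
  exact: lin_tns_mull.
rewrite (amulA p.1 r.1 s.1) (amulA p.2 r.2 s.2).
exact: esym (lin_tns_mulr _ _ _).
Qed.

Lemma tns_mul1l (p : A * B) :
  lin (tns_mul ^~ p) (tns (aone A) (aone B)) = << p >>.
Proof. by rewrite lin_tns_mulr !amul1l tnsUU -surjective_pairing. Qed.

Lemma tns_mul1r (p : A * B) :
  lin (tns_mul p) (tns (aone A) (aone B)) = << p >>.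
Proof. by rewrite lin_tns_mull !amul1r tnsUU -surjective_pairing. Qed.

Definition tensor : basedAlg F := BasedAlg tns_mulA tns_mul1l tns_mul1r.

End Tensor.

Definition tnsA {F : fieldType} {A B : basedAlg F} (x : carrier A)
    (y : carrier B) : carrier (tensor A B) := tns x y.

Notation "x ⊗ y" := (tnsA x y) (at level 35, right associativity) : ring_scope.

(** * Hopf algebra structures

   The record only carries the coproduct, counit and antipode on basis vectors;
   it is used for the three concrete Hopf algebras below. *)

Record hopf (F : fieldType) := Hopf {
  halg :> basedAlg F;
  comulb : halg -> carrier (tensor halg halg);
  counitb : halg -> F;
  antipb : halg -> carrier halg }.

Section HopfCalculus.
Context {F : fieldType} {A : hopf F}.
Local Notation AA := (carrier (tensor A A)).
Implicit Types (a x : carrier A) (w : AA) (M L : set (carrier A)).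

Definition Delta a : AA := lin (@comulb F A) a.
Definition eps a : F := lin (@counitb F A : A -> F^o) a.
Definition antip a : carrier A := lin (@antipb F A) a.

Definition kereps : set (carrier A) := [set a | eps a = 0].

Definition subspace (U : lmodType F) (M : set U) :=
  M 0 /\ forall (c : F) (u v : U), M u -> M v -> M (c *: u + v).

Definition tens_sub (P Q : set (carrier A)) : set AA :=
  [set w | exists2 s : seq (carrier A * carrier A),
     (forall p, p \in s -> P p.1 /\ Q p.2) & w = \sum_(p <- s) p.1 ⊗ p.2].

(* [v] is a basis of the quotient space W/M (of W itself when M = 0) *)
Definition basis_mod (U : lmodType F) (W M : set U) (n : nat) (v : nat -> U) :=
  (forall i, (i < n)%N -> W (v i)) /\
  forall u, W u -> exists! c : {ffun 'I_n -> F}, M (u - \sum_(i < n) c i *: v i).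

Definition dim_mod (U : lmodType F) (W M : set U) (n : nat) :=
  exists v, basis_mod W M n v.

(* v |-> v_(1) S v_(3) (x) v_(2), with v_(1) (x) v_(2) (x) v_(3) computed as
   (Delta (x) id) Delta v *)
Definition AdL (v : carrier A) : AA :=
  lin (fun p : A * A =>
    lin (fun r : A * A => (mono r.1 * antip (mono p.2)) ⊗ mono r.2)
      (Delta (mono p.1)))
    (Delta v).

(** First order differential calculi are encoded by their left crossed
   submodules M. *)

Definition calculus M :=
  [/\ subspace M, M `<=` kereps,
      forall a m, M m -> M (a * m) &
      forall m, M m -> tens_sub setT M (AdL m)].

Definition calculus_dim M n := dim_mod kereps M n.

Definition fd_calculus : set (set (carrier A)) :=
  [set M | calculus M /\ exists n, calculus_dim M n].

(* Quotient calculi of the calculus of M correspond to the crossed submodules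
   containing M; the zero calculus is M = ker eps. *)
Definition coirreducible M :=
  [/\ calculus M, M <> kereps &
      forall M', calculus M' -> M `<=` M' -> M' = M \/ M' = kereps].

(** The bimodule Gamma = (ker eps / M) (x) A = (ker eps (x) A) / (M (x) A):
   its elements are represented in ker eps (x) A, inside A (x) A, up to the
   congruence [calc_eq M]. In terms of the product of A (x) A, the left action
   a (v (x) b) = a_(1) v (x) a_(2) b is the multiplication by Delta a. *)

Definition calc_eq M w w' := tens_sub M setT (w - w').
Definition lact a w : AA := Delta a * w.
Definition ract w a : AA := w * (1 ⊗ a).
Definition calc_d a : AA := Delta a - 1 ⊗ a.
Definition calc_comm a w : AA := lact a w - ract w a.
Definition rinv (v : carrier A) : AA := v ⊗ 1.

Definition adl (h x : carrier A) : carrier A :=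
  lin (fun p : A * A => mono p.1 * x * antip (mono p.2)) (Delta h).

Definition tangent_space L :=
  [/\ subspace L, L `<=` kereps,
      forall h x, L x -> L (adl h x) &
      forall x, L x -> tens_sub setT L
        (lin (fun p : A * A =>
               mono p.1 ⊗ (mono p.2 - eps (mono p.2) *: (1 : carrier A))) (Delta x))].

Definition fd_tangent_space : set (set (carrier A)) :=
  [set L | tangent_space L /\ exists n, dim_mod L [set 0] n].

Definition irreducible_tangent_space L :=
  [/\ tangent_space L, L <> [set 0] &
      forall L', tangent_space L' -> L' `<=` L -> L' = [set 0] \/ L' = L].

End HopfCalculus.

Arguments fd_calculus {F} A.
Arguments fd_tangent_space {F} A.
Arguments kereps {F} A.

Section Pairing.
Context {F : fieldType} {A K : hopf F} (pairb : A -> K -> F).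

Definition pairing (a : carrier A) (x : carrier K) : F :=
  lin (fun b => lin (pairb b : K -> F^o) x : F^o) a.

Definition tangent_of (M : set (carrier A)) : set (carrier K) :=
  [set x | kereps K x /\ forall m, M m -> pairing m x = 0].

Definition bderiv (x : carrier K) (a : carrier A) : carrier A :=
  lin (fun p : A * A => pairing (mono p.1) x *: mono p.2) (Delta a).

End Pairing.

(** * The Hopf algebra generated by X, g, g^-1 with X g = q g X *)

Section Bq.
Context {F : fieldType} (q : F) (q0 : q != 0).
Local Notation bas := (nat * int)%type.

(* (n, m) stands for X^n g^m; g^m X^r = q^(- m r) X^r g^m *)
Definition Bq_mul (a b : bas) : {malg F[bas]} :=
  q ^ (- (a.2 * b.1%:Z)) *: << ((a.1 + b.1)%N, a.2 + b.2) >>.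

Lemma Bq_mulA a b c : lin (Bq_mul a) (Bq_mul b c) = lin (Bq_mul ^~ c) (Bq_mul a b).
Proof.
have linZU (f : bas -> {malg F[bas]}) u d : lin f (u *: << d >>) = u *: f d.
  by rewrite linearZ /= linU1.
transitivity (q ^ (- (b.2 * c.1%:Z)) *: Bq_mul a ((b.1 + c.1)%N, b.2 + c.2)).
  exact: (linZU (Bq_mul a)).
transitivity
  (q ^ (- (a.2 * b.1%:Z)) *: Bq_mul ((a.1 + b.1)%N, a.2 + b.2) c); last first.
  exact/esym/(linZU (Bq_mul ^~ c)).
rewrite /Bq_mul /= !scalerA -(expfzDr _ _ q0) -(expfzDr _ _ q0) addnA addrA.
congr (_ ^ _ *: _).
by rewrite PoszD mulrDr mulrDl !opprD [LHS]addrC -addrA.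
Qed.

Lemma Bq_mul1l a : lin (Bq_mul ^~ a) << (0%N, 0) >> = << a >>.
Proof. by rewrite linU1 /Bq_mul /= mul0r oppr0 expr0z scale1r !add0r; case: a. Qed.

Lemma Bq_mul1r a : lin (Bq_mul a) << (0%N, 0) >> = << a >>.
Proof.
by rewrite linU1 /Bq_mul /= mulr0 oppr0 expr0z scale1r addn0 addr0; case: a.
Qed.

Definition Bq_alg : basedAlg F := BasedAlg Bq_mulA Bq_mul1l Bq_mul1r.

Definition Bq_X : carrier Bq_alg := << (1%N, 0) >>.
Definition Bq_g (m : int) : carrier Bq_alg := << (0%N, m) >>.

Lemma Bq_monoE n m : Bq_X ^+ n * Bq_g m = mono ((n, m) : Bq_alg).
Proof.
elim: n => [|n IHn].
  by rewrite expr0 mul1r.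
rewrite exprS -mulrA IHn (mul_mono (A := Bq_alg) (1%N, 0) (n, m)) /= /Bq_mul /=.
by rewrite mul0r oppr0 expr0z scale1r add1n add0r.
Qed.

Lemma Bq_rel : Bq_X * Bq_g 1 = q *: (Bq_g 1 * Bq_X).
Proof.
rewrite (mul_mono (A := Bq_alg) (1%N, 0) (0%N, 1)).
rewrite (mul_mono (A := Bq_alg) (0%N, 1) (1%N, 0)) /= /Bq_mul /=.
rewrite mul0r oppr0 expr0z scale1r mulr1 [RHS]scalerA.
by rewrite -[in X in X * _](expr1z q) -(expfzDr _ _ q0) subrr expr0z scale1r.
Qed.

Lemma Bq_gV : Bq_g 1 * Bq_g (- 1) = 1.
Proof.
rewrite (mul_mono (A := Bq_alg) (0%N, 1) (0%N, - 1)) /= /Bq_mul /=.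
by rewrite mulr0 oppr0 expr0z scale1r.
Qed.

(* Delta and eps are multiplicative, S is antimultiplicative *)
Definition Bq_comul (b : bas) : carrier (tensor Bq_alg Bq_alg) :=
  (Bq_X ⊗ 1 + Bq_g 1 ⊗ Bq_X) ^+ b.1 * (Bq_g b.2 ⊗ Bq_g b.2).
Definition Bq_counit (b : bas) : F := (b.1 == 0%N)%:R.
Definition Bq_antip (b : bas) : carrier Bq_alg :=
  Bq_g (- b.2) * (- (Bq_g (- 1) * Bq_X)) ^+ b.1.

Definition Bq : hopf F := @Hopf F Bq_alg Bq_comul Bq_counit Bq_antip.

Definition qint (n : nat) : F := \sum_(i < n) q ^+ i.
Definition qfact (n : nat) : F := \prod_(1 <= i < n.+1) qint i.

Definition Bq_pair (a b : Bq) : F :=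
  if a.1 == b.1 then
    qfact a.1 * q ^- (a.1 * a.1.-1)./2 * q ^ (- (a.2 * b.2))
  else 0.

End Bq.

(** * The enveloping algebra of the Lie algebra [H, X] = X *)

Section Ub.
Context (k : fieldType).
Local Notation bas := (nat * nat)%type.

(* (n, m) stands for X^n H^m, and [Ub_XP n p] for X^n p(H);
   p(H) X^r = X^r p(H + r) *)
Definition Ub_XP (n : nat) (p : {poly k}) : {malg k[bas]} :=
  \sum_(j < size p) p`_j *: << (n, j : nat) >>.
Definition Ub_mul (a b : bas) : {malg k[bas]} :=
  Ub_XP (a.1 + b.1) (('X + (b.1)%:R%:P) ^+ a.2 * 'X^(b.2)).

Lemma Ub_XPEw N n (p : {poly k}) : (size p <= N)%N ->
  Ub_XP n p = \sum_(j < N) p`_j *: << (n, j : nat) >>.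
Proof.
move=> le; rewrite /Ub_XP (big_ord_widen _ (fun j : nat => p`_j *: << (n, j) >>) le).
rewrite big_mkcond; apply: eq_bigr => j _; case: ltnP => // h.
by rewrite nth_default // scale0r.
Qed.

Lemma Ub_XP_linear n : linear (Ub_XP n).
Proof.
move=> c p r; set N := maxn (size p) (size r).
have hN : (size (c *: p + r)%R <= N)%N.
  apply: leq_trans (size_polyD _ _) _; rewrite geq_max leq_maxr andbT.
  by apply: leq_trans (size_scale_leq _ _) _; rewrite leq_maxl.
rewrite (Ub_XPEw _ hN) (Ub_XPEw _ (leq_maxl _ _ : (size p <= N)%N)).
rewrite (Ub_XPEw _ (leq_maxr _ _ : (size r <= N)%N)) scaler_sumr -big_split /=.
by apply: eq_bigr => j _; rewrite coefD coefZ scalerDl scalerA.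
Qed.

HB.instance Definition _ n :=
  GRing.isLinear.Build k {poly k} {malg k[bas]} _ (Ub_XP n) (Ub_XP_linear n).

Lemma Ub_XPXn n m : Ub_XP n 'X^m = << (n, m) >>.
Proof.
rewrite /Ub_XP size_polyXn big_ord_recr /= coefXn eqxx scale1r big1 ?add0r //.
by move=> j _; rewrite coefXn ltn_eqF // scale0r.
Qed.

Lemma lin_Ub_XP (V : lmodType k) (f : bas -> V) n (p : {poly k}) :
  lin f (Ub_XP n p) = \sum_(j < size p) p`_j *: f (n, j : nat).
Proof.
by rewrite linear_sum; apply: eq_bigr => j _; rewrite linearZ /= linU1.
Qed.

Lemma lin_Ub_mulr n p b : lin (Ub_mul ^~ b) (Ub_XP n p) =
  Ub_XP (n + b.1) ((p \Po ('X + (b.1)%:R%:P)) * 'X^(b.2)).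
Proof.
rewrite lin_Ub_XP comp_polyE mulr_suml linear_sum; apply: eq_bigr => j _.
by rewrite -scalerAl linearZ.
Qed.

Lemma lin_Ub_mull n p a : lin (Ub_mul a) (Ub_XP n p) =
  Ub_XP (a.1 + n) (('X + n%:R%:P) ^+ a.2 * p).
Proof.
rewrite lin_Ub_XP -[in RHS](coefK p) poly_def mulr_sumr linear_sum.
by apply: eq_bigr => j _; rewrite -scalerAr linearZ.
Qed.

Lemma Ub_mulA a b c : lin (Ub_mul a) (Ub_mul b c) = lin (Ub_mul ^~ c) (Ub_mul a b).
Proof.
rewrite lin_Ub_mull lin_Ub_mulr addnA; congr (Ub_XP _ _).
rewrite comp_polyM comp_Xn_poly [_ \Po _](rmorphXn (comp_poly _)) /= mulrA.
by rewrite comp_polyD comp_polyX comp_polyC addrAC -addrA -polyCD -natrD.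
Qed.

Lemma Ub_mul1l a : lin (Ub_mul ^~ a) << (0%N, 0%N) >> = << a >>.
Proof.
by rewrite linU1 /Ub_mul /= expr0 mul1r add0n Ub_XPXn; case: a.
Qed.

Lemma Ub_mul1r a : lin (Ub_mul a) << (0%N, 0%N) >> = << a >>.
Proof.
rewrite linU1 /Ub_mul /= expr0 mulr1 addn0 polyC0 addr0 Ub_XPXn.
by case: a.
Qed.

Definition Ub_alg : basedAlg k := BasedAlg Ub_mulA Ub_mul1l Ub_mul1r.

Definition Ub_X : carrier Ub_alg := << (1%N, 0%N) >>.
Definition Ub_H : carrier Ub_alg := << (0%N, 1%N) >>.

Lemma Ub_monoE n m : Ub_X ^+ n * Ub_H ^+ m = mono ((n, m) : Ub_alg).
Proof.
have HE : Ub_H ^+ m = mono ((0%N, m) : Ub_alg).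
  elim: m => [//|m IHm]; rewrite exprS IHm.
  rewrite (mul_mono (A := Ub_alg) (0%N, 1%N) (0%N, m)) /= /Ub_mul /=.
  by rewrite polyC0 addr0 expr1 -exprS Ub_XPXn.
rewrite HE; elim: n => [|n IHn]; first by rewrite expr0 mul1r.
rewrite exprS -mulrA IHn (mul_mono (A := Ub_alg) (1%N, 0%N) (n, m)) /= /Ub_mul /=.
by rewrite expr0 mul1r Ub_XPXn.
Qed.

Lemma Ub_rel : Ub_H * Ub_X - Ub_X * Ub_H = Ub_X.
Proof.
rewrite (mul_mono (A := Ub_alg) (0%N, 1%N) (1%N, 0%N)).
rewrite (mul_mono (A := Ub_alg) (1%N, 0%N) (0%N, 1%N)) /= /Ub_mul /=.
rewrite !expr1 !expr0 mulr1 mul1r linearD /= addrAC subrr add0r.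
by rewrite polyC1 -(expr0 'X) Ub_XPXn.
Qed.

Definition Ub_comul (b : bas) : carrier (tensor Ub_alg Ub_alg) :=
  (Ub_X ⊗ 1 + 1 ⊗ Ub_X) ^+ b.1 * (Ub_H ⊗ 1 + 1 ⊗ Ub_H) ^+ b.2.
Definition Ub_counit (b : bas) : k := (b == (0%N, 0%N))%:R.
Definition Ub_antip (b : bas) : carrier Ub_alg :=
  (- Ub_H) ^+ b.2 * (- Ub_X) ^+ b.1.

Definition Ub : hopf k := @Hopf k Ub_alg Ub_comul Ub_counit Ub_antip.

(* f = sum_m f_m(H) X^m in k[X, H] is encoded as a polynomial in X over k[H] *)
Definition normord (f : {poly {poly k}}) : carrier Ub :=
  \sum_(m < size f) \sum_(s < size f`_m) f`_m`_s *: (Ub_H ^+ s * Ub_X ^+ m).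

Definition T_H (a : k) (f : {poly {poly k}}) : {poly {poly k}} :=
  map_poly (fun p : {poly k} => p \Po ('X + a%:P)) f.

End Ub.

(** * The q-deformed algebras and their classical counterparts *)

Definition kq (k : fieldType) : fieldType := {fraction {poly k}}.
Definition ofpoly (k : fieldType) (p : {poly k}) : kq k := tofrac p.
Definition qvar (k : fieldType) : kq k := ofpoly 'X.

Lemma qvar_neq0 (k : fieldType) : qvar k != 0.
Proof. by rewrite /qvar /ofpoly tofrac_eq0 polyX_eq0. Qed.

Definition Uq (k : fieldType) : hopf (kq k) := Bq (qvar_neq0 k).
Definition CqB (k : fieldType) : hopf (kq k) := Uq k.
Definition CB (k : fieldType) : hopf k := Bq (oner_neq0 k).

Definition pair_q (k : fieldType) (a : Uq k) (b : CqB k) : kq k :=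
  @Bq_pair _ _ (qvar_neq0 k) a b.
Definition pair_cl (k : fieldType) (a : Ub k) (b : CB k) : k :=
  if a.1 == b.1 then (a.1)`!%:R * (b.2)%:~R ^+ a.2 else 0.

(** * The limiting process *)

Section Limit.
Context {k : fieldType}.

(* coefficient of t^j in p(e^{-t}) *)
Definition exp_q (p : {poly k}) (j : nat) : k :=
  \sum_(i < size p) p`_i * ((- i%:R) ^+ j / j`!%:R).
(* coefficient of t^j in (e^{tH})^m = e^{tmH} *)
Definition exp_g (m : int) (j : nat) : carrier (Ub k) :=
  (m%:~R ^+ j / j`!%:R) *: Ub_H k ^+ j.

(* product of a power series over k and a power series over U(b_+) *)
Definition conv (u : nat -> k) (v : nat -> carrier (Ub k)) (j : nat) :
    carrier (Ub k) :=
  \sum_(i < j.+1) u i *: v (j - i)%N.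

(* coefficient of t^j in p(e^{-t}) X^n e^{tmH} *)
Definition exp_mono (p : {poly k}) (b : nat * int) (j : nat) : carrier (Ub k) :=
  conv (exp_q p) (fun i => Ub_X k ^+ b.1 * exp_g b.2 i) j.

(* The Laurent series t^(-N) (s_0 + s_1 t + ...) is obtained from [a] by
   q = e^{-t}, g = e^{tH}: after multiplication by a common denominator d(q),
   d(e^{-t}) s = t^N sum_b P_b(e^{-t}) X^(b.1) e^{t (b.2) H}. *)
Definition expansion (a : carrier (Uq k)) (N : nat) (s : nat -> carrier (Ub k)) :=
  exists (d : {poly k}) (P : nat * int -> {poly k}),
    [/\ d != 0, (forall b, ofpoly d * a@_b = ofpoly (P b)) &
        forall j, conv (exp_q d) s j =
          if (j < N)%N then 0
          else \sum_(b <- msupp a) exp_mono (P b) b (j - N)].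

Definition limM (M : set (carrier (Uq k))) : set (carrier (Ub k)) :=
  [set x | exists a N s j,
     [/\ M a, expansion a N s, (forall i, (i < j)%N -> s i = 0) & s j = x]].

(* c in k(q) is regular at q = 1, with value v *)
Definition value_at1 (c : kq k) (v : k) :=
  exists p d : {poly k},
    [/\ d.[1] != 0, c = ofpoly p / ofpoly d & v = p.[1] / d.[1]].

(* the ordered monomials: X^n g^m or g^m X^n *)
Definition ordmono (F : fieldType) (q : F) (q0 : q != 0) (o : bool)
    (b : nat * int) : carrier (Bq q0) :=
  if o then Bq_X q0 ^+ b.1 * Bq_g q0 b.2 else Bq_g q0 b.2 * Bq_X q0 ^+ b.1.

Definition specialize (o : bool) (x : carrier (CqB k)) (y : carrier (CB k)) :=
  exists (r : seq (nat * int)) (c : nat * int -> kq k) (v : nat * int -> k),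
    [/\ forall b, value_at1 (c b) (v b),
        x = \sum_(b <- r) c b *: ordmono (qvar_neq0 k) o b &
        y = \sum_(b <- r) v b *: ordmono (oner_neq0 k) o b].

Definition limL (o : bool) (L : set (carrier (CqB k))) : set (carrier (CB k)) :=
  [set y | exists2 x, L x & specialize o x y].

End Limit.

(* Main.v *)
From HB Require Import structures.
Require Import Defs.
From mathcomp Require Import all_boot all_order all_algebra.
From mathcomp Require Import finmap monalg.
From mathcomp Require Import classical_sets functions.
From mathcomp Require Import boolp.
From mathcomp Require Import zify ring.

(** Write B for the algebra with basis X^r g^m and X g = q g X. Up to a nonzero
    weight, pairing with X^r g^m evaluates the coefficient of X^r at
    g = q^(-m) on B ([pairing_ev]), and at H = m on U(b_+) ([pairing_evu]). For a
    finite list J of naturals, let S_J be the set of the X^r g^(-i) with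
    0 <= r <= i and i = 0 or i in J ([strings]). The theorem holds because, for
    generic q, the finite dimensional quantum tangent spaces are exactly the
    augmented spans [tan_str J] of the sets S_J, the finite dimensional calculi
    are exactly their annihilators [calc_str J], and both descriptions survive
    q -> 1 unchanged.

    Tangent spaces ([fd_tangent_classify]). The adjoint action of g multiplies
    X^n g^m by q^(-n), and the coproduct separates monomials according to n + m;
    together they show that a tangent space is spanned by augmented monomials
    ([tangent_augm]). The coproduct lowers n, and the adjoint action of X sends
    X^n g^m to (1 - q^(-(n+m))) X^(n+1) g^m ([adX_e]): it raises n, unless
    n + m = 0. In finite dimension raising must stop, so only the m = -i with
    n <= i occur, and each column is complete.

    Calculi ([fd_calculus_classify]). The adjoint coaction of X^n g^m is a sum
    over j of X^j g^(n-j) (x) X^(n-j) g^m times a product of factors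
    1 - q^(-l) g ([AdL_e]). Hence a crossed submodule M is graded by the degree
    in X, its graded parts are modules over k(q)[g,g^-1], and it is stable under
    X^n p(g) -> X^(n+1) p(g) and X^(n+1) p(g) -> X^n p(g) (1 - q^(-n) g). Finite
    dimension puts all high degrees into M. Descending, passing from n+1 to n
    leaves one alternative: either every element of M of degree n vanishes at
    g = q^n or not. These alternatives form J and determine M.

    Interpolation, at the distinct points q^i or at the distinct integers i in
    characteristic 0, makes annihilators and tangent spaces mutually inverse on
    the sets S_J, so intersections of calculi and of tangent spaces correspond
    to operations on J, identically before and after the limit.

    Limit ([limM_calc_str], [limL_tan_str]). Relations between powers of q give
    relations between the coefficients of the powers of e^(-t) ([q_relation]),
    so vanishing at g = q^i becomes vanishing at H = -i. Conversely, every
    polynomial vanishing at these points is a leading term: g - q^i starts with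
    t (H + i), and factors 1 - q, which start with t, adjust the order so that
    different degrees in X can be added ([lifts_divisible]). On the dual side
    the spaces are spanned by monomials, which q -> 1 does not move.

    An irreducible object is a single string J = [:: d] of dimension n = d + 1.
    There the dual bases are eta_0 = - H / d, eta_i = X^i and
    phi_0 = g^(-d) - 1, phi_i = X^i g^(-d) / i!. As X and H are primitive,
    [a, eta_i] is the product a eta_i modulo M, which gives the commutation
    relations; contracting the coproduct with X^j g^s shifts H by s + j and
    differentiates j times in X ([bderiv_nordH]), which gives the braided
    derivations. *)

Set Implicit Arguments.
Unset Strict Implicit.
Unset Printing Implicit Defensive.

Import Order.TTheory GRing.Theory Num.Theory.

Local Open Scope classical_set_scope.
Local Open Scope ring_scope.

(** * Dimension and dual bases modulo a subspace *)
Section LinearAlgebra.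
Context {F : fieldType}.

Lemma subspace_sum (U : lmodType F) (M : set U) (I : Type) (r : seq I)
    (P : pred I) (c : I -> F) (f : I -> U) :
  subspace M -> (forall i, P i -> M (f i)) ->
  M (\sum_(i <- r | P i) c i *: f i).
Proof.
move=> [M0 ML] fM; elim: r => [|i r IHr]; first by rewrite big_nil.
by rewrite big_cons; case: ifP => // Pi; apply: ML => //; apply: fM.
Qed.

Lemma subspaceZ (U : lmodType F) (M : set U) c u :
  subspace M -> M u -> M (c *: u).
Proof. by move=> [M0 ML] Mu; rewrite -[_ *: _]addr0; apply: ML. Qed.

Lemma subspaceD (U : lmodType F) (M : set U) u v :
  subspace M -> M u -> M v -> M (u + v).
Proof. by move=> [M0 ML] Mu Mv; rewrite -[u]scale1r; apply: ML. Qed.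

Lemma subspaceB (U : lmodType F) (M : set U) u v :
  subspace M -> M u -> M v -> M (u - v).
Proof.
by move=> MS Mu Mv; apply: subspaceD => //; rewrite -scaleN1r; apply: subspaceZ.
Qed.

Lemma subspace_set0 (U : lmodType F) : subspace [set (0 : U)].
Proof. by split=> // c u v -> ->; rewrite scaler0 addr0. Qed.

(** The coordinates of m > n vectors modulo M form a matrix with a nontrivial
    row kernel. Both uniqueness of the dimension and the existence of an element
    of high degree in a crossed submodule come from this. *)
Lemma dim_mod_dependent (U : lmodType F) (W M : set U) n m (w : 'I_m -> U) :
  subspace M -> dim_mod W M n -> (n < m)%N -> (forall i, W (w i)) ->
  exists2 d : 'I_m -> F, (exists i, d i != 0) & M (\sum_i d i *: w i).
Proof.
move=> MS [v [vW vB]] ltnm wW.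
have : forall i, exists c : {ffun 'I_n -> F}, M (w i - \sum_(j < n) c j *: v j).
  by move=> i; have [c [Mc _]] := vB _ (wW i); exists c.
case/fin_all_exists=> C CM; pose A := \matrix_(i, j) C i j.
have : kermx A != 0.
  by rewrite kermx_eq0 /row_free neq_ltn (leq_ltn_trans (rank_leq_col _)).
case/rowV0Pn=> d /sub_kermxP dA /rV0Pn[i0 di0].
exists (fun i => d 0 i); first by exists i0.
have -> : \sum_i d 0 i *: w i =
    \sum_i d 0 i *: (w i - \sum_(j < n) C i j *: v j).
  under [RHS]eq_bigr => i _ do rewrite scalerBr scaler_sumr.
  rewrite sumrB exchange_big /= [X in _ - X]big1 ?subr0 // => j _.
  under eq_bigr => i _ do rewrite scalerA.
  rewrite -scaler_suml; move/matrixP/(_ 0 j): dA; rewrite !mxE => dA.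
  have -> : \sum_i d 0 i * C i j = 0.
    by rewrite -[RHS]dA; apply: eq_bigr => i _; rewrite !mxE.
  by rewrite scale0r.
by apply: subspace_sum.
Qed.

Lemma dim_mod_uniq (U : lmodType F) (W M : set U) n m :
  subspace M -> dim_mod W M n -> dim_mod W M m -> n = m.
Proof.
suff le a b : subspace M -> dim_mod W M a -> dim_mod W M b -> (b <= a)%N.
  by move=> MS dn dm; apply/eqP; rewrite eqn_leq !(le _ _ MS).
move=> MS da [v [vW vB]]; rewrite leqNgt; apply/negP => ltab.
have [|d [i di] dM] := dim_mod_dependent (w := fun i : 'I_b => v i) MS da ltab.
  by move=> i; apply: vW.
have [M0 ML] := MS.
case/negP: di; apply/eqP; case: (posnP b) ltab => [->//|b0 _].
have [|c [cM cU]] := vB (v i); first exact: vW.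
have e : [ffun j => c j - d j] = c.
  apply/esym/cU; under eq_bigr => j _ do rewrite ffunE scalerBl.
  by rewrite sumrB opprB addrCA addrC; apply: subspaceD.
by move/ffunP/(_ i): e; rewrite ffunE => /(canRL (subrK _)) /eqP;
   rewrite eq_sym -subr_eq0 addrC addKr => /eqP.
Qed.

(** A family dual to linear forms cutting out M inside W is a basis of W / M: the
    coordinates of u must be the values of the forms at u. All bases below are
    obtained in this way. *)
Lemma basis_mod_dual (U : lmodType F) (W M : set U) n (v : nat -> U)
    (f : nat -> U -> F) :
  subspace W -> (forall i, linear (f i : U -> F^o)) ->
  (forall u, W u -> M u <-> forall i, (i < n)%N -> f i u = 0) ->
  (forall i, (i < n)%N -> W (v i)) ->
  (forall i j, (i < n)%N -> (j < n)%N -> f j (v i) = (i == j)%:R) ->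
  basis_mod W M n v.
Proof.
move=> WS fl MP vW vf; split=> // u Wu.
have fE j (c : {ffun 'I_n -> F}) : (j < n)%N ->
    forall h : (j < n)%N, f j (u - \sum_(i < n) c i *: v i) = f j u - c (Ordinal h).
  move=> _ h; pose H := GRing.isLinear.Build F U F^o *:%R (f j) (fl j).
  pose g : {linear U -> F^o} := HB.pack (f j) H.
  have fZ a w : f j (a *: w) = a * f j w by apply: (linearZZ g).
  rewrite -[f j]/(g : _ -> _) linearB linear_sum /= (bigD1 (Ordinal h)) //=.
  rewrite big1 => [|i ij].
    by rewrite addr0 fZ vf // eqxx mulr1.
  have nij : (i == j :> nat) = false.
    by apply/negbTE; apply: contraNneq ij => e; apply/eqP/val_inj.
  by rewrite fZ vf // nij mulr0.
have sW (c : {ffun 'I_n -> F}) : W (u - \sum_(i < n) c i *: v i).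
  by apply: subspaceB => //; apply: subspace_sum => // i _; apply: vW.
exists [ffun i : 'I_n => f i u]; split.
  by apply/(MP _ (sW _)) => j h; rewrite (fE _ _ h h) ffunE subrr.
move=> c /(MP _ (sW _)) cM; apply/ffunP => i; rewrite ffunE.
have /eqP := cM i (ltn_ord i); rewrite (fE _ _ _ (ltn_ord i)) // subr_eq0.
by move/eqP ->; congr (c _); apply: val_inj.
Qed.

End LinearAlgebra.

(** * Slices of tensors *)
Section Slices.
Context {F : fieldType}.

Lemma linear_scale (U V : lmodType F) (f : U -> V) : linear f ->
  forall c u, f (c *: u) = c *: f u.
Proof.
move=> fl c u; pose H := GRing.isLinear.Build F U V *:%R f fl.
exact: (linearZZ (HB.pack_for {linear U -> V} f H)).
Qed.

Lemma linear_bigsum (U V : lmodType F) (f : U -> V) : linear f ->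
  forall (I : Type) (r : seq I) (P : pred I) (g : I -> U),
  f (\sum_(i <- r | P i) g i) = \sum_(i <- r | P i) f (g i).
Proof.
move=> fl I r P g; pose H := GRing.isLinear.Build F U V *:%R f fl.
exact: (linear_sum (HB.pack_for {linear U -> V} f H)).
Qed.

Lemma linear_zero (U V : lmodType F) (f : U -> V) : linear f -> f 0 = 0.
Proof. by move=> fl; rewrite -(scale0r 0) (linear_scale fl) scale0r. Qed.

Lemma linear_add (U V : lmodType F) (f : U -> V) : linear f ->
  forall u v, f (u + v) = f u + f v.
Proof. by move=> fl u v; rewrite -{1}[u]scale1r fl scale1r. Qed.

Lemma mcoeff_linear (B : choiceType) (b : B) :
  linear (mcoeff b : {malg F[B]} -> F^o).
Proof. by move=> c x y; rewrite mcoeffD mcoeffZ. Qed.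

(** The coefficient of a in the first factor; membership in the tensor product of
    the whole space with a subspace is tested slice by slice ([tens_subP]). *)
Definition slice {A B : choiceType} (a : A) : {malg F[(A * B)%type]} -> {malg F[B]} :=
  lin (fun p => if p.1 == a then << p.2 >> else 0).

Lemma slice_linear (A B : choiceType) (a : A) :
  linear (slice a : {malg F[(A * B)%type]} -> {malg F[B]}).
Proof. exact: lin_is_linear. Qed.

Lemma slice_tns (A B : choiceType) (a : A) x (y : {malg F[B]}) :
  slice a (tns x y) = x@_a *: y.
Proof.
apply: (malg_ext (h := fun x => slice a (tns x y)) (h' := fun x => x@_a *: y)) x.
- by move=> c x x'; rewrite tns_linl slice_linear.
- by move=> c x x'; rewrite mcoeffD mcoeffZ scalerDl scalerA.
move=> a'; apply: (malg_ext (h := fun y => slice a (tns << a' >> y))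
  (h' := fun y => << a' >>@_a *: y)) y.
- by move=> c x x'; rewrite tns_linr slice_linear.
- by move=> c x x'; rewrite scalerDr !scalerA mulrC.
move=> b; rewrite tnsUU /slice linU1 /= mcoeffU.
by case: eqP => _; rewrite ?scale1r ?scale0r.
Qed.

Lemma sliceK (A B : choiceType) (w : {malg F[(A * B)%type]}) :
  w = \sum_(a <- undup (map fst (msupp w))) tns << a >> (slice a w).
Proof.
transitivity (lin (fun p : A * B => tns << p.1 >> << p.2 >>) w).
  apply: (malg_ext (h := id)) w => //; first exact: lin_is_linear.
  by case=> a b; rewrite linU1 tnsUU.
under [RHS]eq_bigr => a _.
  rewrite /slice linE (linear_bigsum (tns_linr _)).
  under eq_bigr => p _ do rewrite (linear_scale (tns_linr _)).
  over.
rewrite exchange_big linE; apply: eq_big_seq => p pw /=.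
rewrite (bigD1_seq p.1) ?undup_uniq ?mem_undup ?map_f //= eqxx big1 ?addr0 //.
move=> a; rewrite eq_sym => /negPf ->.
by rewrite (linear_zero (tns_linr _)) scaler0.
Qed.

Lemma tens_subP (A : hopf F) (M : set (carrier A)) (w : carrier (tensor A A)) :
  subspace M -> tens_sub setT M w <-> forall a, M (slice a w).
Proof.
move=> MS; split=> [[s sM ->] a | sM].
  rewrite (linear_bigsum (slice_linear a)) big_seq.
  under eq_bigr => p _ do rewrite slice_tns.
  by apply: subspace_sum => // p /sM[].
exists [seq (mono a, slice a w) | a <- undup (map fst (msupp w))].
  by move=> p /mapP[a _ ->]; split=> //; apply: sM.
by rewrite big_map; apply: sliceK.
Qed.

End Slices.

(** * Annihilators and augmented spans of sets of monomials *)
Section CounitKernel.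
Context {F : fieldType} {A : hopf F}.

Lemma eps_linear : linear (eps : carrier A -> F^o).
Proof. exact: lin_is_linear. Qed.

Lemma kereps_subspace : subspace (kereps A).
Proof.
split=> [|c u v]; first exact: (linear_zero eps_linear).
by rewrite /kereps /= eps_linear => -> ->; rewrite scaler0 addr0.
Qed.

End CounitKernel.

Section Duality.
Context {F : fieldType} {A K : hopf F} (pairb : A -> K -> F).
Local Notation pr := (pairing pairb).

Lemma pairing_linl x : linear (pr^~ x : carrier A -> F^o).
Proof. exact: lin_is_linear. Qed.

Lemma pairingU (a : A) x : pr (mono a) x = lin (pairb a : K -> F^o) x.
Proof. by rewrite /pairing /mono linU1. Qed.

Lemma pairingUU (a : A) (b : K) : pr (mono a) (mono b) = pairb a b.
Proof. by rewrite pairingU /mono linU1. Qed.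

Lemma pairing_linr a : linear (pr a : carrier K -> F^o).
Proof.
move=> c x y; rewrite /pairing !(linE _ a) scaler_sumr -big_split /=.
apply: eq_bigr => b _; rewrite linearP scalerDr !scalerA.
by rewrite [c * _]mulrC.
Qed.

Lemma pairingEr a x : pr a x = \sum_(b <- msupp x) x@_b * pr a (mono b).
Proof.
rewrite {1}[x]monalgE (linear_bigsum (pairing_linr a)); apply: eq_bigr => b _.
by rewrite -[_ * _]/(_ *: (_ : F^o)) -(linear_scale (pairing_linr a));
   congr (pr a _); apply/malgP => b'; rewrite mcoeffZ !mcoeffU mulrnAr mulr1.
Qed.

Variable b1 : K.
Hypothesis pr_b1 : forall a, pr a (mono b1) = eps a.
Hypothesis eps_b1 : eps (mono b1) = 1.
Hypothesis interpolation : forall (b0 : K) (s : seq K), b0 \notin s ->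
  exists2 a, pr a (mono b0) != 0 & forall b, b \in s -> pr a (mono b) = 0.

Definition ann_of (S : pred K) : set (carrier A) :=
  [set a | forall b, S b -> pr a (mono b) = 0].
Definition supp_on (S : pred K) : set (carrier K) :=
  [set x | eps x = 0 /\ forall b, ~~ S b -> x@_b = 0].
(** The projection of a basis vector to the kernel of the counit along the basis
    vector [b1], which stands for the unit. *)
Definition augm (b : K) : carrier K := mono b - eps (mono b) *: mono b1.

Lemma ann_of_subspace S : subspace (ann_of S).
Proof.
split=> [b _|c u v Mu Mv b Sb]; first exact: (linear_zero (pairing_linl _)).
by rewrite pairing_linl Mu // Mv // scaler0 addr0.
Qed.

Lemma supp_on_subspace S : subspace (supp_on S).
Proof.
split=> [|c u v [eu Su] [ev Sv]].
  by split=> [|b _]; [exact: (linear_zero (@eps_linear _ K)) | exact: mcoeff0].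
split; first by rewrite (@eps_linear _ K) eu ev scaler0 addr0.
by move=> b Sb; rewrite mcoeffD mcoeffZ Su // Sv // mulr0 addr0.
Qed.

Lemma eps_augm b : eps (augm b) = 0.
Proof.
by rewrite /augm addrC -scaleNr (@eps_linear _ K) eps_b1 [_ *: _]mulr1 addNr.
Qed.

Lemma augm_coef b b' : b' != b1 -> (augm b)@_b' = (b == b')%:R.
Proof.
move=> nb; rewrite mcoeffB mcoeffZ !mcoeffU [b1 == _]eq_sym (negPf nb).
by rewrite mulr0 subr0.
Qed.

Lemma augm_in_supp (S : pred K) b : S b1 -> S b -> supp_on S (augm b).
Proof.
move=> Sb1 Sb; split=> [|b' Sb']; first exact: eps_augm.
rewrite augm_coef; last by apply: contraNneq Sb' => ->.
by case: eqVneq Sb' => // <-; rewrite Sb.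
Qed.

Lemma augm_supp_inv S b : b != b1 -> supp_on S (augm b) -> S b.
Proof.
move=> nb [_ /(_ b)]; case: (S b) => // /(_ isT).
by rewrite augm_coef // eqxx => /eqP; rewrite oner_eq0.
Qed.

Lemma interp (b0 : K) (s : seq K) : b0 \notin s ->
  exists2 a, pr a (mono b0) = 1 & forall b, b \in s -> pr a (mono b) = 0.
Proof.
case/interpolation => a a0 az; exists ((pr a (mono b0))^-1 *: a) => [|b bs].
  by rewrite (linear_scale (pairing_linl _)); apply: mulVf.
by rewrite (linear_scale (pairing_linl _)) (az b bs) scaler0.
Qed.

Lemma ann_of_sub_kereps (S : pred K) : S b1 -> ann_of S `<=` kereps A.
Proof. by move=> Sb1 a /(_ _ Sb1); rewrite pr_b1. Qed.

(** As [augm b1] is zero, an element of the kernel of the counit is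
    determined by its coefficients at the other basis vectors. *)
Lemma supp_onE S x : supp_on S x ->
  x = \sum_(b <- msupp x | b != b1) x@_b *: augm b.
Proof.
move=> [ex Sx]; have E : x = \sum_(b <- msupp x) x@_b *: augm b.
  under eq_bigr => b _ do rewrite scalerBr scalerA.
  rewrite sumrB -scaler_suml; have -> : \sum_(b <- msupp x) x@_b * eps (mono b) = 0.
    rewrite -[RHS]ex [RHS]linE; apply: eq_bigr => b _.
    by rewrite /eps /mono linU1.
  rewrite scale0r subr0 {1}[x]monalgE; apply: eq_bigr => b _.
  by apply/malgP => b'; rewrite mcoeffZ !mcoeffU mulrnAr mulr1.
rewrite {1}E (bigID (fun b => b == b1)) /= big1 ?add0r // => b /eqP ->.
by rewrite /augm eps_b1 scale1r subrr scaler0.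
Qed.

(** If x had a nonzero coefficient outside S, interpolation would give an element
    vanishing on S and on the rest of the support of x, but not at x. *)
Lemma tangent_ann_of (l : seq K) (S : pred K) : S b1 ->
  (forall b, S b -> b \in l) -> tangent_of pairb (ann_of S) = supp_on S.
Proof.
move=> Sb1 Sl; apply/seteqP; split=> x [ex]; last first.
  move=> Sx; split=> // m mM; rewrite pairingEr big1_seq // => b _.
  by case: (boolP (S b)) => Sb; [rewrite mM ?mulr0 | rewrite Sx ?mul0r].
move=> xM; split=> // b Sb.
have [|a a1 a0] := @interp b (filter (fun b' => b' != b) (l ++ msupp x)).
  by rewrite mem_filter eqxx.
have /xM : ann_of S a.
  move=> b' Sb'; apply: a0; rewrite mem_filter mem_cat Sl // andbT.
  by apply: contraNneq Sb => <-.
rewrite pairingEr; case: (boolP (b \in msupp x)) => [bx|/mcoeff_outdom //].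
rewrite (bigD1_seq b) ?fset_uniq //= a1 mulr1 big1_seq ?addr0 // => b'.
by case/andP=> nb bx'; rewrite a0 ?mulr0 // mem_filter nb mem_cat bx' orbT.
Qed.

Lemma supp_on_inj (S S' : pred K) : S b1 -> S' b1 ->
  supp_on S = supp_on S' -> S =1 S'.
Proof.
move=> Sb Sb' e b; case: (eqVneq b b1) => [->|nb]; first by rewrite Sb Sb'.
by apply/idP/idP => [/(augm_in_supp Sb)|/(augm_in_supp Sb')];
   [rewrite e | rewrite -e] => /(augm_supp_inv nb).
Qed.

Lemma ann_of_inj (l l' : seq K) (S S' : pred K) : S b1 -> S' b1 ->
  (forall b, S b -> b \in l) -> (forall b, S' b -> b \in l') ->
  ann_of S = ann_of S' -> S =1 S'.
Proof.
move=> Sb Sb' Sl Sl' e; apply: supp_on_inj => //.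
by rewrite -(tangent_ann_of Sb Sl) e (tangent_ann_of Sb' Sl').
Qed.

Lemma dim_supp_on (l : seq K) (S : pred K) : uniq (b1 :: l) ->
  S =1 mem (b1 :: l) -> dim_mod (supp_on S) [set 0] (size l).
Proof.
move=> /= /andP[b1l ul] Sl.
have nth_b1 i : (i < size l)%N -> nth b1 l i != b1.
  by move=> il; apply: contraNneq b1l => <-; apply: mem_nth.
exists (fun i => augm (nth b1 l i)).
apply: (@basis_mod_dual _ _ _ _ _ _ (fun i => mcoeff (nth b1 l i))).
- exact: supp_on_subspace.
- by move=> i; apply: mcoeff_linear.
- move=> u Su; split=> [-> i _|u0]; first exact: mcoeff0.
  rewrite /= (supp_onE Su) big1_seq // => b /andP[nb _].
  case: (boolP (S b)) => [|Sb]; last by rewrite (Su.2 _ Sb) scale0r.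
  rewrite Sl /= !inE (negPf nb) /= => bl.
  by rewrite -(nth_index b1 bl) u0 ?index_mem // scale0r.
- by move=> i il; apply: augm_in_supp; rewrite Sl /= !inE ?eqxx ?mem_nth ?orbT.
- by move=> i j il jl; rewrite augm_coef ?nth_b1 // nth_uniq.
Qed.

(** Interpolation on the finite set S provides a dual family to its monomials. *)
Lemma dim_ann_of (l : seq K) (S : pred K) : uniq (b1 :: l) ->
  S =1 mem (b1 :: l) -> calculus_dim (ann_of S) (size l).
Proof.
move=> ul Sl.
have : forall i : 'I_(size l), exists a,
    forall b, b \in b1 :: l -> pr a (mono b) = (nth b1 l i == b)%:R.
  move=> i; have [|a a1 a0] := @interp (nth b1 l i)
      (filter (fun b => b != nth b1 l i) (b1 :: l)).
    by rewrite mem_filter eqxx.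
  exists a => b bl; case: eqVneq => [<- //|nb].
  by apply: a0; rewrite mem_filter bl eq_sym nb.
case/fin_all_exists=> v vP.
exists (fun i => if insub i is Some j then v j else 0).
apply: (@basis_mod_dual _ _ _ _ _ _ (fun i a => pr a (mono (nth b1 l i)))).
- exact: kereps_subspace.
- by move=> i; apply: pairing_linl.
- move=> u eu; split=> [Mu i il|u0 b].
    by apply: Mu; rewrite Sl /= inE mem_nth ?orbT.
  rewrite Sl /= inE => /orP[/eqP ->|bl]; first by rewrite pr_b1.
  by rewrite -(nth_index b1 bl) u0 ?index_mem.
- move=> i il; rewrite insubT /kereps /= -pr_b1 vP ?mem_head //=.
  by case/andP: ul => b1l _; case: eqP b1l => // <-; rewrite mem_nth.
move=> i j il jl; rewrite insubT vP ?inE ?mem_nth ?orbT //= nth_uniq //.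
by case/andP: ul.
Qed.

End Duality.

(** * Linear maps on polynomials and on based algebras *)
Section PolyLin.
Context {F : fieldType} {V : lmodType F}.

Definition plin (f : nat -> V) (p : {poly F}) : V := \sum_(i < size p) p`_i *: f i.

Lemma plinEw N f (p : {poly F}) : (size p <= N)%N ->
  plin f p = \sum_(i < N) p`_i *: f i.
Proof.
move=> le; rewrite /plin (big_ord_widen _ (fun i : nat => p`_i *: f i) le).
rewrite big_mkcond; apply: eq_bigr => j _; case: ltnP => // h.
by rewrite nth_default // scale0r.
Qed.

Lemma plin_linear f : linear (plin f).
Proof.
move=> c p r; set N := maxn (size p) (size r).
have hN : (size (c *: p + r)%R <= N)%N.
  apply: leq_trans (size_polyD _ _) _; rewrite geq_max leq_maxr andbT.
  by apply: leq_trans (size_scale_leq _ _) _; rewrite leq_maxl.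
rewrite (plinEw _ hN) (plinEw _ (leq_maxl _ _ : (size p <= N)%N)).
rewrite (plinEw _ (leq_maxr _ _ : (size r <= N)%N)) scaler_sumr -big_split /=.
by apply: eq_bigr => j _; rewrite coefD coefZ scalerDl scalerA.
Qed.

Lemma plin_Xn f n : plin f 'X^n = f n.
Proof.
rewrite /plin size_polyXn big_ord_recr /= coefXn eqxx scale1r big1 ?add0r //.
by move=> j _; rewrite coefXn ltn_eqF // scale0r.
Qed.

Lemma plin_1 f : plin f 1 = f 0%N.
Proof. by rewrite -[1](expr0 'X) plin_Xn. Qed.

Lemma poly_ext (h h' : {poly F} -> V) : linear h -> linear h' ->
  (forall n, h 'X^n = h' 'X^n) -> h =1 h'.
Proof.
move=> hl hl' e p; rewrite -(coefK p) poly_def.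
rewrite (linear_bigsum hl) (linear_bigsum hl'); apply: eq_bigr => i _.
by rewrite (linear_scale hl) (linear_scale hl') e.
Qed.

End PolyLin.

(** The relation [h, x] = x makes x^n an eigenvector of weight n for the
    commutator with h. *)
Lemma commutator_pow (R : pzRingType) (h x : R) n :
  h * x = x * h + x -> h * x ^+ n = x ^+ n * h + x ^+ n *+ n.
Proof.
move=> hx; elim: n => [|n IHn]; first by rewrite expr0 mulr1 mul1r mulr0n addr0.
rewrite exprSr mulrA IHn mulrDl -mulrA hx mulrDr mulrA -addrA; congr (_ + _).
by rewrite mulrS mulrnAl.
Qed.

(** The lemmas of the next two sections restate linearity and ring laws at the
    types [carrier D] and [carrier (tensor A B)]: with the structures already
    resolved, rewriting does not have to unify iterated tensor products. *)
Section CarrierLinear.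
Context {F : fieldType} {D E : basedAlg F} (f : carrier D -> carrier E).
Hypothesis fl : linear f.

Lemma clinD x y : f (x + y) = f x + f y.
Proof. exact: linear_add. Qed.

Lemma clinZ c x : f (c *: x) = c *: f x.
Proof. exact: linear_scale. Qed.

Lemma clinS (I : Type) (r : seq I) (P : pred I) (g : I -> carrier D) :
  f (\sum_(i <- r | P i) g i) = \sum_(i <- r | P i) f (g i).
Proof. exact: linear_bigsum. Qed.

End CarrierLinear.

Section TensorProduct.
Context {F : fieldType} {A B : basedAlg F}.
Implicit Types (x : carrier A) (y : carrier B).

Lemma tnsA_linl y : linear (fun x => x ⊗ y : carrier (tensor A B)).
Proof. exact: tns_linl. Qed.

Lemma tnsA_linr x : linear (fun y => x ⊗ y : carrier (tensor A B)).
Proof. exact: tns_linr. Qed.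

Lemma tnsZl c x y : (c *: x) ⊗ y = c *: (x ⊗ y) :> carrier (tensor A B).
Proof. exact: (linear_scale (tnsA_linl y)). Qed.

Lemma tnsZr c x y : x ⊗ (c *: y) = c *: (x ⊗ y) :> carrier (tensor A B).
Proof. exact: (linear_scale (tnsA_linr x)). Qed.

Lemma tnsDl x x' y : (x + x') ⊗ y = x ⊗ y + x' ⊗ y :> carrier (tensor A B).
Proof. exact: (linear_add (tnsA_linl y)). Qed.

Lemma tnsDr x y y' : x ⊗ (y + y') = x ⊗ y + x ⊗ y' :> carrier (tensor A B).
Proof. exact: (linear_add (tnsA_linr x)). Qed.

Lemma tns_monoE (p : tensor A B) : mono p = mono p.1 ⊗ mono p.2.
Proof. by case: p => a b; apply/esym/tnsUU. Qed.

Lemma mono_ext (D : basedAlg F) (V : lmodType F) (h h' : carrier D -> V) :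
  linear h -> linear h' -> (forall b, h (mono b) = h' (mono b)) -> h =1 h'.
Proof. exact: malg_ext. Qed.

Lemma scaleAl (D : basedAlg F) c (x y : carrier D) : (c *: x) * y = c *: (x * y : carrier D).
Proof. exact: (linear_scale (mul_linl y)). Qed.

Lemma scaleAr (D : basedAlg F) c (x y : carrier D) : x * (c *: y) = c *: (x * y : carrier D).
Proof. exact: (linear_scale (mul_linr x)). Qed.

Lemma alg_sumr (D : basedAlg F) (x : carrier D) (I : Type) (r : seq I)
    (P : pred I) (f : I -> carrier D) :
  x * (\sum_(i <- r | P i) f i) =
  \sum_(i <- r | P i) (x * f i : carrier D).
Proof. exact: (linear_bigsum (mul_linr x)). Qed.

Lemma alg_suml (D : basedAlg F) (x : carrier D) (I : Type) (r : seq I)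
    (P : pred I) (f : I -> carrier D) :
  (\sum_(i <- r | P i) f i) * x =
  \sum_(i <- r | P i) (f i * x : carrier D).
Proof. exact: (linear_bigsum (mul_linl x)). Qed.

(** The combinatorial step of a binomial expansion: two sums shifted by one index
    recombine by a Pascal rule. *)
Lemma sum_shift (D : basedAlg F) n (a b t : nat -> carrier D) :
  t 0%N = b 0%N -> (forall j, (j <= n)%N -> t j.+1 = a j + b j.+1) ->
  b n.+1 = 0 -> \sum_(j < n.+1) (a j + b j) = \sum_(j < n.+2) t j.
Proof.
move=> t0 tS bn; rewrite [RHS]big_ord_recl t0 big_split /=.
have -> : \sum_(j < n.+1) t (lift ord0 j) = \sum_(j < n.+1) (a j + b j.+1).
  by apply: eq_bigr => j _; rewrite lift0 tS // -ltnS.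
rewrite big_split /= addrCA; congr (_ + _).
by rewrite big_ord_recl; congr (_ + _); rewrite big_ord_recr /= bn addr0.
Qed.

Lemma algDl (D : basedAlg F) (x y z : carrier D) :
  (x + y) * z = (x * z : carrier D) + (y * z : carrier D).
Proof. exact: mulrDl. Qed.

Lemma algDr (D : basedAlg F) (x y z : carrier D) :
  x * (y + z) = (x * y : carrier D) + (x * z : carrier D).
Proof. exact: mulrDr. Qed.

Lemma algA (D : basedAlg F) (x y z : carrier D) : x * (y * z) = x * y * z.
Proof. exact: mulrA. Qed.

Lemma algAC4 (D : basedAlg F) (x y z t : carrier D) :
  x * y * (z * t) = x * (y * z) * t.
Proof. by rewrite !mulrA. Qed.

Lemma alg_sandwich (D : basedAlg F) (y u z v w s : carrier D) :
  (y * u * z * v : carrier D) + (w * u * z * (v * s) : carrier D) =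
  (y * (u * z * v) : carrier D) + (w * (u * z * v) * s : carrier D).
Proof. by rewrite !mulrA. Qed.

Lemma alg_cancel (D : basedAlg F) (x z : carrier D) : x + z + -1 *: x = z.
Proof. by rewrite scaleN1r addrAC subrr add0r. Qed.

Lemma alg_expS (D : basedAlg F) (x y : carrier D) n :
  x ^+ n.+1 * y = x * (x ^+ n * y).
Proof. by rewrite exprS mulrA. Qed.

Lemma alg_expSr (D : basedAlg F) (x y : carrier D) n :
  y * x ^+ n.+1 = y * x ^+ n * x.
Proof. by rewrite exprSr mulrA. Qed.

Lemma alg_AC6 (D : basedAlg F) (a b c d f g : carrier D) :
  a + b + c + (d + (f + g)) = a + d + (c + f) + (b + g).
Proof. by rewrite [LHS](AC (3*(1*2)) ((1*4)*(3*5)*(2*6))). Qed.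

Lemma alg_commutator_l (D : basedAlg F) (h x : carrier D) n m :
  h * x = (x * h : carrier D) + x ->
  (x ^+ n * h ^+ m.+1 : carrier D) + n%:R *: (x ^+ n * h ^+ m : carrier D) =
  h * (x ^+ n * h ^+ m).
Proof.
move=> hx; rewrite [RHS]mulrA (commutator_pow n hx) [RHS]mulrDl.
by rewrite exprS mulrA scaler_nat mulrnAl.
Qed.

Lemma alg_commutator_r (D : basedAlg F) (h x : carrier D) n m :
  h * x = (x * h : carrier D) + x ->
  ((- h) ^+ m.+1 * (- x) ^+ n : carrier D) +
    n%:R *: ((- h) ^+ m * (- x) ^+ n : carrier D) =
  (- h) ^+ m * (- x) ^+ n * - h.
Proof.
move=> hx; have hy : h * - x = - x * h + - x by rewrite mulrN hx opprD mulNr.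
have := commutator_pow n hy; move: (- x) => y E.
have E' : y ^+ n * - h = - h * y ^+ n + y ^+ n *+ n.
  by rewrite mulrN mulNr E opprD addrNK.
by rewrite -[RHS]mulrA E' mulrDr mulrA -exprSr scaler_nat mulrnAr.
Qed.

Lemma alg_exp00 (D : basedAlg F) (x y : carrier D) : x ^+ 0 * y ^+ 0 = 1.
Proof. by rewrite !expr0 mulr1. Qed.

Lemma one_tns (D E : basedAlg F) : 1 = 1 ⊗ 1 :> carrier (tensor D E).
Proof. by []. Qed.

Lemma alg1l (D : basedAlg F) (x : carrier D) : 1 * x = x.
Proof. exact: mul1r. Qed.

Lemma alg1r (D : basedAlg F) (x : carrier D) : x * 1 = x.
Proof. exact: mulr1. Qed.

Lemma tns_mulE x y x' y' :
  (x ⊗ y) * (x' ⊗ y') = (x * x') ⊗ (y * y') :> carrier (tensor A B).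
Proof.
apply: (mono_ext (h := fun x => (x ⊗ y) * (x' ⊗ y'))
  (h' := fun x => (x * x') ⊗ (y * y'))) x.
- by move=> c x z; rewrite tnsA_linl mul_linl.
- by move=> c x z; rewrite mul_linl tnsA_linl.
move=> a; apply: (mono_ext (h := fun y => (mono a ⊗ y) * (x' ⊗ y'))
  (h' := fun y => (mono a * x') ⊗ (y * y'))) y.
- by move=> c x z; rewrite tnsA_linr mul_linl.
- by move=> c x z; rewrite mul_linl tnsA_linr.
move=> b; rewrite -(tns_monoE (a, b)) /mono !mulE !linU1.
exact: (lin_tns_mull (a, b)).
Qed.

End TensorProduct.

(** * Gaussian binomials *)
Section GaussianBinomials.
Context {R : comNzRingType} (Q : R).

Fixpoint gauss (n r : nat) : R :=
  match n, r with
  | _, 0 => 1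
  | 0, _.+1 => 0
  | n'.+1, r'.+1 => gauss n' r + Q ^+ (n' - r') * gauss n' r'
  end.

Lemma gaussn0 n : gauss n 0 = 1. Proof. by case: n. Qed.

Lemma gaussS n r :
  gauss n.+1 r.+1 = gauss n r.+1 + Q ^+ (n - r) * gauss n r.
Proof. by []. Qed.

Lemma gauss_small n r : (n < r)%N -> gauss n r = 0.
Proof.
elim: n r => [|n IHn] [|r] //; rewrite ltnS gaussS => lt.
by rewrite !IHn ?mulr0 ?addr0 // ltnW.
Qed.

(** The second Pascal rule. The expansion of the adjoint coaction uses both rules
    at once ([gfactors_rec]). *)
Lemma gaussS' n r :
  gauss n.+1 r.+1 = Q ^+ r.+1 * gauss n r.+1 + gauss n r.
Proof.
elim: n r => [|n IHn] r.
  case: r => [|r]; first by rewrite gaussS /= !mulr0 mulr1 expr0.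
  by rewrite gaussS /= !mulr0 addr0.
rewrite [LHS]gaussS; case: r => [|r].
  rewrite [in LHS]IHn [in RHS]gaussS !gaussn0 !subn0 expr1 exprS; ring.
rewrite ![in LHS]IHn ![in RHS]gaussS.
rewrite subSS; case: (ltnP r n) => h; last first.
  by rewrite (gauss_small (_ : n < r.+1)%N) // (gauss_small (_ : n < r.+2)%N) ?ltnS ?leqW //; ring.
suff e : Q ^+ (n - r) * Q ^+ r.+1 = Q ^+ r.+2 * Q ^+ (n - r.+1).
  by rewrite !mulrDr !mulrA e; ring.
by rewrite -!exprD; congr (_ ^+ _); lia.
Qed.

Lemma gaussnn n : gauss n n = 1.
Proof.
elim: n => [|n IHn] //.
by rewrite gaussS gauss_small // subnn mul1r IHn add0r.
Qed.

Lemma gaussn1 n : gauss n 1 = \sum_(i < n) Q ^+ i.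
Proof.
elim: n => [|n IHn]; first by rewrite big_ord0.
by rewrite big_ord_recr gaussS gaussn0 mulr1 subn0 IHn.
Qed.

Lemma gaussSn n : gauss n.+1 n = \sum_(i < n.+1) Q ^+ i.
Proof.
elim: n => [|n IHn]; first by rewrite big_ord_recr big_ord0 /= expr0 add0r.
rewrite gaussS gaussnn IHn subSnn expr1 [RHS]big_ord_recl mulr_sumr.
by congr (_ + _); apply: eq_bigr => i _; rewrite -exprS.
Qed.

End GaussianBinomials.

Lemma lin_param (F : fieldType) (D : choiceType) (U V : lmodType F)
    (f : U -> D -> V) (w : {malg F[D]}) :
  (forall b, linear (f^~ b)) -> linear (fun u => lin (f u) w).
Proof.
move=> fl c x y; rewrite !linE scaler_sumr -big_split /=.
by apply: eq_bigr => b _; rewrite fl scalerDr !scalerA mulrC.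
Qed.

(** * Adjoint coaction and coproduct *)
Section HopfGeneralities.
Context {F : fieldType} {A : hopf F}.

Lemma Delta_linear : linear (Delta : carrier A -> carrier (tensor A A)).
Proof. exact: lin_is_linear. Qed.

Lemma antip_linear : linear (antip : carrier A -> carrier A).
Proof. exact: lin_is_linear. Qed.

Lemma Delta_mono (b : A) : Delta (mono b) = comulb b.
Proof. by rewrite /Delta /mono linU1. Qed.

Lemma antip_mono (b : A) : antip (mono b) = antipb b.
Proof. by rewrite /antip /mono linU1. Qed.

Lemma eps_mono (b : A) : eps (mono b) = counitb b.
Proof. by rewrite /eps /mono linU1. Qed.

Lemma AdL_linear : linear (AdL : carrier A -> carrier (tensor A A)).
Proof. by move=> c x y; rewrite /AdL Delta_linear lin_is_linear. Qed.

(** The adjoint coaction factors through the linear map u (x) v -> Delta u (S v (x) 1)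
    on Delta a ([AdLE]), which is easier to expand than the iterated coproduct. *)
Definition AdL_kernel (p : tensor A A) : carrier (tensor A A) :=
  Delta (mono p.1) * (antip (mono p.2) ⊗ 1).

Definition AdL_of (w : carrier (tensor A A)) : carrier (tensor A A) :=
  lin AdL_kernel w.

Lemma AdL_of_linear : linear AdL_of.
Proof. exact: lin_is_linear. Qed.

Lemma AdLE a : AdL a = AdL_of (Delta a).
Proof.
apply: eq_lin => p; rewrite /AdL_kernel.
apply: (mono_ext (D := tensor A A)
  (h := lin (fun r : A * A => (mono r.1 * antip (mono p.2)) ⊗ mono r.2))
  (h' := fun w => w * (antip (mono p.2) ⊗ 1))).
- exact: lin_is_linear.
- exact: mul_linl.
by move=> r; rewrite {1}/mono linU1 tns_monoE tns_mulE mulr1.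
Qed.

Lemma adl_linl x : linear (adl^~ x : carrier A -> carrier A).
Proof. by move=> c h h'; rewrite /adl Delta_linear lin_is_linear. Qed.

Lemma AdL_kernel_tns (u v : carrier A) :
  AdL_of (u ⊗ v) = Delta u * (antip v ⊗ 1).
Proof.
apply: (mono_ext (h := fun u => AdL_of (u ⊗ v))
  (h' := fun u => Delta u * (antip v ⊗ 1))) u.
- by move=> c x y; rewrite tnsA_linl AdL_of_linear.
- by move=> c x y; rewrite Delta_linear mul_linl.
move=> a; apply: (mono_ext (h := fun v => AdL_of (mono a ⊗ v))
  (h' := fun v => Delta (mono a) * (antip v ⊗ 1))) v.
- by move=> c x y; rewrite tnsA_linr AdL_of_linear.
- by move=> c x y; rewrite antip_linear tnsA_linl mul_linr.
by move=> b; rewrite -(tns_monoE (a, b)) /AdL_of /mono linU1.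
Qed.

(** The map x -> x_(1) (x) (x_(2) - eps x_(2)) of the definition of tangent
    spaces. *)
Definition coideal_slices (x : carrier A) : carrier (tensor A A) :=
  lin (fun p : A * A =>
    mono p.1 ⊗ (mono p.2 - eps (mono p.2) *: (1 : carrier A))) (Delta x).

End HopfGeneralities.

(** * The algebra X g = q g X *)

(** An abstract presentation of a Hopf algebra by its basis X^n g^m. Working with
    it instead of with pairs of numbers keeps products and coproducts from
    being computed during unification; it also serves q generic and q = 1
    alike. *)
Record BqBasis (F : fieldType) (q : F) (A : hopf F) := {
  bx : nat -> int -> A;
  xdeg : A -> nat;
  gexp : A -> int;
  bxK : forall b, bx (xdeg b) (gexp b) = b;
  xdegE : forall n m, xdeg (bx n m) = n;
  gexpE : forall n m, gexp (bx n m) = m;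
  bx_mul : forall n m r s, mono (bx n m) * mono (bx r s) =
    q ^ (- (m * r%:Z)) *: mono (bx (n + r) (m + s));
  bx_one : mono (bx 0 0) = 1;
  bx_Delta0 : forall m, Delta (mono (bx 0 m)) = mono (bx 0 m) ⊗ mono (bx 0 m);
  bx_DeltaS : forall n m, Delta (mono (bx n.+1 m)) =
    (mono (bx 1 0) ⊗ 1 + mono (bx 0 1) ⊗ mono (bx 1 0)) * Delta (mono (bx n m));
  bx_antip0 : forall m, antip (mono (bx 0 m)) = mono (bx 0 (- m));
  bx_antipS : forall n m, antip (mono (bx n.+1 m)) =
    antip (mono (bx n m)) * - (mono (bx 0 (- 1)) * mono (bx 1 0) : carrier A);
  bx_eps : forall n m, eps (mono (bx n m)) = (n == 0%N)%:R }.

Section BqPresentation.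
Context {F : fieldType} {q : F} (q0 : q != 0).
Local Notation B := (Bq q0).
Local Notation e := (fun (n : nat) (m : int) => mono ((n, m) : B)).

Let mul_e n m r s : e n m * e r s = q ^ (- (m * r%:Z)) *: e (n + r)%N (m + s).
Proof. exact: (mul_mono (A := Bq_alg q0) (n, m) (r, s)). Qed.

Let Delta_eS n m : Delta (e n.+1 m) =
  (e 1%N 0 ⊗ 1 + e 0%N 1 ⊗ e 1%N 0) * Delta (e n m).
Proof. by rewrite !Delta_mono /= /Bq_comul /= exprS -algA. Qed.

Let Delta_e0 m : Delta (e 0%N m) = e 0%N m ⊗ e 0%N m.
Proof. by rewrite Delta_mono /= /Bq_comul /= expr0 alg1l. Qed.

Let antip_e0 m : antip (e 0%N m) = e 0%N (- m).
Proof. by rewrite antip_mono /= /Bq_antip /= expr0 alg1r. Qed.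

Let antip_eS n m :
  antip (e n.+1 m) = antip (e n m) * - (e 0%N (- 1) * e 1%N 0 : carrier B).
Proof. by rewrite !antip_mono /= /Bq_antip /= exprSr algA. Qed.

Let eps_e n m : eps (e n m) = (n == 0%N)%:R.
Proof. by rewrite eps_mono. Qed.

Definition Bq_basis : BqBasis q (Bq q0) := {|
  bx := fun n m => ((n, m) : B);
  xdeg := fun b : B => b.1;
  gexp := fun b : B => b.2;
  bxK := fun b => let: (n, m) as b := b return (b.1, b.2) = b in erefl;
  xdegE := fun _ _ => erefl;
  gexpE := fun _ _ => erefl;
  bx_mul := mul_e;
  bx_one := erefl;
  bx_Delta0 := Delta_e0;
  bx_DeltaS := Delta_eS;
  bx_antip0 := antip_e0;
  bx_antipS := antip_eS;
  bx_eps := eps_e |}.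

End BqPresentation.

Section BqAlgebra.
Context {F : fieldType} {q : F} (q0 : q != 0) {A : hopf F} (P : BqBasis q A).
Local Notation AA := (carrier (tensor A A)).
Local Notation Q := (q^-1).
Local Notation e n m := (mono (bx P n m)).
Implicit Types a : carrier A.

Lemma monoE (b : A) : mono b = e (xdeg P b) (gexp P b).
Proof. by rewrite bxK. Qed.

Lemma mulX_e n m : e 1 0 * e n m = e n.+1 m.
Proof. by rewrite bx_mul mul0r oppr0 expr0z scale1r add0r add1n. Qed.

Lemma mulg_e s n m : e 0 s * e n m = q ^ (- (s * n%:Z)) *: e n (s + m).
Proof. by rewrite bx_mul add0n. Qed.

Lemma mul_eg n m s : e n m * e 0 s = e n (m + s).
Proof. by rewrite bx_mul mulr0 oppr0 expr0z scale1r addn0. Qed.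

(** The coproduct and the antipode of X. *)
Definition DX : AA := e 1 0 ⊗ 1 + e 0 1 ⊗ e 1 0.
Definition SX : carrier A := - (e 0 (- 1) * e 1 0 : carrier A).

(** The q-binomial theorem for X (x) 1 and g (x) X, which commute up to a factor q. *)
Lemma Delta_e n m : Delta (e n m) =
  \sum_(r < n.+1) gauss Q n r *: (e (n - r) (m + r%:Z) ⊗ e r m).
Proof.
elim: n => [|n IHn].
  by rewrite big_ord_recr big_ord0 /= add0r scale1r bx_Delta0 addr0.
rewrite bx_DeltaS IHn algDl [X in X + _]alg_sumr [X in _ + X]alg_sumr.
rewrite [RHS]big_ord_recl.
under [in RHS]eq_bigr => r _ do
  rewrite lift0 gaussS scalerDl subSS.
rewrite [in RHS]big_split /= [X in _ = _ + (X + _)]big_ord_recr /=.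
rewrite gauss_small // scale0r addr0 addrA; congr (_ + _).
  rewrite [LHS]big_ord_recl; congr (_ + _).
    rewrite scaleAr tns_mulE mulX_e alg1l.
    by rewrite /= !gaussn0 !scale1r !subn0 addr0.
  rewrite addr0; apply: eq_bigr => r _; rewrite lift0 scaleAr tns_mulE mulX_e alg1l.
  by rewrite subnSK.
apply: eq_bigr => r _; rewrite scaleAr tns_mulE mulX_e mulg_e.
rewrite tnsZl scalerA; congr (_ *: (e _ _ ⊗ _)).
  by rewrite mulrC mul1r -exprnN exprVn.
by rewrite addrCA -PoszD add1n.
Qed.

Lemma Delta_X (a : carrier A) : Delta (e 1 0 * a) = DX * Delta a.
Proof.
apply: (mono_ext (h := fun a => Delta (e 1 0 * a)) (h' := fun a => DX * Delta a)) a.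
- by move=> c x y; rewrite mul_linr Delta_linear.
- by move=> c x y; rewrite Delta_linear mul_linr.
by move=> b; rewrite (monoE b) mulX_e bx_DeltaS.
Qed.

(** The basis puts X to the left, so multiplicativity in g needs the expansion
    [Delta_e] rather than the definition. *)
Lemma Delta_g s (a : carrier A) : Delta (e 0 s * a) = (e 0 s ⊗ e 0 s) * Delta a.
Proof.
apply: (mono_ext (h := fun a => Delta (e 0 s * a))
  (h' := fun a => (e 0 s ⊗ e 0 s) * Delta a)) a.
- by move=> c x y; rewrite mul_linr Delta_linear.
- by move=> c x y; rewrite Delta_linear mul_linr.
move=> b; rewrite (monoE b); move: (xdeg P b) (gexp P b) => n m.
rewrite mulg_e (clinZ Delta_linear) !Delta_e.
rewrite alg_sumr scaler_sumr; apply: eq_bigr => r _.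
rewrite scaleAr tns_mulE !mulg_e tnsZl tnsZr !scalerA addrA; congr (_ *: _).
rewrite mulrC -mulrA -expfzDr //; congr (_ * (_ ^ _)).
have /leqW := ltn_ord r; rewrite !ltnS => h.
by rewrite -opprD -mulrDr -PoszD subnK // -ltnS.
Qed.

Lemma antip_X (a : carrier A) : antip (e 1 0 * a) = antip a * SX.
Proof.
apply: (mono_ext (h := fun a => antip (e 1 0 * a)) (h' := fun a => antip a * SX)) a.
- by move=> c x y; rewrite mul_linr antip_linear.
- by move=> c x y; rewrite antip_linear mul_linl.
by move=> b; rewrite (monoE b) mulX_e bx_antipS.
Qed.

Lemma DX_tns u v : DX * (u ⊗ v) = (e 1 0 * u) ⊗ v + (e 0 1 * u) ⊗ (e 1 0 * v).
Proof.
rewrite /DX.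
rewrite algDl.
congr (_ + _).
  apply: etrans (tns_mulE _ _ _ _) _.
  congr (_ ⊗ _); exact: alg1l.
exact: tns_mulE.
Qed.

Lemma gg_tns_SX u v :
  (e 0 1 ⊗ e 0 1) * (u ⊗ v) * (SX ⊗ 1) = (e 0 1 * u * SX) ⊗ (e 0 1 * v).
Proof.
have -> := tns_mulE (e 0 1) (e 0 1) u v.
apply: etrans (tns_mulE _ _ _ _) _; congr (_ ⊗ _); exact: alg1r.
Qed.

(** As S reverses products, the coaction of X a is obtained from that of a by
    operations on its two tensor factors only: this recursion in the degree
    drives [AdL_e]. *)
Lemma AdL_X (a : carrier A) :
  AdL (e 1 0 * a) =
  (DX * AdL a : AA) + ((e 0 1 ⊗ e 0 1) * AdL a * (SX ⊗ 1) : AA).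
Proof.
rewrite !AdLE Delta_X.
apply: (mono_ext (D := tensor A A) (h := fun w => AdL_of (DX * w))
  (h' := fun w => (DX * AdL_of w : AA) +
    ((e 0 1 ⊗ e 0 1) * AdL_of w * (SX ⊗ 1) : AA))).
- by move=> c x y; rewrite mul_linr AdL_of_linear.
- move=> c x y; rewrite AdL_of_linear !mul_linr mul_linl.
  by rewrite scalerDr addrACA.
move=> p; rewrite tns_monoE; move: (mono p.1) (mono p.2) => u v.
rewrite DX_tns (clinD AdL_of_linear) {1}(AdL_kernel_tns (e 1 0 * u)).
rewrite {1}(AdL_kernel_tns (e 0 1 * u)) (AdL_kernel_tns u v).
rewrite {1}Delta_X {1}Delta_g {1}antip_X.
have -> : (antip v * SX) ⊗ 1 = (antip v ⊗ 1) * (SX ⊗ 1) :> AA.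
  by rewrite (tns_mulE (antip v)) alg1r.
rewrite [X in X + _ = _](esym (algA DX (Delta u) (antip v ⊗ 1))).
rewrite [X in _ + X = _](algAC4 (e 0 1 ⊗ e 0 1) (Delta u) (antip v ⊗ 1) (SX ⊗ 1)).
reflexivity.
Qed.
End BqAlgebra.

(** * The adjoint coaction on monomials *)
Section BqAdjointCoaction.
Context {F : fieldType} {q : F} (q0 : q != 0) {A : hopf F} (P : BqBasis q A).
Local Notation AA := (carrier (tensor A A)).
Local Notation Q := (q^-1).
Local Notation e n m := (mono (bx P n m)).
Implicit Types a : carrier A.

(** X^r g^m p(g). *)
Definition gp (r : nat) (m : int) : {poly F} -> carrier A :=
  plin (fun i => e r (m + i%:Z)).

Lemma gp_linear r m : linear (gp r m).
Proof. exact: plin_linear. Qed.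

Lemma gpD r m p p' : gp r m (p + p') = gp r m p + gp r m p'.
Proof. exact: (linear_add (gp_linear r m)). Qed.

Lemma gpZ r m c p : gp r m (c *: p) = c *: gp r m p.
Proof. exact: (linear_scale (gp_linear r m)). Qed.

Lemma gp1 r m : gp r m 1 = e r m.
Proof. by rewrite /gp plin_1 addr0. Qed.

Lemma gp_mulX r m p : gp r m ('X * p) = gp r (m + 1) p.
Proof.
apply: (poly_ext (h := fun p => gp r m ('X * p)) (h' := gp r (m + 1))) p.
- by move=> c x y; rewrite mulrDr -scalerAr gp_linear.
- exact: gp_linear.
by move=> n; rewrite -exprS /gp !plin_Xn -addrA -[1]/(1%:Z) -PoszD add1n.
Qed.

Lemma gp_mulXn r m n p : gp r m ('X^n * p) = gp r (m + n%:Z) p.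
Proof.
elim: n m => [|n IHn] m; first by rewrite mul1r addr0.
by rewrite exprS -mulrA gp_mulX IHn -addrA -[1]/(1%:Z) -PoszD add1n.
Qed.

Lemma mulX_gp r m p : e 1 0 * gp r m p = gp r.+1 m p.
Proof.
apply: (poly_ext (h := fun p => e 1 0 * gp r m p) (h' := gp r.+1 m)) p.
- by move=> c x y; rewrite gp_linear mul_linr.
- exact: gp_linear.
by move=> n; rewrite /gp !plin_Xn mulX_e.
Qed.

Lemma mulg_gp s r m p : e 0 s * gp r m p = q ^ (- (s * r%:Z)) *: gp r (m + s) p.
Proof.
apply: (poly_ext (h := fun p => e 0 s * gp r m p)
  (h' := fun p => q ^ (- (s * r%:Z)) *: gp r (m + s) p)) p.
- by move=> c x y; rewrite gp_linear mul_linr.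
- by move=> c x y; rewrite gp_linear scalerDr !scalerA mulrC.
by move=> n; rewrite /gp !plin_Xn mulg_e addrA [s + m]addrC.
Qed.

Definition gfactors (n j : nat) : {poly F} :=
  \prod_(n - j <= l < n) (1 - (Q ^+ l) *: 'X).

Definition AdL_term (n j : nat) (m : int) : AA :=
  e j (n - j)%N%:Z ⊗ gp (n - j) m (gfactors n j).

(** Compare the coefficients of 1 and of g in the two new factors: the
    constant terms agree by one Pascal rule and the linear terms by the other. *)
Lemma gfactors_rec n j : (j <= n)%N ->
  gauss Q n.+1 j.+1 *: gfactors n.+1 j.+1 =
  gauss Q n j *: ((1 - Q ^+ (n + (n - j)) *: 'X) * gfactors n j) +
  (gauss Q n j.+1 * Q ^+ j.+1) *: gfactors n j.+1.
Proof.
move=> jn; have L : gfactors n.+1 j.+1 = gfactors n j * (1 - Q ^+ n *: 'X).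
  by rewrite /gfactors subSS big_nat_recr //= leq_subr.
rewrite L; case: (ltnP j n) => h; last first.
  have -> : j = n by apply/eqP; rewrite eqn_leq jn.
  by rewrite subnn addn0 (gauss_small _ (ltnSn n)) mul0r scale0r addr0 !gaussnn !scale1r mulrC.
have -> : gfactors n j.+1 = (1 - Q ^+ (n - j.+1) *: 'X) * gfactors n j.
  by rewrite /gfactors big_ltn ?subnSK //; lia.
have E1 := gaussS' Q n j; have E2 := gaussS Q n j.
rewrite -!mul_polyC.
have G1 : (gauss Q n.+1 j.+1)%:P = 
    (Q ^+ j.+1)%:P * (gauss Q n j.+1)%:P + (gauss Q n j)%:P :> {poly F}.
  by rewrite E1 polyCD polyCM.
have G2 : (Q ^+ n)%:P * (gauss Q n.+1 j.+1)%:P = (Q ^+ n)%:P * (gauss Q n j.+1)%:P +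
    (Q ^+ (n + (n - j)))%:P * (gauss Q n j)%:P :> {poly F}.
  by rewrite E2 polyCD polyCM mulrDr mulrA exprD polyCM.
have G3 : (Q ^+ n)%:P = (Q ^+ j.+1)%:P * (Q ^+ (n - j.+1))%:P :> {poly F}.
  by rewrite -polyCM -exprD subnKC.
have -> : (gauss Q n.+1 j.+1)%:P * (gfactors n j * (1 - (Q ^+ n)%:P * 'X)) =
  gfactors n j * ((gauss Q n.+1 j.+1)%:P - ((Q ^+ n)%:P * (gauss Q n.+1 j.+1)%:P) * 'X).
  by ring.
rewrite G2 G1 polyCM [in (Q ^+ n)%:P * _]G3; ring.
Qed.

Lemma mul_e_SX s t : e s (1 + t) * SX P = - q ^ (- t) *: e s.+1 t.
Proof.
rewrite /SX -scaleN1r scaleAr algA mul_eg bx_mul mulr1 addn1 addr0.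
by rewrite scalerA mulN1r addrAC subrr add0r.
Qed.

Lemma expQ n : q ^ (- n%:Z) = Q ^+ n.
Proof. by rewrite -exprnN exprVn. Qed.

(** Induction on n with [AdL_X]. Left multiplication by X (x) 1, g (x) X and the
    twisted right multiplication by S X contribute to degree j + 1 the factor
    1 - q^(-(n+n-j)) g, and to degree j the power q^(-j); [gfactors_rec]
    recombines them. *)
Lemma AdL_e n m :
  AdL (e n m) = \sum_(j < n.+1) gauss Q n j *: AdL_term n j m.
Proof.
elim: n => [|n IHn].
  rewrite big_ord_recr big_ord0 /= add0r scale1r /AdL_term /gfactors big_geq // gp1.
  rewrite AdLE bx_Delta0 AdL_kernel_tns bx_Delta0 bx_antip0 tns_mulE alg1r mul_eg.
  by rewrite subrr subn0.
have step j : (j <= n)%N -> (DX P * AdL_term n j m : AA) +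
    ((e 0 1 ⊗ e 0 1) * AdL_term n j m * (SX P ⊗ 1) : AA) =
    e j.+1 (n - j)%N%:Z ⊗
      gp (n - j) m ((1 - Q ^+ (n + (n - j)) *: 'X) * gfactors n j) +
    Q ^+ j *: (e j (n.+1 - j)%N%:Z ⊗ gp (n.+1 - j) m (gfactors n j)).
  move=> jn; rewrite /AdL_term DX_tns gg_tns_SX mulX_e mulX_gp.
  rewrite mulg_gp mulg_e !mul1r !expQ -gp_mulX scaleAl mul_e_SX expQ.
  have -> : gp (n - j) m ((1 - Q ^+ (n + (n - j)) *: 'X) * gfactors n j) =
      - Q ^+ (n + (n - j)) *: gp (n - j) m ('X * gfactors n j) +
      gp (n - j) m (gfactors n j).
    by rewrite -gp_linear mulrBl mul1r -scalerAl scaleNr addrC.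
  have -> : Q ^+ j *: (- Q ^+ (n - j) *: e j.+1 (n - j)%N) = - Q ^+ n *: e j.+1 (n - j)%N.
    by rewrite scalerA mulrN -exprD subnKC.
  rewrite tnsDr (tnsZr (Q ^+ (n - j))) (tnsZl (- Q ^+ n)).
  rewrite (tnsZr (- Q ^+ (n + (n - j)))) (tnsZl (Q ^+ j)).
  rewrite (subSn jn) -[Posz (n - j).+1]/(1%:Z + Posz (n - j)).
  rewrite (scalerA (Q ^+ (n - j))) mulrN -exprD [(n - j + n)%N]addnC.
  by rewrite addrAC; congr (_ + _); rewrite addrC.
have opl : linear (fun w : AA => (DX P * w : AA) + ((e 0 1 ⊗ e 0 1) * w * (SX P ⊗ 1) : AA)).
  move=> c x y; rewrite (mul_linr (DX P) c) (mul_linr (e 0 1 ⊗ e 0 1) c).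
  by rewrite (mul_linl (SX P ⊗ 1) c) scalerDr addrACA.
(* The contributions of the term j to the degrees j + 1 and j. *)
pose a j := gauss Q n j *: (e j.+1 (n - j)%N%:Z ⊗
  gp (n - j) m ((1 - Q ^+ (n + (n - j)) *: 'X) * gfactors n j)) : AA.
pose b j := (gauss Q n j * Q ^+ j) *: (e j (n.+1 - j)%N%:Z ⊗
  gp (n.+1 - j) m (gfactors n j)) : AA.
rewrite -mulX_e (AdL_X q0) IHn (clinS opl).
rewrite -(@sum_shift _ _ n a b (fun j => gauss Q n.+1 j *: AdL_term n.+1 j m)).
- apply: eq_bigr => j _; have jn : (j <= n)%N by rewrite -ltnS.
  by rewrite (clinZ opl) (step j jn) scalerDr scalerA.
- by rewrite /b !gaussn0 /AdL_term /gfactors !subn0 !big_geq ?leqnn ?leqnSn // expr0 mulr1.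
- move=> j jn; rewrite /a /b subSS /AdL_term subSS -(tnsZr (gauss Q n.+1 j.+1)).
  rewrite -gpZ (gfactors_rec jn) gpD tnsDr.
  by rewrite !gpZ (tnsZr (gauss Q n j)) (tnsZr (gauss Q n j.+1 * _)).
by rewrite /b (gauss_small _ (ltnSn n)) mul0r scale0r.
Qed.

End BqAdjointCoaction.

Arguments gfactors {F} q n j.

(** * Calculi defined by vanishing conditions *)
Section BqCalculi.
Context {F : fieldType} {q : F} (q0 : q != 0) {A : hopf F} (P : BqBasis q A).
Local Notation AA := (carrier (tensor A A)).
Local Notation Q := (q^-1).
Local Notation e n m := (mono (bx P n m)).
Implicit Types (a : carrier A) (c : F).

Lemma bx_eq n m n' m' : (bx P n m == bx P n' m') = (n == n') && (m == m').
Proof.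
apply/eqP/andP => [E|[/eqP-> /eqP->] //].
by have := congr1 (xdeg P) E; have := congr1 (gexp P) E; rewrite !xdegE !gexpE => -> ->.
Qed.

Lemma mono_coef (b b' : A) : (mono b)@_b' = (b == b')%:R.
Proof. by rewrite mcoeffU. Qed.

Lemma mono_sumE a : a = \sum_(b <- msupp a) a@_b *: mono b.
Proof.
rewrite {1}[a]monalgE; apply: eq_bigr => b _.
by apply/malgP => b'; rewrite mcoeffZ !mcoeffU mulrnAr mulr1.
Qed.

(** The coefficient of X^r, a Laurent polynomial in g, evaluated at g = c. *)
Definition ev (r : nat) (c : F) (a : carrier A) : F :=
  lin (fun b => (if xdeg P b == r then c ^ gexp P b else 0) : F^o) a.

Lemma ev_linear r c : linear (ev r c : carrier A -> F^o).
Proof. exact: lin_is_linear. Qed.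

Lemma evD r c a a' : ev r c (a + a') = ev r c a + ev r c a'.
Proof. exact: (linear_add (ev_linear r c)). Qed.

Lemma evZ r c x a : ev r c (x *: a) = x * ev r c a.
Proof. exact: (linear_scale (ev_linear r c)). Qed.

Lemma ev0 r c : ev r c 0 = 0.
Proof. exact: (linear_zero (ev_linear r c)). Qed.

Lemma ev_e r c n m : ev r c (e n m) = if n == r then c ^ m else 0.
Proof. by rewrite /ev /mono linU1 xdegE gexpE. Qed.

Lemma ev_gp r c n m p : c != 0 ->
  ev r c (gp P n m p) = if n == r then c ^ m * p.[c] else 0.
Proof.
move=> c0; apply: (poly_ext (V := F^o) (h := fun p => ev r c (gp P n m p))
  (h' := fun p => if n == r then c ^ m * p.[c] else 0)) p.
- by move=> x p p'; rewrite gp_linear evD evZ.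
- move=> x p p'; case: eqP => _; last by rewrite scaler0 addr0.
  by rewrite hornerD hornerZ mulrDr mulrCA.
by move=> i; rewrite /gp plin_Xn ev_e hornerXn expfzDr.
Qed.

Lemma ev_mul_e r c n m a : c != 0 -> ev r c (e n m * a) =
  if (n <= r)%N then q ^ (- (m * (r - n)%N%:Z)) * c ^ m * ev (r - n) c a else 0.
Proof.
move=> c0; apply: (mono_ext (V := F^o) (h := fun a => ev r c (e n m * a))
  (h' := fun a => if (n <= r)%N then
     q ^ (- (m * (r - n)%N%:Z)) * c ^ m * ev (r - n) c a else 0)) a.
- by move=> x y z; rewrite mul_linr evD evZ.
- move=> x y z; case: leqP => _; last by rewrite scaler0 addr0.
  by rewrite evD evZ mulrDr mulrCA.
move=> b; rewrite -(bxK P b) bx_mul evZ !ev_e.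
move: (xdeg P b) (gexp P b) => n' m'; case: (leqP n r) => h.
  rewrite -(eqn_add2l n n') subnKC //; case: eqP => [<-|_]; last by rewrite !mulr0.
  by rewrite addKn expfzDr // mulrA.
by case: eqP => [E|_]; [lia | rewrite mulr0].
Qed.

Lemma slice_AdL_e j t n m : slice (bx P j t) (AdL (e n m)) =
  if (j <= n)%N && (t == (n - j)%N%:Z)
  then gauss Q n j *: gp P (n - j) m (gfactors q n j) else 0.
Proof.
have sl (i : 'I_n.+1) : slice (bx P j t) (gauss Q n i *: AdL_term P n i m) =
    gauss Q n i *: (((i == j :> nat) && (t == (n - i)%N%:Z))%:R *:
      gp P (n - i) m (gfactors q n i)).
  rewrite (linear_scale (slice_linear _)) slice_tns mono_coef bx_eq.
  by rewrite [t == _]eq_sym.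
rewrite (AdL_e q0) (linear_bigsum (slice_linear _)).
rewrite (eq_bigr _ (fun i _ => sl i)).
case: (leqP j n) => jn /=; last first.
  rewrite big1 // => i _; have -> : (i == j :> nat) = false by have := ltn_ord i; lia.
  by rewrite scale0r scaler0.
rewrite (bigD1 (Ordinal (jn : (j < n.+1)%N))) //= eqxx big1 ?addr0 => [|i ij].
  by case: eqP => _; rewrite ?scale1r ?scale0r ?scaler0.
have -> : (i == j :> nat) = false.
  by apply/negbTE; apply: contraNneq ij => E; apply/eqP/val_inj.
by rewrite scale0r scaler0.
Qed.

(** The factors of the adjoint coaction vanish where the conditions defining
    [vanish_calc] would otherwise leave the range r <= i. *)
Lemma gfactors_root n j i : (n - j <= i < n)%N -> (gfactors q n j).[q ^+ i] = 0.
Proof.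
move=> ij; rewrite /gfactors horner_prod (bigD1_seq i) ?mem_index_iota ?iota_uniq //=.
by rewrite !hornerE -exprMn mulVf // expr1n subrr mul0r.
Qed.

Lemma ev_slice_AdL r c j t a : c != 0 -> ev r c (slice (bx P j t) (AdL a)) =
  (if t == r%:Z then gauss Q (j + r) j * (gfactors q (j + r) j).[c] else 0) *
  ev (j + r) c a.
Proof.
move=> c0; apply: (mono_ext (V := F^o)
  (h := fun a => ev r c (slice (bx P j t) (AdL a)))
  (h' := fun a => (if t == r%:Z then
     gauss Q (j + r) j * (gfactors q (j + r) j).[c] else 0) * ev (j + r) c a)) a.
- by move=> x y z; rewrite AdL_linear slice_linear evD evZ.
- by move=> x y z; rewrite evD evZ mulrDr mulrCA.
move=> b; rewrite -(bxK P b); move: (xdeg P b) (gexp P b) => n m.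
rewrite slice_AdL_e ev_e; case: (leqP j n) => jn /=; last first.
  have -> : (n == j + r)%N = false by lia.
  by rewrite ev0 mulr0.
rewrite -[X in if X == (j + r)%N then _ else _](subnKC jn) eqn_add2l.
case: (eqVneq (n - j)%N r) => [<-|nr]; last first.
  by rewrite mulr0; case: ifP => _; rewrite ?ev0 // evZ ev_gp // (negPf nr) mulr0.
rewrite subnKC //; case: ifP => _; last by rewrite ev0 mul0r.
by rewrite evZ ev_gp // eqxx -mulrA; congr (_ * _); apply: mulrC.
Qed.

Definition vanish_calc (J : seq nat) : set (carrier A) :=
  [set a | forall i r, i \in 0%N :: J -> (r <= i)%N -> ev r (q ^+ i) a = 0].

Lemma vanish_calc_subspace J : subspace (vanish_calc J).
Proof.
split=> [i r _ _|c u v Mu Mv i r iJ ri]; first exact: ev0.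
by rewrite evD evZ Mu // Mv // mulr0 addr0.
Qed.

Lemma eps_ev a : eps a = ev 0 1 a.
Proof.
apply: (mono_ext (V := F^o) (h := eps) (h' := ev 0 1)) a.
- exact: eps_linear.
- exact: ev_linear.
by move=> b; rewrite -(bxK P b) bx_eps ev_e exp1rz; case: eqP.
Qed.

Lemma left_ideal_mono (M : set (carrier A)) : subspace M ->
  (forall b a, M a -> M (mono b * a)) -> forall x a, M a -> M (x * a).
Proof.
move=> MS Mb x a Ma; rewrite [x]mono_sumE alg_suml.
rewrite (eq_bigr _ (fun b _ => scaleAl _ _ _)).
by apply: subspace_sum => // b _; apply: Mb.
Qed.

(** Multiplication by X^n only lowers r in the conditions. A slice of the coaction
    relates the condition at (r, i) to the value at degree j + r: for j + r <= i
    this value is zero by hypothesis, and otherwise the factors vanish at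
    q^i. *)
Lemma vanish_calc_calculus J : calculus (vanish_calc J).
Proof.
have qi i : q ^+ i != 0 by rewrite expf_neq0.
have MS := vanish_calc_subspace J; split=> //.
- by move=> a /(_ 0%N 0%N); rewrite mem_head expr0 -eps_ev; apply.
- apply: left_ideal_mono => // b a Ma i r iJ ri; rewrite -(bxK P b) ev_mul_e //.
  case: leqP => // h; rewrite Ma ?mulr0 //.
  by apply: leq_trans ri; rewrite leq_subr.
move=> a Ma; apply/tens_subP => // b i r iJ ri; rewrite -(bxK P b) ev_slice_AdL //.
case: eqP => _; last by rewrite mul0r.
case: (leqP (xdeg P b + r) i) => h; first by rewrite Ma // mulr0.
by rewrite gfactors_root ?mulr0 ?mul0r // addKn ri.
Qed.

End BqCalculi.

(** * Classification of the finite dimensional calculi *)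
Section BqCalculiClassification.
Context {F : fieldType} {q : F} (q0 : q != 0) {A : hopf F} (P : BqBasis q A).
Hypothesis qgen : forall n, q ^+ n.+1 != 1.
Local Notation Q := (q^-1).
Local Notation e n m := (mono (bx P n m)).
Implicit Types (a : carrier A) (c : F) (p : {poly F}).

Lemma expq_inj i j : q ^+ i = q ^+ j -> i = j.
Proof.
wlog le : i j / (i <= j)%N => [W E|E].
  by case: (leqP i j) => h; [apply: W | apply/esym/W => //; apply: ltnW].
apply/eqP; rewrite eqn_leq le leqNgt; apply/negP => lt.
have : q ^+ i * q ^+ (j - i) = q ^+ i * 1 by rewrite -exprD subnKC // mulr1.
move/(mulfI (expf_neq0 _ q0)); have -> : (j - i = (j - i.+1).+1)%N by lia.
by move/eqP; rewrite (negPf (qgen _)).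
Qed.

Lemma gauss1_neq0 n : gauss Q n.+1 1 != 0.
Proof.
rewrite gaussn1; apply: contraNneq (qgen n) => E.
have := subrX1 Q n.+1; rewrite E mulr0 exprVn => /eqP; rewrite subr_eq0 => /eqP h.
by apply/eqP; rewrite -[LHS]invrK h invr1.
Qed.

(** The part of degree n in X is a slice of the adjoint coaction, the term j = 0 of
    [AdL_e]; this is why crossed submodules are graded. *)
Definition degree_part n a : carrier A := slice (bx P 0 n%:Z) (AdL a).

Lemma degree_part_linear n : linear (degree_part n : carrier A -> carrier A).
Proof. by move=> c x y; rewrite /degree_part AdL_linear slice_linear. Qed.

Lemma degree_part_e n n' m : degree_part n (e n' m) = if n == n' then e n' m else 0.
Proof.
rewrite /degree_part slice_AdL_e //= subn0 eqz_nat; case: eqP => [_|//].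
by rewrite gaussn0 /gfactors subn0 big_geq // gp1 scale1r.
Qed.

Lemma ev_degree_part n a : ev P n (q ^+ n) (degree_part n a) = ev P n (q ^+ n) a.
Proof.
rewrite /degree_part ev_slice_AdL ?expf_neq0 // eqxx add0n gaussn0 /gfactors subn0.
by rewrite big_geq // hornerC !mul1r.
Qed.

Lemma sum_degree_part a : exists N, a = \sum_(n < N) degree_part n a.
Proof.
exists (\max_(b <- msupp a) xdeg P b).+1; set N := (X in X.+1).
rewrite {1 2}[a]mono_sumE; under [RHS]eq_bigr => n _ do
  rewrite (clinS (degree_part_linear n)).
rewrite exchange_big; apply: eq_big_seq => b bx /=.
under eq_bigr => n _ do rewrite (clinZ (degree_part_linear n)).
have bN : (xdeg P b < N.+1)%N by rewrite ltnS /N (bigD1_seq b) ?leq_maxl.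
rewrite (bigD1 (Ordinal bN)) //= big1 ?addr0.
  by rewrite [X in degree_part _ X](monoE P) degree_part_e eqxx -(monoE P).
move=> i ib; rewrite (monoE P) degree_part_e.
have -> : (i == xdeg P b :> nat) = false.
  by apply/negbTE; apply: contraNneq ib => E; apply/eqP/val_inj.
exact: scaler0.
Qed.

(** The multiples of X^n by Laurent polynomials in g. *)
Definition homog n : set (carrier A) := [set a | exists m p, a = gp P n m p].

Lemma homog_subspace n : subspace (homog n).
Proof.
split; first by exists 0, 0; rewrite (linear_zero (gp_linear P n 0)).
(* Two Laurent polynomials are brought to a common lowest exponent. *)
have sh m m' : exists M u v, m = M + u%:Z /\ m' = M + v%:Z.
  by exists (Num.min m m'), `|m - Num.min m m'|%N, `|m' - Num.min m m'|%N; lia.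
move=> c _ _ [m [p ->]] [m' [p' ->]]; have [M [u [v [-> ->]]]] := sh m m'.
by exists M, (c *: ('X^u * p) + 'X^v * p'); rewrite gpD gpZ !gp_mulXn.
Qed.

Lemma homog_degree_part n a : homog n (degree_part n a).
Proof.
rewrite [a]mono_sumE (clinS (degree_part_linear n)).
under eq_bigr => b _ do rewrite (clinZ (degree_part_linear n)).
apply: subspace_sum => [|b _]; first exact: homog_subspace.
rewrite (monoE P) degree_part_e; case: eqP => [->|_]; last exact: (homog_subspace n).1.
by exists (gexp P b), 1; rewrite gp1.
Qed.

Section Classify.
Variable M : set (carrier A).
Hypothesis Mcalc : calculus M.

Let MS : subspace M. Proof. by case: Mcalc. Qed.

Lemma calc_slice a b : M a -> M (slice b (AdL a)).
Proof. by case: Mcalc => _ _ _ h /h /(tens_subP _ MS). Qed.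

Lemma calc_degree_part n a : M a -> M (degree_part n a).
Proof. exact: calc_slice. Qed.

Lemma calc_mul x a : M a -> M (x * a).
Proof. by case: Mcalc => _ _ h _; apply: h. Qed.

Lemma calc_up n m p : M (gp P n m p) -> M (gp P n.+1 m p).
Proof. by move=> /(calc_mul (e 1 0)); rewrite mulX_gp. Qed.

Lemma calc_shift n m m' p : M (gp P n m p) -> M (gp P n m' p).
Proof.
move=> /(calc_mul (e 0 (m' - m))); rewrite mulg_gp addrCA subrr addr0.
move=> /(subspaceZ (q ^ ((m' - m) * n%:Z)) MS).
by rewrite scalerA -expfzDr // subrr expr0z scale1r.
Qed.

(** The term j = 1 of the adjoint coaction; its coefficient is a q-integer,
    nonzero because q is not a root of unity. *)
Lemma calc_down n m p : M (gp P n.+1 m p) -> M (gp P n m (p * (1 - Q ^+ n *: 'X))).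
Proof.
have E : slice (bx P 1 n%:Z) (AdL (gp P n.+1 m p)) =
    gauss Q n.+1 1 *: gp P n m (p * (1 - Q ^+ n *: 'X)).
  apply: (poly_ext (V := carrier A)
    (h := fun p => slice (bx P 1 n%:Z) (AdL (gp P n.+1 m p)))
    (h' := fun p => gauss Q n.+1 1 *: gp P n m (p * (1 - Q ^+ n *: 'X)))) p.
  - by move=> c x y; rewrite gp_linear AdL_linear slice_linear.
  - move=> c x y; rewrite mulrDl -scalerAl gp_linear scalerDr.
    by rewrite !scalerA mulrC.
  move=> i; rewrite /gp plin_Xn -/(gp P n m) slice_AdL_e // subn1 eqxx.
  by rewrite /gfactors subn1 big_nat1 gp_mulXn.
move=> /(calc_slice (bx P 1 n%:Z)); rewrite E.
move=> /(subspaceZ (gauss Q n.+1 1)^-1 MS).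
by rewrite scalerA mulVf ?gauss1_neq0 // scale1r.
Qed.

(** Multiplication by X^(i-r) transports the condition in degree i to degree r. *)
Lemma calc_ev i r a : (r <= i)%N -> (forall a, M a -> ev P i (q ^+ i) a = 0) ->
  M a -> ev P r (q ^+ i) a = 0.
Proof.
move=> ri iJ /(calc_mul (e (i - r) 0)) /iJ.
by rewrite ev_mul_e ?expf_neq0 // leq_subr mul0r oppr0 !expr0z !mul1r subKn.
Qed.

(** J collects the degrees i at which all of M vanishes at g = q^i. Membership of
    X^n p(g) in M, for p vanishing at the q^i with i in J and i >= n, is proved by
    descending induction on n. If p also vanishes at q^n, divide it by
    1 - q^(-n) g and use [calc_down]; this is always the case for n in J. For n not
    in J, some element of degree n of M does not vanish at q^n, and subtracting a
    multiple of it reduces to the first case. *)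
Lemma calc_classify N : M (e N 0) -> exists J, M = vanish_calc P J.
Proof.
move=> MN; pose J := [seq i <- iota 0 N | `[< forall a, M a -> ev P i (q ^+ i) a = 0 >]].
have JP i : i \in J -> forall a, M a -> ev P i (q ^+ i) a = 0.
  by rewrite mem_filter => /andP[/asboolP].
have JN i : (i < N)%N -> i \notin J -> exists2 a, M a & ev P i (q ^+ i) a != 0.
  rewrite mem_filter mem_iota /= add0n => -> ; rewrite andbT => /asboolPn.
  move=> h; apply: contrapT => nh; apply: h => a Ma; apply: contrapT => h.
  by apply: nh; exists a => //; apply/eqP.
have big n m p : (N <= n)%N -> M (gp P n m p).
  move=> Nn; have MX m' : M (gp P n m' 1).
    elim: n Nn m' => [|n IHn]; first by rewrite leqn0 => /eqP E m'; 
      apply: (@calc_shift _ 0); rewrite gp1 -E.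
    rewrite leq_eqVlt => /orP[/eqP <- m'|/IHn h m']; last exact: calc_up.
    by apply: (@calc_shift _ 0); rewrite gp1.
  rewrite /gp /plin; apply: subspace_sum => // i _.
  by rewrite -gp1.
have main d n m p : (N <= n + d)%N ->
    (forall i, i \in J -> (n <= i)%N -> p.[q ^+ i] = 0) -> M (gp P n m p).
  elim: d n m p => [|d IHd] n m p; first by rewrite addn0 => le _; apply: big.
  rewrite addnS -addSn => le pJ.
  have root p' : (forall i, i \in J -> (n < i)%N -> p'.[q ^+ i] = 0) ->
      p'.[q ^+ n] = 0 -> M (gp P n m p').
    move=> p'J /rootP /factor_theorem[r E].
    have -> : p' = (- q ^+ n *: r) * (1 - Q ^+ n *: 'X).
      rewrite E -scalerAl scalerAr; congr (_ * _).
      by rewrite scaleNr -scalerN opprB scalerBr scalerA -exprMn mulfV // expr1n scale1r alg_polyC.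
    apply/calc_down/IHd => // i iJ ni; rewrite hornerZ.
    have := p'J i iJ ni; rewrite E hornerM hornerXsubC => /eqP.
    rewrite mulf_eq0 subr_eq0 => /orP[/eqP ->|/eqP /expq_inj E']; first by rewrite mulr0.
    by rewrite E' ltnn in ni.
  case: (boolP (n \in J)) => nJ.
    by apply: root => [i iJ /ltnW|]; apply: pJ.
  case: (ltnP n N) => nN; last exact: big.
  have [a Ma an] := JN _ nN nJ; have Mp := calc_degree_part n Ma.
  have [m0 [p0 Ea]] := homog_degree_part n a; rewrite -ev_degree_part Ea in an.
  rewrite Ea in Mp; have qi i : q ^+ i != 0 by rewrite expf_neq0.
  have p0n : p0.[q ^+ n] != 0.
    by apply: contraNneq an => p0n; rewrite ev_gp // eqxx p0n mulr0.
  have p0J i : i \in J -> (n <= i)%N -> p0.[q ^+ i] = 0.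
    move=> iJ ni; have := calc_ev ni (JP _ iJ) Mp; rewrite ev_gp // eqxx.
    by move/eqP; rewrite mulf_eq0 expfz_eq0 (negPf (qi _)) andbF => /eqP.
  pose c := p.[q ^+ n] / p0.[q ^+ n].
  have -> : p = c *: p0 + (p - c *: p0) by rewrite addrC subrK.
  rewrite gpD gpZ; apply: subspaceD => //.
    by apply: subspaceZ => //; apply: calc_shift Mp.
  apply: root => [i iJ ni|]; rewrite !hornerE.
    by rewrite pJ ?p0J // ?mulr0 ?subrr // ltnW.
  by rewrite /c divfK // subrr.
exists J; apply/seteqP; split=> a Ma.
  move=> i r; rewrite inE => /orP[/eqP ->|iJ ri]; last exact: (calc_ev ri (JP _ iJ)).
  rewrite leqn0 => /eqP ->; rewrite expr0 -eps_ev.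
  by case: Mcalc => _ Mk _ _; apply: Mk.
have [R ->] := sum_degree_part a.
rewrite (eq_bigr (fun n : 'I_R => (1 : F) *: degree_part n a)); last first.
  by move=> n _; rewrite scale1r.
apply: subspace_sum => // n _; have [m [p E]] := homog_degree_part n a; rewrite E.
apply: (main N); first by rewrite leq_addl.
move=> i iJ ni; have qi : q ^+ i != 0 by rewrite expf_neq0.
have : ev P n (q ^+ i) (degree_part n a) = 0.
  rewrite /degree_part ev_slice_AdL // Ma ?mulr0 // inE iJ orbT //.
rewrite E ev_gp // eqxx.
by move/eqP; rewrite mulf_eq0 expfz_eq0 (negPf qi) andbF => /eqP.
Qed.

(** Among the n + 1 elements X, ..., X^(n+1) of the kernel of the counit some
    nontrivial combination is in M; the grading extracts one power of X. *)
Lemma calculus_dim_top n : calculus_dim M n -> exists N, M (e N 0).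
Proof.
move=> dM; have [|d [i di] Md] := dim_mod_dependent (w := fun i : 'I_n.+1 => e i.+1 0)
  MS dM (ltnSn n).
  by move=> i; rewrite /kereps /= bx_eps.
exists i.+1; move: (calc_degree_part i.+1 Md); rewrite (clinS (degree_part_linear _)).
under eq_bigr => j _ do rewrite (clinZ (degree_part_linear _)) degree_part_e.
rewrite (bigD1 i) //= eqxx big1 ?addr0 => [|j ji].
  by move/(subspaceZ (d i)^-1 MS); rewrite scalerA mulVf // scale1r.
by rewrite eqSS val_eqE eq_sym (negPf ji) scaler0.
Qed.

End Classify.

Lemma fd_calculus_classify M : fd_calculus A M -> exists J, M = vanish_calc P J.
Proof. by move=> [Mc [n /(calculus_dim_top Mc)[N /(calc_classify Mc)]]]. Qed.

End BqCalculiClassification.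

(** * Tangent spaces spanned by strings *)
Section BqTangent.
Context {F : fieldType} {q : F} (q0 : q != 0) {A : hopf F} (P : BqBasis q A).
Local Notation AA := (carrier (tensor A A)).
Local Notation Q := (q^-1).
Local Notation e n m := (mono (bx P n m)).
Implicit Types (x : carrier A) (c : F).

(** The adjoint action as a function of the coproduct of the acting element, so
    that [Delta_X] yields the recursion [adl_X]. *)
Definition adl_of x (w : AA) : carrier A :=
  lin (fun p : A * A => mono p.1 * x * antip (mono p.2)) w.

Lemma adl_of_linear x : linear (adl_of x : AA -> carrier A).
Proof. exact: lin_is_linear. Qed.

Lemma adl_of_tns x u v : adl_of x (u ⊗ v) = u * x * antip v.
Proof.
apply: (mono_ext (V := carrier A) (h := fun u => adl_of x (u ⊗ v))
  (h' := fun u => u * x * antip v)) u.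
- by move=> c y z; rewrite tnsA_linl adl_of_linear.
- by move=> c y z; rewrite !mul_linl.
move=> a; apply: (mono_ext (V := carrier A) (h := fun v => adl_of x (mono a ⊗ v))
  (h' := fun v => mono a * x * antip v)) v.
- by move=> c y z; rewrite tnsA_linr adl_of_linear.
- by move=> c y z; rewrite antip_linear mul_linr.
by move=> b; rewrite -(tns_monoE (a, b)) /adl_of /mono linU1.
Qed.

(** The adjoint action of X. *)
Definition adX x : carrier A := (e 1 0 * x : carrier A) + (e 0 1 * x * SX P : carrier A).

Lemma adX_linear : linear adX.
Proof. by move=> c x y; rewrite /adX !mul_linr mul_linl scalerDr addrACA. Qed.

Lemma adl_X h x : adl (e 1 0 * h) x = adX (adl h x).
Proof.
rewrite -[LHS]/(adl_of x _) -[adl h x]/(adl_of x _) Delta_X.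
apply: (mono_ext (D := tensor A A) (V := carrier A)
  (h := fun w => adl_of x (DX P * w)) (h' := fun w => adX (adl_of x w))).
- by move=> c y z; rewrite mul_linr adl_of_linear.
- by move=> c y z; rewrite adl_of_linear adX_linear.
move=> p; rewrite tns_monoE; move: (mono p.1) (mono p.2) => u v.
rewrite DX_tns (clinD (adl_of_linear x)) {1}(adl_of_tns x (e 1 0 * u)).
rewrite {1}(adl_of_tns x (e 0 1 * u)) (adl_of_tns x u) antip_X /adX.
exact: alg_sandwich.
Qed.

Lemma adl_e0 s x : adl (e 0 s) x = e 0 s * x * e 0 (- s).
Proof. by rewrite -[LHS]/(adl_of x _) bx_Delta0 adl_of_tns bx_antip0. Qed.

Lemma adl_eS n m x : adl (e n.+1 m) x = adX (adl (e n m) x).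
Proof. by rewrite -mulX_e adl_X. Qed.

(** The two terms of the adjoint action of X are proportional; their difference
    vanishes exactly at the end n + m = 0 of a string when q is generic. *)
Lemma adX_e n m : adX (e n m) = (1 - q ^ (- (n%:Z + m))) *: e n.+1 m.
Proof.
rewrite /adX mulX_e mulg_e scaleAl mul_e_SX scalerA mulrN mul1r -expfzDr //.
by rewrite -opprD scaleNr scalerBl scale1r.
Qed.

Lemma coef_adX x n m : (adX x)@_(bx P n m) =
  if n is n'.+1 then (1 - q ^ (- (n'%:Z + m))) * x@_(bx P n' m) else 0.
Proof.
apply: (mono_ext (V := F^o) (h := fun x => (adX x)@_(bx P n m))
  (h' := fun x => if n is n'.+1 then (1 - q ^ (- (n'%:Z + m))) * x@_(bx P n' m) else 0)) x.
- by move=> c y z; rewrite adX_linear mcoeff_linear.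
- move=> c y z; case: n => [|n]; first by rewrite scaler0 addr0.
  by rewrite mcoeff_linear mulrDr mulrCA.
move=> b; rewrite -(bxK P b) adX_e mcoeffZ !mono_coef bx_eq.
case: n => [|n]; first by rewrite mulr0.
by rewrite eqSS mono_coef bx_eq; case: andP => [[/eqP-> /eqP->] //|_]; rewrite !mulr0.
Qed.

Lemma coef_adg s x n m :
  (e 0 s * x * e 0 (- s))@_(bx P n m) = q ^ (- (s * n%:Z)) * x@_(bx P n m).
Proof.
apply: (mono_ext (V := F^o) (h := fun x => (e 0 s * x * e 0 (- s))@_(bx P n m))
  (h' := fun x => q ^ (- (s * n%:Z)) * x@_(bx P n m))) x.
- by move=> c y z; rewrite mul_linr mul_linl mcoeff_linear.
- by move=> c y z; rewrite mcoeff_linear mulrDr mulrCA.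
move=> b; rewrite -(bxK P b) mulg_e scaleAl mul_eg mcoeffZ !mono_coef addrAC subrr add0r bx_eq.
by case: andP => [[/eqP-> _] //|_]; rewrite !mulr0.
Qed.

Lemma eps_adX x : eps (adX x) = 0.
Proof.
apply: (mono_ext (V := F^o) (h := fun x => eps (adX x)) (h' := fun x => 0)) x.
- by move=> c y z; rewrite adX_linear eps_linear.
- by move=> c y z; rewrite scaler0 addr0.
by move=> b; rewrite -(bxK P b) adX_e (linear_scale eps_linear) bx_eps scaler0.
Qed.

Lemma eps_adg s x : eps (e 0 s * x * e 0 (- s)) = eps x.
Proof.
apply: (mono_ext (V := F^o) (h := fun x => eps (e 0 s * x * e 0 (- s))) (h' := eps)) x.
- by move=> c y z; rewrite mul_linr mul_linl eps_linear.
- by move=> c y z; rewrite eps_linear.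
move=> b; rewrite -(bxK P b) mulg_e scaleAl mul_eg (linear_scale eps_linear) !bx_eps.
case: eqP => [->|_]; last by rewrite scaler0.
by rewrite mulr0 oppr0 expr0z scale1r.
Qed.

Definition aug x : carrier A := x - eps x *: (1 : carrier A).

Lemma slice_coideal b x : slice b (coideal_slices x) = aug (slice b (Delta x)).
Proof.
have augl : linear aug.
  move=> c y z; rewrite /aug eps_linear scalerDl scalerBr opprD addrACA.
  by rewrite scalerA.
pose f (w : AA) : AA := lin (fun p : A * A =>
  mono p.1 ⊗ (mono p.2 - eps (mono p.2) *: (1 : carrier A))) w.
have fl : linear f by exact: lin_is_linear.
have fE p : f (mono p) = mono p.1 ⊗ aug (mono p.2) by rewrite /f /mono linU1.
rewrite -[coideal_slices x]/(f (Delta x)); move: (Delta x) => w.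
apply: (mono_ext (D := tensor A A) (V := carrier A)
  (h := fun w => slice b (f w)) (h' := fun w => aug (slice b w))) w.
- by move=> c y z; rewrite fl slice_linear.
- by move=> c y z; rewrite slice_linear augl.
move=> p; rewrite fE tns_monoE; move: (mono p.1) (mono p.2) => u v.
have E : slice b (u ⊗ v) = u@_b *: v by apply: slice_tns.
apply: etrans (slice_tns b u (aug v)) _.
by rewrite E (clinZ augl).
Qed.

Lemma slice_Delta_e s t n m : slice (bx P s t) (Delta (e n m)) =
  if (s <= n)%N && (t == m + (n - s)%N%:Z)
  then gauss Q n (n - s) *: e (n - s) m else 0.
Proof.
have sl (i : 'I_n.+1) :
    slice (bx P s t) (gauss Q n i *: (e (n - i) (m + i%:Z) ⊗ e i m)) =
    gauss Q n i *: ((((n - i)%N == s) && (m + i%:Z == t))%:R *: e i m).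
  by rewrite (linear_scale (slice_linear _)) slice_tns mono_coef bx_eq.
rewrite Delta_e (linear_bigsum (slice_linear _)) (eq_bigr _ (fun i _ => sl i)).
case: (leqP s n) => sn /=; last first.
  rewrite big1 // => i _; have -> : (n - i == s)%N = false by lia.
  by rewrite scale0r scaler0.
have sn' : (n - s < n.+1)%N by rewrite ltnS leq_subr.
rewrite (bigD1 (Ordinal sn')) //= subKn // eqxx big1 ?addr0 => [|i ij].
  by rewrite eq_sym; case: eqP => _; rewrite ?scale1r ?scale0r ?scaler0.
have -> : (n - i == s)%N = false.
  apply/negbTE; apply: contraNneq ij => E; apply/eqP/val_inj => /=.
  by have := ltn_ord i; lia.
by rewrite scale0r scaler0.
Qed.

(** The slice at X^s g^t keeps only monomials with m + r = t, and lowers their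
    degree by s. With s = 0 it is the projection separating the values of
    n + m. *)
Lemma coef_slice_Delta s t x r m : (slice (bx P s t) (Delta x))@_(bx P r m) =
  if t == m + r%:Z then gauss Q (r + s) r * x@_(bx P (r + s) m) else 0.
Proof.
apply: (mono_ext (V := F^o) (h := fun x => (slice (bx P s t) (Delta x))@_(bx P r m))
  (h' := fun x => if t == m + r%:Z then
    gauss Q (r + s) r * x@_(bx P (r + s) m) else 0)) x.
- by move=> c y z; rewrite Delta_linear slice_linear mcoeff_linear.
- move=> c y z; case: eqP => _; last by rewrite scaler0 addr0.
  by rewrite mcoeff_linear mulrDr mulrCA.
move=> b; rewrite -(bxK P b); move: (xdeg P b) (gexp P b) => n k.
rewrite slice_Delta_e mono_coef bx_eq; case: (leqP s n) => sn /=; last first.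
  have -> : (n == r + s)%N = false by lia.
  by rewrite mulr0 mcoeff0 if_same.
have -> : (n == r + s)%N = (n - s == r)%N by lia.
case: (eqVneq (n - s)%N r) => [E|ne].
  have -> : (r + s)%N = n by lia.
  rewrite E; case: (eqVneq k m) => [->|km].
    by case: eqP; rewrite ?mcoeff0 // mcoeffZ mono_coef eqxx.
  by rewrite mulr0 if_same; case: eqP; rewrite ?mcoeff0 // mcoeffZ mono_coef bx_eq
    (negPf km) andbF mulr0.
rewrite mulr0 if_same; case: eqP; rewrite ?mcoeff0 // mcoeffZ mono_coef bx_eq.
by rewrite (negPf ne) mulr0.
Qed.

(** The columns g^(-i), X g^(-i), ..., X^i g^(-i), for i in J and for i = 0; the
    last one consists of the unit only. *)
Definition strings (J : seq nat) (b : A) : bool :=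
  [&& gexp P b <= 0, `|gexp P b|%N \in 0%N :: J & (xdeg P b <= `|gexp P b|)%N].

Lemma strings_bx J n m : strings J (bx P n m) =
  [&& m <= 0, `|m|%N \in 0%N :: J & (n <= `|m|)%N].
Proof. by rewrite /strings xdegE gexpE. Qed.

Lemma strings1 J : strings J (bx P 0 0).
Proof. by rewrite strings_bx inE. Qed.

Lemma eps_one : eps (e 0 0) = 1.
Proof. by rewrite bx_eps. Qed.

(** The coproduct only lowers degrees. The adjoint action of X raises them, but
    its coefficient is zero at the top of each string. *)
Lemma supp_tangent J : tangent_space (supp_on (strings J)).
Proof.
have LS := @supp_on_subspace _ A (strings J).
split=> // [x []//|y x Lx|x [ex Sx]].
  rewrite [y]mono_sumE (clinS (adl_linl x)).
  rewrite (eq_bigr _ (fun b _ => clinZ (adl_linl x) _ _)).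
  apply: subspace_sum => // b _; rewrite (monoE P); move: (xdeg P b) (gexp P b) => n m.
  elim: n => [|n [ey Sy]].
    rewrite adl_e0; case: Lx => ex Sx; split; first by rewrite eps_adg.
    by move=> b' nb'; rewrite -(bxK P b') coef_adg bxK Sx // mulr0.
  rewrite adl_eS; split; first exact: eps_adX.
  move=> b'; rewrite -(bxK P b') coef_adX strings_bx.
  move: (xdeg P b') (gexp P b') => [//|k] l nb'.
  case: (boolP (strings J (bx P k l))) => [|h]; last by rewrite Sy // mulr0.
  rewrite strings_bx => /and3P[l0 lJ kl]; rewrite l0 lJ -ltnNge ltnS /= in nb'.
  have -> : k%:Z + l = 0 by lia.
  by rewrite oppr0 expr0z subrr mul0r.
apply/tens_subP => // b; rewrite -[lin _ _]/(coideal_slices x) slice_coideal.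
rewrite -(bxK P b); move: (xdeg P b) (gexp P b) => s t.
split=> [|b' nb'].
  rewrite /aug addrC -scaleNr eps_linear -(bx_one P) eps_one [_ *: _]mulr1.
  exact: addNr.
have nb1 : b' != bx P 0 0 by apply: contraNneq nb' => ->; apply: strings1.
rewrite /aug mcoeffB mcoeffZ -(bx_one P) mono_coef eq_sym (negPf nb1) mulr0 subr0.
rewrite -(bxK P b') coef_slice_Delta; case: eqP => // _; rewrite Sx ?mulr0 //.
apply: contra nb'; rewrite /strings xdegE gexpE => /and3P[-> -> h] /=.
by apply: leq_trans h; rewrite leq_addr.
Qed.

End BqTangent.

(** * Classification of the finite dimensional tangent spaces *)
Section BqTangentClassification.
Context {F : fieldType} {q : F} (q0 : q != 0) {A : hopf F} (P : BqBasis q A).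
Hypothesis qgen : forall n, q ^+ n.+1 != 1.
Local Notation Q := (q^-1).
Local Notation e n m := (mono (bx P n m)).
Local Notation b1 := (bx P 0 0).
Implicit Types (x : carrier A) (c : F).

Lemma gaussSn_neq0 n : gauss Q n.+1 n != 0.
Proof. by rewrite gaussSn -gaussn1; apply: gauss1_neq0. Qed.

Lemma expqz_eq1 (z : int) : q ^ z = 1 -> z = 0.
Proof.
case: z => [[|k]|k] // /eqP; first by rewrite -exprnP (negPf (qgen k)).
by rewrite NegzE -exprnN invr_eq1 (negPf (qgen k)).
Qed.

Lemma augmE b : augm b1 b = aug (mono b).
Proof. by rewrite /augm /aug (bx_one P). Qed.

Lemma augm_pos n m : augm b1 (bx P n.+1 m) = e n.+1 m.
Proof. by rewrite /augm bx_eps scale0r subr0. Qed.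

Section Classify.
Variable L : set (carrier A).
Hypothesis LT : tangent_space L.

Let LS : subspace L. Proof. by case: LT. Qed.
Let Leps x : L x -> eps x = 0. Proof. by case: LT => _ h _ _ /h. Qed.
Let Ladl h x : L x -> L (adl h x). Proof. by case: LT => _ _ Lh _; apply: Lh. Qed.
Let Laug b x : L x -> L (aug (slice b (Delta x))).
Proof.
by case: LT => _ _ _ Lh /Lh /(tens_subP _ LS) h; rewrite -slice_coideal; apply: h.
Qed.

(** The adjoint action of g is diagonal with eigenvalue q^(-n) in degree n, so
    shifting by q^(-n) erases degree n. *)
Lemma tangent_filter (s : seq nat) x : L x ->
  exists2 y, L y & forall b,
    y@_b = (\prod_(n <- s) (Q ^+ xdeg P b - Q ^+ n)) * x@_b.
Proof.
move=> Lx; elim: s => [|n s [y Ly yE]].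
  by exists x => // b; rewrite big_nil mul1r.
exists (adl (e 0 1) y - Q ^+ n *: y).
  by apply: subspaceB => //; [apply: Ladl | apply: subspaceZ].
move=> b; rewrite mcoeffB mcoeffZ adl_e0 -(bxK P b) coef_adg // bxK.
by rewrite mul1r expQ yE big_cons -mulrBl mulrA.
Qed.

(** First isolate the monomials with the same n + m as b by a slice of the
    coproduct, then erase the other degrees by [tangent_filter]. What is left is
    a multiple of b up to the unit, hence of its augmentation. *)
Lemma tangent_augm x b : L x -> x@_b != 0 -> L (augm b1 b).
Proof.
move=> Lx xb; case: (eqVneq b b1) => [->|nb].
  by rewrite /augm eps_one scale1r subrr; case: LS.
pose n := xdeg P b; pose t := gexp P b + n%:Z.
have Ly := Laug (bx P 0 t) Lx; move: Ly; set y := aug _ => Ly.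
have yE b' : b' != b1 -> y@_b' = if t == gexp P b' + (xdeg P b')%:Z then x@_b' else 0.
  move=> nb'; rewrite /y /aug mcoeffB mcoeffZ -(bx_one P) mono_coef eq_sym.
  rewrite (negPf nb') mulr0 subr0 -{1}(bxK P b') (coef_slice_Delta q0) addn0 bxK.
  by rewrite gaussnn mul1r.
have [z Lz zE] := tangent_filter [seq k <- undup (map (xdeg P) (msupp y)) | k != n] Ly.
have zb : z@_b != 0.
  rewrite zE yE // eqxx mulf_neq0 // prodf_seq_neq0; apply/allP => k.
  rewrite mem_filter => /andP[kn _]; apply/implyP => _.
  by rewrite subr_eq0; apply: contraNneq kn; rewrite !exprVn => /invr_inj /(expq_inj q0 qgen) <-.
have zs b' : b' != b1 -> b' != b -> z@_b' = 0.
  move=> nb' bb'; rewrite zE yE //; case: eqP => [tE|_]; last by rewrite mulr0.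
  case: (eqVneq (xdeg P b') n) => [nE|nn].
    case/eqP: bb'; rewrite -(bxK P b') -(bxK P b) nE; congr (bx P _ _).
    by move: tE; rewrite nE /t => /addIr.
  case: (boolP (b' \in msupp y)) => [by'|/mcoeff_outdom].
    rewrite (bigD1_seq (xdeg P b')) /= ?subrr ?mul0r //; last first.
      by rewrite filter_uniq ?undup_uniq.
    by rewrite mem_filter nn mem_undup map_f.
  by rewrite yE // tE eqxx => ->; rewrite mulr0.
have Sz : supp_on (pred2 b1 b) z.
  split=> [|b']; first exact: Leps.
  by rewrite /= negb_or => /andP[]; apply: zs.
have := supp_onE (eps_one P) Sz.
have bz : b \in msupp z by rewrite -mcoeff_neq0.
rewrite -big_filter (bigD1_seq b) /=; first last.
- by rewrite filter_uniq ?fset_uniq.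
- by rewrite mem_filter nb.
rewrite big1_seq ?addr0 => [E|b']; last first.
  by rewrite mem_filter => /and3P[bb' nb' _]; rewrite zs // scale0r.
rewrite E in Lz; move: Lz => /(subspaceZ (z@_b)^-1 LS).
by rewrite scalerA mulVf // scale1r.
Qed.

Definition in_tangent (b : A) : bool := `[< L (augm b1 b) >].
Local Notation T := in_tangent.

Lemma in_tangentP b : reflect (L (augm b1 b)) (T b).
Proof. exact: asboolP. Qed.

Lemma tangent_suppE : L = supp_on T.
Proof.
apply/seteqP; split=> x Lx.
  split=> [|b nT]; first exact: Leps.
  by apply: contraNeq nT => xb; apply/in_tangentP/(tangent_augm Lx).
rewrite (supp_onE (eps_one P) Lx).
rewrite (eq_bigr (fun b => x@_b *: (if T b then augm b1 b else 0))) => [|b _].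
  apply: subspace_sum => // b _.
  by case: (boolP (T b)) => [/in_tangentP //|_]; case: LS.
by case: (boolP (T b)) => // nT; rewrite (Lx.2 _ nT) !scale0r.
Qed.

Lemma in_tangent_up n m : n%:Z + m != 0 -> T (bx P n m) -> T (bx P n.+1 m).
Proof.
move=> nm /in_tangentP /(Ladl (e 1 0)); set c := 1 - q ^ (- (n%:Z + m)).
have c0 : c != 0.
  rewrite subr_eq0; apply: contraNneq nm => E.
  by rewrite -oppr_eq0; apply/eqP/expqz_eq1.
have -> : adl (e 1 0) (augm b1 (bx P n m)) = c *: e n.+1 m.
  rewrite -[e 1 0]alg1r -(bx_one P) adl_X adl_e0 oppr0 /augm.
  rewrite (bx_one P) alg1l alg1r -(bx_one P) addrC -scaleNr adX_linear !adX_e //.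
  by rewrite addr0 oppr0 expr0z subrr scale0r scaler0 add0r.
move=> /(subspaceZ c^-1 LS); rewrite scalerA mulVf // scale1r => h.
by apply/in_tangentP; rewrite augm_pos.
Qed.

Lemma in_tangent_down n m : T (bx P n.+1 m) -> T (bx P n m).
Proof.
move=> /in_tangentP; rewrite augm_pos => /(Laug (bx P 1 (m + n%:Z))).
rewrite (slice_Delta_e q0) /= subn1 eqxx /= => h.
apply/in_tangentP; move: h => /(subspaceZ (gauss Q n.+1 n)^-1 LS).
rewrite augmE /aug (linear_scale eps_linear) -scalerA -scalerBr scalerA.
by rewrite mulVf ?gaussSn_neq0 // scale1r.
Qed.

(** The set T of monomials whose augmentation is in L is closed under lowering the
    degree, and under raising it except at n + m = 0. A column that is nonempty
    contains g^m; if its exponent m is not some -i with i >= 0, or if it contains a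
    degree above i, then raising never stops, contradicting finiteness. *)
Lemma tangent_classify d : dim_mod L [set 0] d -> exists J, L = supp_on (strings P J).
Proof.
case=> v [vL vB]; pose D := flatten [seq enum_fset (msupp (v i)) | i <- iota 0 d].
have TD b : b != b1 -> T b -> b \in D.
  move=> nb /in_tangentP /vB[c [/= /eqP + _]]; rewrite subr_eq0 => /eqP E.
  have : (augm b1 b)@_b != 0 by rewrite augm_coef // eqxx oner_neq0.
  rewrite E; apply: contraNT => bD.
  rewrite (linear_bigsum (mcoeff_linear b)) big1 // => i _.
  rewrite mcoeffZ; case: (boolP (b \in msupp (v i))) => [bv|/mcoeff_outdom ->].
    case/negP: bD; apply/flattenP; exists (enum_fset (msupp (v i))) => //.
    by apply/mapP; exists (val i) => //; rewrite mem_iota /= add0n.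
  exact: mulr0.
(* D contains all monomials of T except possibly the unit, since v spans L. *)
pose J := [seq i <- [seq `|gexp P b|%N | b <- D] | T (bx P 0 (- i%:Z))].
exists J; rewrite tangent_suppE; congr supp_on; apply/funext => b.
have Tb1 : T b1.
  by apply/in_tangentP; rewrite /augm eps_one scale1r subrr; case: LS.
case: (eqVneq b b1) => [->|nb]; first by rewrite strings1 Tb1.
rewrite -(bxK P b) strings_bx in nb *; move: (xdeg P b) (gexp P b) nb => r m nb.
have JP i : i \in 0%N :: J -> T (bx P 0 (- i%:Z)).
  by rewrite inE mem_filter => /orP[/eqP ->|/andP[]//]; rewrite oppr0.
apply/idP/and3P => [Trm|[m0 mJ rm]]; last first.
  have {m0} -> : m = - (`|m|%N)%:Z by lia.
  elim: r rm {nb} => [|r IHr] rm; first exact: JP.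
  by apply: in_tangent_up; [lia | apply/IHr/ltnW].
have [n [rn Tn mE]] : exists n, [/\ (r <= n)%N, T (bx P n m) & m = - n%:Z].
  apply: contrapT => h.
  have Tall k : T (bx P (r + k) m).
    elim: k => [|k IHk]; first by rewrite addn0.
    rewrite addnS; apply: in_tangent_up => //; apply/eqP => E; apply: h.
    by exists (r + k)%N; split; [exact: leq_addr | | lia].
  pose N := (\max_(b <- D) xdeg P b)%N.
  have := TD _ _ (Tall N.+1); rewrite bx_eq addnS => /(_ isT) bD.
  suff : (xdeg P (bx P (r + N).+1 m) <= N)%N by rewrite xdegE; lia.
  by rewrite /N; apply: (@leq_bigmax_seq _ _ _ (xdeg P)).
rewrite mE; split; [lia | | lia].
have T0 : T (bx P 0 (- n%:Z)).
  rewrite -mE; elim: n Tn {rn mE} => [|n IHn]; first exact: id.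
  by move/in_tangent_down; exact: IHn.
case: n {rn Tn mE} T0 => [|n] T0; first by rewrite oppr0 inE.
rewrite inE mem_filter abszN absz_nat T0 /=; apply/mapP; exists (bx P 0 (- n.+1%:Z)).
  by apply: TD => //; rewrite bx_eq.
by rewrite gexpE abszN absz_nat.
Qed.

End Classify.
Lemma fd_tangent_classify L : fd_tangent_space A L -> exists J, L = supp_on (strings P J).
Proof. by move=> [LT [d /(tangent_classify LT)]]. Qed.

End BqTangentClassification.

(** * Combinatorics of strings *)
Section Strings.
Context {F : fieldType} {q : F} {K : hopf F} (P : BqBasis q K).
Local Notation b1 := (bx P 0 0).

Definition string_seq (J : seq nat) : seq K :=
  [seq bx P r (- i%:Z) | i <- 0%N :: J, r <- iota 0 i.+1].

Lemma mem_string_seq J : strings P J =1 mem (string_seq J).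
Proof.
move=> b; rewrite -(bxK P b) strings_bx; move: (xdeg P b) (gexp P b) => r m.
apply/and3P/allpairsPdep => [[m0 mJ rm]|[i [r' [iJ]]]].
  exists `|m|%N, r; split => //; first by rewrite mem_iota add0n ltnS.
  by congr (bx P _ _); lia.
rewrite mem_iota add0n ltnS => ri /eqP; rewrite bx_eq => /andP[/eqP-> /eqP->].
by rewrite abszN absz_nat; split=> //; lia.
Qed.

(** The strings without the unit: the augmentations of these monomials form a
    basis of the tangent space. *)
Definition string_seq1 (J : seq nat) : seq K := filter (predC1 b1) (undup (string_seq J)).

Lemma string_seq1_uniq J : uniq (b1 :: string_seq1 J).
Proof. by rewrite /= mem_filter /= eqxx filter_uniq // undup_uniq. Qed.

Lemma string_seq1E J : strings P J =1 mem (b1 :: string_seq1 J).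
Proof.
move=> b; rewrite /= inE mem_filter mem_undup -[b \in string_seq J]mem_string_seq /=.
by case: eqVneq => // ->; apply: strings1.
Qed.

Definition column (i : nat) : seq K := [seq bx P r (- i%:Z) | r <- iota 0 i.+1].

Lemma column_uniq i : (0 < i)%N -> uniq (b1 :: column i).
Proof.
move=> i0; rewrite cons_uniq; apply/andP; split.
  apply/mapP => [[r _ /eqP]]; rewrite bx_eq => /andP[_ /eqP]; lia.
rewrite map_inj_uniq ?iota_uniq // => r r' /eqP.
by rewrite bx_eq => /andP[/eqP].
Qed.

Lemma columnE i : strings P [:: i] =1 mem (b1 :: column i).
Proof.
move=> b; rewrite mem_string_seq; congr (b \in _).
by rewrite /string_seq /column /= cats0 oppr0.
Qed.

Lemma size_column i : size (column i) = i.+1.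
Proof. by rewrite size_map size_iota. Qed.

Lemma strings_cat J J' b : strings P (J ++ J') b = strings P J b || strings P J' b.
Proof.
rewrite /strings !inE mem_cat; case: (_ <= _) => //=; case: (_ <= _)%N; rewrite ?andbF //.
by rewrite !andbT; case: (_ == _).
Qed.

Lemma strings_filter J J' b :
  strings P [seq i <- J | i \in J'] b = strings P J b && strings P J' b.
Proof.
rewrite /strings !inE mem_filter; case: (_ <= _) => //=; case: (_ <= _)%N; rewrite ?andbF //.
by rewrite !andbT andbC; case: (_ == _).
Qed.

Lemma strings_single_sub J i : i \in J -> subpred (strings P [:: i]) (strings P J).
Proof.
move=> iJ b /and3P[m0 mi rb]; apply/and3P; split=> //.
by move: mi; rewrite !inE => /orP[->//|/eqP ->]; rewrite iJ orbT.
Qed.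

Lemma strings_top i J : (0 < i)%N -> strings P J (bx P 0 (- i%:Z)) = (i \in J).
Proof.
move=> i0; rewrite strings_bx abszN absz_nat inE andbT.
have -> : (i == 0%N) = false by lia.
by have -> : (- i%:Z <= 0) by lia.
Qed.

End Strings.

(** * The two families attached to strings *)
Section PairedFamilies.
Context {F : fieldType} {q : F} {A K : hopf F} (P : BqBasis q K).
Context (pairb : A -> K -> F).
Local Notation pr := (pairing pairb).
Local Notation b1 := (bx P 0 0).

Hypothesis pr_b1 : forall a, pr a (mono b1) = eps a.
Hypothesis interpolation : forall (b0 : K) (s : seq K), b0 \notin s ->
  exists2 a, pr a (mono b0) != 0 & forall b, b \in s -> pr a (mono b) = 0.

Definition calc_str J : set (carrier A) := ann_of pairb (strings P J).
Definition tan_str J : set (carrier K) := supp_on (strings P J).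

Lemma calc_str_eq J J' : strings P J =1 strings P J' -> calc_str J = calc_str J'.
Proof. by move=> E; rewrite /calc_str; congr ann_of; apply/funext. Qed.

Lemma tan_str_eq J J' : strings P J =1 strings P J' -> tan_str J = tan_str J'.
Proof. by move=> E; rewrite /tan_str; congr supp_on; apply/funext. Qed.

Let string_seq_in J b : strings P J b -> b \in string_seq P J.
Proof. by rewrite mem_string_seq. Qed.

Lemma calc_str_tangent J : tangent_of pairb (calc_str J) = tan_str J.
Proof. exact: (tangent_ann_of interpolation (strings1 P J) (string_seq_in (J := J))). Qed.

Lemma calc_str_inj J J' : calc_str J = calc_str J' -> strings P J =1 strings P J'.
Proof.
exact: (ann_of_inj (eps_one P) interpolation (strings1 P J) (strings1 P J')
  (string_seq_in (J := J)) (string_seq_in (J := J'))).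
Qed.

Lemma tan_str_inj J J' : tan_str J = tan_str J' -> strings P J =1 strings P J'.
Proof. exact: (supp_on_inj (eps_one P) (strings1 P J) (strings1 P J')). Qed.

Lemma dim_calc_str J : calculus_dim (calc_str J) (size (string_seq1 P J)).
Proof. exact: (dim_ann_of pr_b1 interpolation (string_seq1_uniq P J) (string_seq1E P J)). Qed.

Lemma dim_tan_str J : dim_mod (tan_str J) [set 0] (size (string_seq1 P J)).
Proof. exact: (dim_supp_on (eps_one P) (string_seq1_uniq P J) (string_seq1E P J)). Qed.

Lemma dim_calc_str1 i : (0 < i)%N -> calculus_dim (calc_str [:: i]) i.+1.
Proof.
move=> i0; rewrite -(size_column P).
exact: (dim_ann_of pr_b1 interpolation (column_uniq P i0) (columnE P i)).
Qed.

Lemma dim_tan_str1 i : (0 < i)%N -> dim_mod (tan_str [:: i]) [set 0] i.+1.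
Proof.
move=> i0; rewrite -(size_column P).
exact: (dim_supp_on (eps_one P) (column_uniq P i0) (columnE P i)).
Qed.

Lemma calc_str_cap J J' : calc_str J `&` calc_str J' = calc_str (J ++ J').
Proof.
apply/seteqP; split=> [a [Ma Ma'] b|a Ma].
  by rewrite strings_cat => /orP[/Ma|/Ma'].
by split=> b h; apply: Ma; rewrite strings_cat h ?orbT.
Qed.

Lemma tan_str_cap J J' : tan_str J `&` tan_str J' = tan_str [seq i <- J | i \in J'].
Proof.
apply/seteqP; split=> [x [[ex Sx] [_ Sx']]|x [ex Sx]].
  by split=> // b; rewrite strings_filter negb_and => /orP[/Sx|/Sx'].
split; split=> // b /negPf h; apply: Sx; rewrite strings_filter h ?andbF //.
Qed.

Lemma calc_str_sub J J' : subpred (strings P J) (strings P J') -> calc_str J' `<=` calc_str J.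
Proof. by move=> s a Ma b /s /Ma. Qed.

Lemma tan_str_sub J J' : subpred (strings P J) (strings P J') -> tan_str J `<=` tan_str J'.
Proof. by move=> s x [ex Sx]; split=> // b nb; apply: Sx; apply: contra nb => /s. Qed.

Lemma strings_trivial J b : (forall i, i \in J -> i = 0%N) -> strings P J b -> b = b1.
Proof.
move=> J0; rewrite -(bxK P b) strings_bx => /and3P[_].
rewrite inE => h r0; have m0 : `|gexp P b|%N = 0%N by case/orP: h => [/eqP|/J0].
rewrite m0 leqn0 in r0; rewrite (eqP r0); congr (bx P _ _).
by apply/eqP; rewrite -absz_eq0 m0.
Qed.

Lemma calc_str_kereps J : (forall i, i \in J -> i = 0%N) -> calc_str J = kereps A.
Proof.
move=> J0; apply/seteqP; split=> a.
  exact: (ann_of_sub_kereps pr_b1 (strings1 P J)).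
by move=> ea b /(strings_trivial J0) ->; rewrite pr_b1.
Qed.

Lemma tan_str_zero J : (forall i, i \in J -> i = 0%N) -> tan_str J = [set 0].
Proof.
move=> J0; apply/seteqP; split=> x; last by move=> ->; case: (supp_on_subspace (strings P J)).
move=> Sx; rewrite /= (supp_onE (eps_one P) Sx) big1 // => b nb.
rewrite Sx.2 ?scale0r //; apply: contra nb => /(strings_trivial J0) ->.
exact: eqxx.
Qed.

End PairedFamilies.

(** * Irreducible objects *)
Section Irreducible.
Context {F : fieldType} {q : F} {A K : hopf F} (P : BqBasis q K).
Context (pairb : A -> K -> F).
Local Notation pr := (pairing pairb).
Local Notation b1 := (bx P 0 0).
Local Notation calc_str := (calc_str P pairb).
Local Notation tan_str := (tan_str P).

Hypothesis pr_b1 : forall a, pr a (mono b1) = eps a.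
Hypothesis interpolation : forall (b0 : K) (s : seq K), b0 \notin s ->
  exists2 a, pr a (mono b0) != 0 & forall b, b \in s -> pr a (mono b) = 0.

(** Each nonzero i in J gives a calculus that contains the one of J and is
    different from the kernel of the counit, hence equal to the one of J. *)
Lemma coirreducible_single J n : (forall J, calculus (calc_str J)) ->
  coirreducible (calc_str J) -> calculus_dim (calc_str J) n ->
  exists2 i, (0 < i)%N & n = i.+1 /\ calc_str J = calc_str [:: i].
Proof.
move=> Mc [_ Mk Mmax] Mn.
have [i iJ i0] : exists2 i, i \in J & (0 < i)%N.
  apply: contrapT => h; apply: Mk; apply: calc_str_kereps => // i iJ.
  by case: (posnP i) => // i0; case: h; exists i.
exists i => //; have [E|E] := Mmax _ (Mc [:: i]) (calc_str_sub (strings_single_sub iJ)).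
  split; last by rewrite E.
  apply: (dim_mod_uniq _ Mn); first exact: ann_of_subspace.
  by rewrite -E; apply: dim_calc_str1.
have : calc_str [:: i] = calc_str [::] by rewrite E calc_str_kereps.
by move/(calc_str_inj interpolation)/(_ (bx P 0 (- i%:Z))); rewrite !strings_top // inE eqxx.
Qed.

Lemma irreducible_single J n : (forall J, tangent_space (tan_str J)) ->
  irreducible_tangent_space (tan_str J) -> dim_mod (tan_str J) [set 0] n ->
  exists2 i, (0 < i)%N & n = i.+1 /\ tan_str J = tan_str [:: i].
Proof.
move=> Lt [_ Lz Lmin] Ln.
have [i iJ i0] : exists2 i, i \in J & (0 < i)%N.
  apply: contrapT => h; apply: Lz; apply: tan_str_zero => // i iJ.
  by case: (posnP i) => // i0; case: h; exists i.
exists i => //; have [E|E] := Lmin _ (Lt [:: i]) (tan_str_sub (strings_single_sub iJ)).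
  have : tan_str [:: i] = tan_str [::] by rewrite E tan_str_zero.
  by move/tan_str_inj/(_ (bx P 0 (- i%:Z))); rewrite !strings_top // inE eqxx.
split; last by rewrite E.
apply: (dim_mod_uniq (@subspace_set0 _ _) Ln).
by rewrite -E; apply: dim_tan_str1.
Qed.

End Irreducible.

(** * The self-pairing for generic q *)
Section BqSelfPairing.
Context {F : fieldType} {q : F} (q0 : q != 0).
Hypothesis qgen : forall n, q ^+ n.+1 != 1.
Local Notation B := (Bq q0).
Local Notation P := (Bq_basis q0).
Local Notation pr := (pairing (@Bq_pair _ _ q0)).

Definition pair_weight (r : nat) : F := qfact q r * q ^- (r * r.-1)./2.

Lemma pair_weight_neq0 r : pair_weight r != 0.
Proof.
rewrite mulf_neq0 ?invr_eq0 ?expf_neq0 // /qfact big_add1 big_mkord.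
apply/prodf_neq0 => i _; apply: contraNneq (qgen i) => E.
by have := subrX1 q i.+1; rewrite -/(qint q i.+1) E mulr0 => /eqP; rewrite subr_eq0.
Qed.

Lemma pairing_ev a (b : B) :
  pr a (mono b) = pair_weight b.1 * ev P b.1 (q ^ (- b.2)) a.
Proof.
apply: (mono_ext (V := F^o) (h := fun a => pr a (mono b))
  (h' := fun a => pair_weight b.1 * ev P b.1 (q ^ (- b.2)) a)) a.
- exact: pairing_linl.
- by move=> c x y; rewrite evD evZ mulrDr mulrCA.
case=> n m; rewrite pairingUU /Bq_pair -[mono _]/(mono (bx P n m)) ev_e /=.
case: eqP => [->|_]; last by rewrite mulr0.
by rewrite /pair_weight exprz_exp mulNr [b.2 * m]mulrC.
Qed.

Lemma Bq_pr_b1 a : pr a (mono (bx P 0 0)) = eps a.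
Proof.
rewrite pairing_ev (eps_ev P) /= oppr0 expr0z /pair_weight /qfact big_geq //.
by rewrite mul0n expr0 invr1 !mul1r.
Qed.

(** Lagrange interpolation in g, at the pairwise distinct points q^(-m). *)
Lemma Bq_interpolation (b0 : B) (s : seq B) : b0 \notin s ->
  exists2 a, pr a (mono b0) != 0 & forall b, b \in s -> pr a (mono b) = 0.
Proof.
move=> b0s; pose p := \prod_(b <- [seq b <- s | b.1 == b0.1]) ('X - (q ^ (- b.2))%:P).
have qz (z : int) : q ^ z != 0 by rewrite expfz_eq0 (negPf q0) andbF.
exists (gp P b0.1 0 p) => [|b bs]; rewrite pairing_ev ev_gp //.
  rewrite eqxx expr0z mul1r mulf_neq0 ?pair_weight_neq0 // /p horner_prod.
  rewrite prodf_seq_neq0; apply/allP => b; rewrite mem_filter => /andP[/eqP bb bs].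
  rewrite hornerXsubC subr_eq0; apply/implyP => _; apply: contraNneq b0s => E.
  have : q ^ (b.2 - b0.2) = 1.
    by rewrite addrC expfzDr // E -expfzDr // addrC subrr.
  move/(expqz_eq1 qgen)/eqP; rewrite subr_eq0 => /eqP E2.
  by move: bs; rewrite [b]surjective_pairing [b0]surjective_pairing bb E2.
case: eqP => [bb|_]; last by rewrite mulr0.
rewrite /p horner_prod (big_rem b) /=; last by rewrite mem_filter bb eqxx.
by rewrite hornerXsubC subrr mul0r !mulr0.
Qed.

Lemma calc_strE J : calc_str P (@Bq_pair _ _ q0) J = vanish_calc P J.
Proof.
apply/seteqP; split=> a Ma.
  move=> i r iJ ri; have /Ma : strings P J (bx P r (- i%:Z)).
    by rewrite strings_bx abszN absz_nat iJ ri; lia.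
  rewrite pairing_ev /= opprK => /eqP.
  by rewrite mulf_eq0 (negPf (pair_weight_neq0 r)) => /eqP.
move=> b /and3P[m0 mJ rb]; rewrite pairing_ev.
have -> : - b.2 = (`|b.2|%N)%:Z by move: m0 => /=; lia.
by rewrite -exprnP Ma // mulr0.
Qed.

Lemma fd_calculus_BqE :
  fd_calculus B = [set M | exists J, M = calc_str P (@Bq_pair _ _ q0) J].
Proof.
apply/seteqP; split=> M /=.
  by case/(fd_calculus_classify q0 P qgen) => J ->; exists J; rewrite calc_strE.
case=> J ->; split; first by rewrite calc_strE; apply: vanish_calc_calculus.
exists (size (string_seq1 P J)); apply: dim_calc_str.
  exact: Bq_pr_b1.
exact: Bq_interpolation.
Qed.

End BqSelfPairing.

Section BqTangentSpaces.
Context {F : fieldType} {q : F} (q0 : q != 0).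
Local Notation P := (Bq_basis q0).

Lemma tan_str_fd J : fd_tangent_space (Bq q0) (tan_str P J).
Proof. by split; [apply: supp_tangent | exists (size (string_seq1 P J)); apply: dim_tan_str]. Qed.

Lemma fd_tangent_BqE : (forall n, q ^+ n.+1 != 1) ->
  fd_tangent_space (Bq q0) = [set L | exists J, L = tan_str P J].
Proof.
move=> qgen; apply/seteqP; split=> L /=.
  by case/(fd_tangent_classify q0 P qgen) => J ->; exists J.
by case=> J ->; apply: tan_str_fd.
Qed.

End BqTangentSpaces.

Lemma qvar_generic (k : fieldType) n : qvar k ^+ n.+1 != 1.
Proof.
rewrite /qvar /ofpoly -tofracXn -tofrac1 tofrac_eq.
apply/eqP => /(congr1 (fun p : {poly k} => size p)).
by rewrite size_polyXn size_poly1.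
Qed.

(** * The enveloping algebra *)
Section PrimitiveElement.
Context {F : fieldType} {A : hopf F} (y : carrier A).
Local Notation AA := (carrier (tensor A A)).

Definition prim_Delta : AA := y ⊗ 1 + 1 ⊗ y.

Hypothesis Delta_y : forall a, Delta (y * a) = prim_Delta * Delta a.
Hypothesis antip_y : forall a, antip (y * a) = antip a * - y.

Lemma prim_tns u v : prim_Delta * (u ⊗ v) = (y * u) ⊗ v + u ⊗ (y * v).
Proof.
rewrite /prim_Delta algDl.
have E1 : (y ⊗ 1) * (u ⊗ v) = (y * u) ⊗ v.
  by rewrite (tns_mulE y 1 u v) alg1l.
have E2 : (1 ⊗ y) * (u ⊗ v) = u ⊗ (y * v).
  exact: (etrans (tns_mulE 1 y u v) (congr1 (fun z => z ⊗ (y * v)) (alg1l u))).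
exact: (f_equal2 (fun a b : AA => a + b) E1 E2).
Qed.

Lemma prim_mul z : prim_Delta * (z ⊗ 1 + 1 ⊗ z) =
  ((y * z) ⊗ 1 + z ⊗ y) + (y ⊗ z + 1 ⊗ (y * z)).
Proof.
have E1 : prim_Delta * (z ⊗ 1) = (y * z) ⊗ 1 + z ⊗ y.
  exact: (etrans (prim_tns z 1)
    (congr1 (fun t => (y * z) ⊗ 1 + z ⊗ t : AA) (alg1r y))).
have E2 : prim_Delta * (1 ⊗ z) = y ⊗ z + 1 ⊗ (y * z).
  exact: (etrans (prim_tns 1 z)
    (congr1 (fun t => t ⊗ z + 1 ⊗ (y * z) : AA) (alg1r y))).
exact: (etrans (algDr _ _ _) (f_equal2 (fun a b : AA => a + b) E1 E2)).
Qed.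

Lemma AdL_prim a : AdL (y * a) = (prim_Delta * AdL a : AA) + (AdL a * ((- y) ⊗ 1) : AA).
Proof.
rewrite !AdLE Delta_y.
apply: (mono_ext (D := tensor A A) (h := fun w => AdL_of (prim_Delta * w))
  (h' := fun w => (prim_Delta * AdL_of w : AA) + (AdL_of w * ((- y) ⊗ 1) : AA))).
- by move=> c z t; rewrite mul_linr AdL_of_linear.
- move=> c z t; rewrite AdL_of_linear mul_linr mul_linl.
  by rewrite scalerDr addrACA.
move=> p; rewrite tns_monoE; move: (mono p.1) (mono p.2) => u v.
rewrite prim_tns (clinD AdL_of_linear) {1}(AdL_kernel_tns (y * u)).
rewrite {1}(AdL_kernel_tns u (y * v)) (AdL_kernel_tns u v).
rewrite {1}Delta_y {1}antip_y.
have -> : (antip v * - y) ⊗ 1 = (antip v ⊗ 1) * ((- y) ⊗ 1) :> AA.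
  by rewrite (tns_mulE (antip v)) alg1r.
rewrite [X in X + _ = _](esym (algA prim_Delta (Delta u) (antip v ⊗ 1))).
rewrite [X in _ + X = _](algA (Delta u) (antip v ⊗ 1) ((- y) ⊗ 1)).
reflexivity.
Qed.

Lemma AdL_prim_trivial a : AdL a = 1 ⊗ a -> AdL (y * a) = 1 ⊗ (y * a).
Proof.
move=> E; rewrite AdL_prim E prim_tns (tns_mulE 1 a (- y) 1) alg1l !alg1r.
have -> : (- y) ⊗ a = -1 *: (y ⊗ a) :> AA by rewrite -tnsZl scaleN1r.
exact: alg_cancel.
Qed.

End PrimitiveElement.

(** Here too the basis X^n H^m is abstract, for the same reason as in
    [BqBasis]. *)
Section EnvelopingAlgebra.
Context {F : fieldType} {A : hopf F} (ub : nat -> nat -> A).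
Local Notation AA := (carrier (tensor A A)).
Local Notation u n m := (mono (ub n m)).
Local Notation X := (u 1 0).
Local Notation H := (u 0 1).
Local Notation DX := (prim_Delta X).
Local Notation DH := (prim_Delta H).
Implicit Types a : carrier A.

Hypothesis ub_surj : forall b, exists n m, b = ub n m.
Hypothesis u_one : u 0 0 = 1.
Hypothesis u_X : forall n m, X * u n m = u n.+1 m.
Hypothesis u_H : forall n m, H * u n m = u n m.+1 + n%:R *: u n m.
Hypothesis u_Delta : forall n m, Delta (u n m) = DX ^+ n * DH ^+ m.
Hypothesis u_antip : forall n m, antip (u n m) = (- H) ^+ m * (- X) ^+ n.

Lemma prim_Delta_X a : Delta (X * a) = DX * Delta a.
Proof.
apply: (mono_ext (h := fun a => Delta (X * a)) (h' := fun a => DX * Delta a)) a.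
- by move=> c x y; rewrite mul_linr Delta_linear.
- by move=> c x y; rewrite Delta_linear mul_linr.
move=> b; have [n [m ->]] := ub_surj b; rewrite u_X (u_Delta n.+1) (u_Delta n).
exact: alg_expS.
Qed.

Lemma prim_antip_X a : antip (X * a) = antip a * - X.
Proof.
apply: (mono_ext (h := fun a => antip (X * a)) (h' := fun a => antip a * - X)) a.
- by move=> c x y; rewrite mul_linr antip_linear.
- by move=> c x y; rewrite antip_linear mul_linl.
move=> b; have [n [m ->]] := ub_surj b; rewrite u_X (u_antip n.+1) (u_antip n).
exact: alg_expSr.
Qed.

Lemma u_HX : H * X = X * H + X.
Proof.
have := u_H 1 0; rewrite scale1r => ->.
by have -> : X * H = u 1 1 by exact: u_X.
Qed.

Lemma prim_comm : DH * DX = (DX * DH : AA) + DX.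
Proof.
apply: etrans (prim_mul H X) _; rewrite u_HX.
have -> : DX * DH = _ := prim_mul X H.
rewrite tnsDl tnsDr; exact: alg_AC6.
Qed.

Lemma prim_Delta_H a : Delta (H * a) = DH * Delta a.
Proof.
apply: (mono_ext (h := fun a => Delta (H * a)) (h' := fun a => DH * Delta a)) a.
- by move=> c x y; rewrite mul_linr Delta_linear.
- by move=> c x y; rewrite Delta_linear mul_linr.
move=> b; have [n [m ->]] := ub_surj b.
rewrite u_H (clinD Delta_linear) (clinZ Delta_linear) (u_Delta n m.+1) (u_Delta n m).
exact: (alg_commutator_l _ _ prim_comm).
Qed.

Lemma prim_antip_H a : antip (H * a) = antip a * - H.
Proof.
apply: (mono_ext (h := fun a => antip (H * a)) (h' := fun a => antip a * - H)) a.
- by move=> c x y; rewrite mul_linr antip_linear.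
- by move=> c x y; rewrite antip_linear mul_linl.
move=> b; have [n [m ->]] := ub_surj b.
rewrite u_H (clinD antip_linear) (clinZ antip_linear) (u_antip n m.+1) (u_antip n m).
exact: (alg_commutator_r _ _ u_HX).
Qed.

(** The Hopf algebra is cocommutative, so v_(1) S v_(3) (x) v_(2) collapses to
    1 (x) v; on the basis this follows by multiplying by the primitive
    generators one at a time ([AdL_prim_trivial]). Hence every left ideal in the
    kernel of the counit is a crossed submodule. *)
Lemma AdL_trivial a : AdL a = 1 ⊗ a.
Proof.
apply: (mono_ext (h := AdL) (h' := fun a => 1 ⊗ a)) a.
- exact: AdL_linear.
- exact: tnsA_linr.
move=> b; have [n [m ->]] := ub_surj b; elim: n => [|n IHn].
  elim: m => [|m IHm].
    have D1 : Delta (u 0 0) = 1 ⊗ 1 := etrans (u_Delta 0 0) (alg_exp00 _ _).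
    have S1 : antip (u 0 0) = 1 := etrans (u_antip 0 0) (alg_exp00 _ _).
    rewrite u_one in D1 S1 *; rewrite AdLE D1 AdL_kernel_tns D1 S1 -one_tns; apply: alg1l.
  have := AdL_prim_trivial prim_Delta_H prim_antip_H IHm.
  by rewrite u_H scale0r addr0.
by have := AdL_prim_trivial prim_Delta_X prim_antip_X IHn; rewrite u_X.
Qed.

End EnvelopingAlgebra.

(** * Calculi on the enveloping algebra *)
Section UbConcrete.
Context (k : fieldType).
Local Notation U := (Ub k).
Local Notation u n m := (mono ((n%N, m%N) : Ub k)).
Implicit Types (a : carrier U) (c : k).

Lemma u_mul n m n' m' : u n m * u n' m' =
  Ub_XP (n + n') (('X + n'%:R%:P) ^+ m * 'X^m').
Proof. exact: (mul_mono (A := Ub_alg k) (n, m) (n', m')). Qed.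

Lemma u_mulX n m : u 1 0 * u n m = u n.+1 m.
Proof. by rewrite u_mul expr0 mul1r Ub_XPXn add1n. Qed.

Lemma u_mulH n m : u 0 1 * u n m = u n m.+1 + n%:R *: u n m.
Proof.
rewrite u_mul expr1 mulrDl add0n linearD /= -exprS Ub_XPXn mul_polyC linearZ /=.
by rewrite Ub_XPXn.
Qed.

Let ub n m : Ub k := (n, m).

Let ub_surj (b : Ub k) : exists n m, b = ub n m.
Proof. by exists b.1, b.2; case: b. Qed.

Let ub_Delta n m : Delta (mono (ub n m)) =
  prim_Delta (mono (ub 1 0)) ^+ n * prim_Delta (mono (ub 0 1)) ^+ m.
Proof. exact: Delta_mono. Qed.

Let ub_antip n m : antip (mono (ub n m)) =
  (- mono (ub 0 1)) ^+ m * (- mono (ub 1 0)) ^+ n.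
Proof. exact: antip_mono. Qed.

Lemma Ub_AdL a : AdL a = 1 ⊗ a.
Proof. exact: (AdL_trivial ub_surj erefl u_mulX u_mulH ub_Delta ub_antip). Qed.

Lemma Ub_Delta_X a : Delta (u 1 0 * a) = prim_Delta (u 1 0) * Delta a.
Proof. exact: (prim_Delta_X ub_surj u_mulX ub_Delta). Qed.

Lemma Ub_Delta_H a : Delta (u 0 1 * a) = prim_Delta (u 0 1) * Delta a.
Proof. exact: (prim_Delta_H ub_surj u_mulX u_mulH ub_Delta). Qed.

(** The coefficient of X^r, a polynomial in H, evaluated at H = c. *)
Definition evu (r : nat) c a : k :=
  lin (fun b : Ub k => (if b.1 == r then c ^+ b.2 else 0) : k^o) a.

Lemma evu_linear r c : linear (evu r c : carrier U -> k^o).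
Proof. exact: lin_is_linear. Qed.

Lemma evuD r c a a' : evu r c (a + a') = evu r c a + evu r c a'.
Proof. exact: (linear_add (evu_linear r c)). Qed.

Lemma evuZ r c x a : evu r c (x *: a) = x * evu r c a.
Proof. exact: (linear_scale (evu_linear r c)). Qed.

Lemma evu0 r c : evu r c 0 = 0.
Proof. exact: (linear_zero (evu_linear r c)). Qed.

Lemma evu_u r c n m : evu r c (u n m) = if n == r then c ^+ m else 0.
Proof. by rewrite /evu /mono linU1. Qed.

Lemma Ub_XPE n p : Ub_XP n p = plin (fun j => u n j) p.
Proof. by []. Qed.

Lemma evu_XP r c n p : evu r c (Ub_XP n p) = if n == r then p.[c] else 0.
Proof.
rewrite Ub_XPE; apply: (poly_ext (V := k^o)
  (h := fun p => evu r c (plin (fun j => u n j) p))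
  (h' := fun p => if n == r then p.[c] else 0)) p.
- by move=> x y z; rewrite plin_linear evuD evuZ.
- move=> x y z; case: eqP => _; last by rewrite scaler0 addr0.
  by rewrite hornerD hornerZ.
by move=> i; rewrite plin_Xn evu_u hornerXn.
Qed.

(** Moving H to the right of X^(r-n) shifts it by r - n. *)
Lemma evu_mul r c n m a : evu r c (u n m * a) =
  if (n <= r)%N then (c + (r - n)%:R) ^+ m * evu (r - n) c a else 0.
Proof.
apply: (mono_ext (V := k^o) (h := fun a => evu r c (u n m * a))
  (h' := fun a => if (n <= r)%N then
     (c + (r - n)%:R) ^+ m * evu (r - n) c a else 0)) a.
- by move=> x y z; rewrite mul_linr evuD evuZ.
- move=> x y z; case: leqP => _; last by rewrite scaler0 addr0.
  by rewrite evuD evuZ mulrDr mulrCA.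
case=> n' m'; rewrite u_mul evu_XP evu_u !hornerE.
case: (leqP n r) => h; last by case: eqP => // E; lia.
have -> : (n + n' == r)%N = (n' == r - n)%N by lia.
by case: eqP => [->//|_]; rewrite mulr0.
Qed.

Lemma eps_evu a : eps a = evu 0 0 a.
Proof.
apply: (mono_ext (V := k^o) (h := eps) (h' := evu 0 0)) a.
- exact: eps_linear.
- exact: evu_linear.
case=> n m; rewrite evu_u eps_mono /= /Ub_counit xpair_eqE.
by case: (n == 0%N) => //=; case: m => [|m]; rewrite ?expr0 // expr0n.
Qed.

Local Notation P := (Bq_basis (oner_neq0 k)).
Local Notation pr := (pairing (@pair_cl k)).

Lemma pairing_evu a (b : CB k) :
  pr a (mono b) = (b.1)`!%:R * evu b.1 (b.2)%:~R a.
Proof.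
apply: (mono_ext (V := k^o) (h := fun a => pr a (mono b))
  (h' := fun a => (b.1)`!%:R * evu b.1 (b.2)%:~R a)) a.
- exact: pairing_linl.
- by move=> c x y; rewrite evuD evuZ mulrDr mulrCA.
case=> n m; rewrite pairingUU /pair_cl evu_u /=.
by case: eqP => [->//|_]; rewrite mulr0.
Qed.

Lemma Ub_pr_b1 a : pr a (mono (bx P 0 0)) = eps a.
Proof. by rewrite pairing_evu eps_evu mul1r. Qed.

Hypothesis k0 : [pchar k] =i pred0.

Lemma natr_eq0_k n : (n%:R == 0 :> k) = (n == 0%N).
Proof. exact: (GRing.pcharf0P k).1. Qed.

Lemma fact_neq0 n : (n`!%:R : k) != 0.
Proof. by rewrite natr_eq0_k -lt0n fact_gt0. Qed.

Lemma intr_eq0_k (z : int) : (z%:~R == 0 :> k) = (z == 0).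
Proof.
case: z => n; first exact: natr_eq0_k.
by rewrite NegzE mulrNz oppr_eq0; apply: natr_eq0_k.
Qed.

Lemma intr_inj_k (x y : int) : x%:~R = y%:~R :> k -> x = y.
Proof.
move/eqP; rewrite -subr_eq0 -mulrzBr intr_eq0_k subr_eq0.
by move/eqP.
Qed.

Lemma natr_inj_k (i j : nat) : i%:R = j%:R :> k -> i = j.
Proof. by move=> E; apply/eqP; rewrite -eqz_nat; apply/eqP/intr_inj_k. Qed.

(** Lagrange interpolation in H at the integers, pairwise distinct in
    characteristic 0. *)
Lemma Ub_interpolation (b0 : CB k) (s : seq (CB k)) : b0 \notin s ->
  exists2 a, pr a (mono b0) != 0 & forall b, b \in s -> pr a (mono b) = 0.
Proof.
move=> b0s; pose p := \prod_(b <- [seq b <- s | b.1 == b0.1]) ('X - (b.2%:~R)%:P) : {poly k}.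
exists (Ub_XP b0.1 p) => [|b bs]; rewrite pairing_evu evu_XP.
  rewrite eqxx mulf_neq0 ?fact_neq0 // /p horner_prod.
  rewrite prodf_seq_neq0; apply/allP => b; rewrite mem_filter => /andP[/eqP bb bs].
  rewrite hornerXsubC subr_eq0; apply/implyP => _; apply: contraNneq b0s => /intr_inj_k E.
  by move: bs; rewrite [b]surjective_pairing [b0]surjective_pairing bb E.
case: eqP => [bb|_]; last by rewrite mulr0.
rewrite /p horner_prod (big_rem b) /=; last by rewrite mem_filter bb eqxx.
by rewrite hornerXsubC subrr mul0r !mulr0.
Qed.

Local Notation MU := (calc_str P (@pair_cl k)).

Lemma MU_evu J a : MU J a <->
  forall i r, i \in 0%N :: J -> (r <= i)%N -> evu r (- i%:R) a = 0.
Proof.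
split=> Ma.
  move=> i r iJ ri; have /Ma : strings P J (bx P r (- i%:Z)).
    by rewrite strings_bx abszN absz_nat iJ ri; lia.
  rewrite pairing_evu /= mulrNz => /eqP.
  by rewrite mulf_eq0 (negPf (fact_neq0 r)) => /eqP.
move=> b /and3P[m0 mJ rb]; rewrite pairing_evu.
have -> : b.2 = - (`|b.2|%N)%:Z by move: m0 => /=; lia.
by rewrite mulrNz Ma // mulr0.
Qed.

Lemma MU_calculus J : calculus (MU J).
Proof.
have MS : subspace (MU J) by apply: ann_of_subspace.
split=> //.
- by apply: ann_of_sub_kereps; [exact: Ub_pr_b1 | exact: strings1].
- apply: left_ideal_mono => // -[n m] a /MU_evu Ma; apply/MU_evu => i r iJ ri.
  rewrite evu_mul; case: leqP => // h; rewrite Ma ?mulr0 //.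
  by apply: leq_trans ri; rewrite leq_subr.
move=> a Ma; rewrite Ub_AdL; exists [:: (1, a)] => [p|]; last by rewrite big_seq1.
by rewrite inE => /eqP ->.
Qed.

Lemma MU_fd J : fd_calculus U (MU J).
Proof.
split; first exact: MU_calculus.
exists (size (string_seq1 P J)); apply: dim_calc_str.
  exact: Ub_pr_b1.
exact: Ub_interpolation.
Qed.

End UbConcrete.

(** * The expansion q = e^(-t), g = e^(tH) *)
Section DividedPowers.
Context {k : fieldType} (k0 : [pchar k] =i pred0).
Implicit Types (p : {poly k}) (c e m : k).

Definition dpow p (j : nat) : {poly k} := j`!%:R^-1 *: p ^+ j.

Lemma dpow0 p : dpow p 0 = 1.
Proof. by rewrite /dpow expr0 invr1 scale1r. Qed.

Lemma dpow1 p : dpow p 1 = p.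
Proof. by rewrite /dpow expr1 invr1 scale1r. Qed.

Lemma dpowD p p' j : dpow (p + p') j = \sum_(l < j.+1) dpow p (j - l) * dpow p' l.
Proof.
rewrite /dpow exprDn scaler_sumr; apply: eq_bigr => l _.
have lj : (l <= j)%N by rewrite -ltnS.
rewrite -scaler_nat scalerA -scalerAl -scalerAr scalerA; congr (_ *: _).
apply: (mulfI (fact_neq0 k0 j)); rewrite mulVKf ?fact_neq0 //.
rewrite -(bin_fact lj) !natrM -!mulrA [(j - l)`!%:R * _]mulrA.
by rewrite mulfV ?fact_neq0 // mul1r mulfV ?fact_neq0 // mulr1.
Qed.

Lemma dpow_monomial c s : dpow (c *: 'X) s = (c ^+ s / s`!%:R) *: 'X^s.
Proof. by rewrite /dpow exprZn scalerA mulrC. Qed.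

Lemma dpow_const c s : dpow c%:P s = (c ^+ s / s`!%:R)%:P.
Proof. by rewrite /dpow -polyC_exp -mul_polyC -polyCM mulrC. Qed.

(** The coefficient of t^j in e^(-et) e^(tmH). *)
Definition exp_coef m e j : {poly k} := dpow (m *: 'X - e%:P) j.

Lemma exp_coef_sum m e j : exp_coef m e j = \sum_(l < j.+1)
  ((- e) ^+ l / l`!%:R * (m ^+ (j - l) / (j - l)`!%:R)) *: 'X^(j - l).
Proof.
rewrite /exp_coef -polyCN dpowD; apply: eq_bigr => l _.
by rewrite dpow_monomial dpow_const mulrC mul_polyC scalerA.
Qed.

Lemma exp_coefD m e m' e' j :
  exp_coef (m + m') (e + e') j = \sum_(l < j.+1) exp_coef m e (j - l) * exp_coef m' e' l.
Proof.
rewrite -dpowD /exp_coef; congr (dpow _ _).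
by rewrite scalerDl polyCD opprD addrACA.
Qed.

Lemma exp_coef_eval m e j c : (exp_coef m e j).[c] = (m * c - e) ^+ j / j`!%:R.
Proof. by rewrite /exp_coef /dpow hornerZ horner_exp !hornerE mulrC. Qed.

End DividedPowers.

Section LimitInclusion.
Context {k : fieldType} (k0 : [pchar k] =i pred0).
Local Notation u n m := (mono ((n%N, m%N) : Ub k)).
Implicit Types (p d : {poly k}).

Lemma exp_gE r (m : int) j :
  Ub_X k ^+ r * exp_g m j = Ub_XP r ((m%:~R ^+ j / j`!%:R) *: 'X^j).
Proof.
rewrite /exp_g scaleAr Ub_monoE linearZ /= Ub_XPXn.
reflexivity.
Qed.

Lemma exp_monoE p r (m : int) j : exp_mono p (r, m) j =
  Ub_XP r (\sum_(i < size p) p`_i *: exp_coef m%:~R i%:R j).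
Proof.
rewrite /exp_mono /conv.
have -> : \sum_(i < size p) p`_i *: exp_coef m%:~R i%:R j =
    \sum_(l < j.+1) exp_q p l *:
      ((m%:~R ^+ (j - l) / (j - l)`!%:R) *: 'X^(j - l)).
  under eq_bigr => i _ do rewrite (exp_coef_sum k0) scaler_sumr.
  rewrite exchange_big; apply: eq_bigr => l _ /=.
  rewrite /exp_q scaler_suml; apply: eq_bigr => i _.
  by rewrite !scalerA mulrA.
rewrite linear_sum; apply: eq_bigr => l _.
rewrite [RHS]linearZ exp_gE; reflexivity.
Qed.

(** If all coefficients of d(e^(-t)) vanished, the functional p -> sum_i d_i p(-i)
    would vanish on every polynomial p; the polynomial with roots 0, -1, ...,
    1 - deg d then contradicts that the leading coefficient of d is nonzero. *)
Lemma exp_q_nonzero d : d != 0 -> exists v, exp_q d v != 0.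
Proof.
move=> d0; apply: contrapT => h.
have E j : \sum_(i < size d) d`_i * (- i%:R) ^+ j = 0.
  have : exp_q d j = 0 by apply/eqP; apply: contrapT => /negP ?; apply: h; exists j.
  rewrite /exp_q => /(congr1 ( *%R^~ j`!%:R)); rewrite mul0r mulr_suml => E; rewrite -[RHS]E.
  by apply: eq_bigr => i _; rewrite -mulrA divfK ?fact_neq0.
have Ep p : \sum_(i < size d) d`_i * p.[- i%:R] = 0.
  rewrite -[p]coefK poly_def.
  under eq_bigr => i _ do rewrite horner_sum mulr_sumr.
  rewrite exchange_big big1 // => j _ /=.
  under eq_bigr => i _ do rewrite hornerZ hornerXn mulrCA.
  by rewrite -mulr_sumr E mulr0.
pose top := (size d).-1.
have ds : (top < size d)%N by rewrite ltn_predL size_poly_gt0.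
have := Ep (\prod_(i < top) ('X + (i : nat)%:R%:P)).
rewrite (bigD1 (Ordinal ds)) //= [X in _ + X]big1 => [|i]; last first.
  move=> it; have {}it : (i != top :> nat).
    by apply: contraNneq it => itE; apply/eqP/val_inj.
  have itop : (i < top)%N by rewrite ltn_neqAle it -ltnS /top prednK ?size_poly_gt0 // ltn_ord.
  have -> : (\prod_(i < top) ('X + (i : nat)%:R%:P)).[- i%:R] = 0 :> k.
    rewrite horner_prod; apply/eqP/prodf_eq0; exists (Ordinal itop) => //.
    by rewrite hornerD hornerX hornerC addNr.
  exact: mulr0.
rewrite addr0 => /eqP; rewrite mulf_eq0 -/(lead_coef d) lead_coef_eq0 (negPf d0) /=.
rewrite horner_prod => /prodf_eq0[i _]; rewrite hornerD hornerX hornerC addrC.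
by rewrite subr_eq0 => /eqP E'; move: (ltn_ord i); rewrite (natr_inj_k k0 E') ltnn.
Qed.

Lemma ofpoly_inj : injective (@ofpoly k).
Proof. by move=> p p' /eqP; rewrite tofrac_eq => /eqP. Qed.

Lemma ofpolyC_linear : forall a b : k, @ofpoly k (a * b)%:P = ofpoly a%:P * ofpoly b%:P.
Proof. by move=> a b; rewrite polyCM /ofpoly tofracM. Qed.

(** The powers of q are linearly independent over k, so a relation between them
    holds for any function of the exponent; for f z = (-z)^j / j! it is the
    coefficient of t^j after q = e^(-t). *)
Lemma q_relation (I : eqType) (s : seq I) (c : I -> k) (z : I -> int) (f : int -> k) :
  \sum_(i <- s) ofpoly (c i)%:P * qvar k ^ z i = 0 -> \sum_(i <- s) c i * f (z i) = 0.
Proof.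
(* Multiplying by q^Z makes all exponents natural numbers. *)
pose Z := (\max_(i <- s) absz (z i))%N; pose w i := absz (z i + Z%:Z).
move=> E.
suff : \sum_(i <- s) c i *: 'X^(w i) = 0 :> {poly k}.
  move=> /(congr1 (plin (V := k^o) (fun n => f (n%:Z - Z%:Z)))).
  rewrite (linear_zero (plin_linear _)) (linear_bigsum (plin_linear _)) => E2.
  rewrite -[RHS]E2; apply: eq_big_seq => i si.
  rewrite (linear_scale (plin_linear _)) plin_Xn; congr (_ * f _).
  have : (absz (z i) <= Z)%N.
    by rewrite /Z; apply: (@leq_bigmax_seq _ s xpredT (fun i => absz (z i))).
  by rewrite /w; lia.
apply: ofpoly_inj; rewrite [RHS]tofrac0 /ofpoly rmorph_sum /=.
have E2 := congr1 ( *%R (qvar k ^ Z%:Z)) E; rewrite mulr0 in E2.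
rewrite -[RHS]E2 mulr_sumr; apply: eq_big_seq => i si.
rewrite mulrCA -expfzDr ?qvar_neq0 // -mul_polyC tofracM tofracXn; congr (_ * _).
have : (absz (z i) <= Z)%N.
  by rewrite /Z; apply: (@leq_bigmax_seq _ s xpredT (fun i => absz (z i))).
by move=> h; rewrite exprnP; congr (_ ^ _); rewrite /w; lia.
Qed.

End LimitInclusion.

(** * Leading terms satisfy the classical vanishing conditions *)
Section LimitOfAnnihilators.
Context {k : fieldType} (k0 : [pchar k] =i pred0).
Local Notation q := (qvar k).
Local Notation Pq := (Bq_basis (qvar_neq0 k)).
Local Notation Pcl := (Bq_basis (oner_neq0 k)).
Local Notation Mq := (calc_str Pq (@pair_q k)).
Local Notation Mcl := (calc_str Pcl (@pair_cl k)).

Lemma Mq_vanish J : Mq J = vanish_calc Pq J.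
Proof. exact: (calc_strE _ (qvar_generic k)). Qed.

Lemma ofpolyE (p : {poly k}) : ofpoly p = \sum_(i < size p) ofpoly (p`_i)%:P * q ^+ i.
Proof.
rewrite -{1}[p]coefK poly_def /ofpoly rmorph_sum; apply: eq_bigr => i _ /=.
by rewrite -mul_polyC tofracM tofracXn.
Qed.

(** The monomial q^e X^r g^m takes at g = q^i the value q^(e+im), while its
    expansion takes at H = -i the value e^(-(e+im)t). Both are governed by the same
    exponent, so [q_relation] applies. *)
Lemma exp_mono_evu J a d (P : nat * int -> {poly k}) i r j :
  vanish_calc Pq J a -> (forall b, ofpoly d * a@_b = ofpoly (P b)) ->
  i \in 0%N :: J -> (r <= i)%N ->
  evu r (- i%:R) (\sum_(b <- msupp a) exp_mono (P b) b j) = 0.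
Proof.
move=> Ma aP iJ ri.
pose s := [seq ((b, e) : (nat * int) * nat) | b <- [seq b <- msupp a | b.1 == r],
  e <- index_iota 0 (size (P b))].
have := @q_relation k _ s (fun t => (P t.1)`_t.2)
  (fun t => t.2%:Z + i%:Z * t.1.2) (fun z => (- (z%:~R)) ^+ j / j`!%:R).
rewrite /s !big_allpairs_dep !big_filter => H.
rewrite (linear_bigsum (evu_linear _ _)) -[RHS]H.
  rewrite [RHS]big_mkcond; apply: eq_bigr => -[r' m] _.
  rewrite (exp_monoE k0) evu_XP /=; case: eqP => // _.
  rewrite horner_sum big_mkord; apply: eq_bigr => e _.
  rewrite hornerZ exp_coef_eval; congr (_ * (_ ^+ _ / _)).
  by rewrite rmorphD rmorphM /= mulrN opprD addrC mulrC.
have := Ma i r iJ ri; rewrite /ev linE => /(congr1 ( *%R (ofpoly d))).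
rewrite mulr0 mulr_sumr => E; rewrite -[RHS]E [LHS]big_mkcond; apply: eq_bigr => -[r' m] _.
rewrite /=; case: eqP => _; last by rewrite scaler0 mulr0.
rewrite -[_ *: _]/(_ * _) mulrA aP [X in _ = X * _]ofpolyE mulr_suml big_mkord.
by apply: eq_bigr => e _; rewrite -mulrA expfzDr ?qvar_neq0 // (exprnP q i) exprz_exp.
Qed.

(** The expansion of a is divided by the one of the common denominator d. The
    conditions hold for the product; looking at the first nonzero coefficient of
    d(e^(-t)) gives them for the leading term of the quotient. *)
Lemma limM_sub J : limM (Mq J) `<=` Mcl J.
Proof.
move=> x [a [N [s [j [Ma [d [P [d0 aP sE]]] s0 sj]]]]].
rewrite Mq_vanish in Ma; apply/(MU_evu k0) => i r iJ ri.
have E0 j' : evu r (- i%:R) (conv (exp_q d) s j') = 0.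
  rewrite sE; case: ifP => _; first exact: evu0.
  exact: exp_mono_evu aP iJ ri.
have [v0 v0P] := exp_q_nonzero k0 d0.
have [v vP vmin] := ex_minnP (ex_intro (fun v => exp_q d v != 0) v0 v0P).
have := E0 (v + j)%N; rewrite /conv.
have vj : (v < (v + j).+1)%N by rewrite ltnS leq_addr.
rewrite (bigD1 (Ordinal vj)) //= addKn sj big1 ?addr0 => [|l lv].
  by rewrite evuZ => /eqP; rewrite mulf_eq0 (negPf vP) => /eqP.
case: (ltngtP l v) => h.
- suff -> : exp_q d l = 0 by rewrite scale0r.
  by apply/eqP; apply: contraLR h => /vmin; rewrite -leqNgt.
- by rewrite s0 ?scaler0 //; have := ltn_ord l; lia.
by case/eqP: lv; apply: val_inj.
Qed.

End LimitOfAnnihilators.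

(** * Lifting polynomials in H to leading terms *)
Section LeadingTerms.
Context {k : fieldType} (k0 : [pchar k] =i pred0).
Local Notation q := (qvar k).
Local Notation qexp := (seq (k * nat * int)).
Implicit Types (W : qexp) (p : {poly k}).

(** W lists triples (c, e, m) and stands for the sum of the c q^e g^m. Its expansion
    at order t^j is [lead W j], its value at g = q^i is [qeval W i], and [twist]
    multiplies it by q^e1 g^m1 - q^e2 g^m2. *)
Definition lead W (j : nat) : {poly k} :=
  \sum_(w <- W) w.1.1 *: exp_coef w.2%:~R w.1.2%:R j.

Definition qeval W (i : nat) : kq k :=
  \sum_(w <- W) ofpoly w.1.1%:P * q ^+ w.1.2 * q ^ (i%:Z * w.2).

Definition twist (m1 : int) (e1 : nat) (m2 : int) (e2 : nat) W : qexp :=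
  [seq (w.1.1, (w.1.2 + e1)%N, w.2 + m1) | w <- W] ++
  [seq (- w.1.1, (w.1.2 + e2)%N, w.2 + m2) | w <- W].

Lemma lead_twist m1 e1 m2 e2 W j : lead (twist m1 e1 m2 e2 W) j =
  \sum_(l < j.+1) lead W (j - l) *
    (exp_coef m1%:~R e1%:R l - exp_coef m2%:~R e2%:R l).
Proof.
rewrite /lead /twist big_cat !big_map /= -big_split /=.
under [RHS]eq_bigr => l _ do rewrite mulr_suml.
rewrite exchange_big; apply: eq_bigr => -[[c e] m] _ /=.
rewrite !mulrzDr !natrD !(exp_coefD k0) scaleNr -scalerBr -sumrB scaler_sumr.
by apply: eq_bigr => l _; rewrite -mulrBr scalerAl.
Qed.

Lemma qeval_twist m1 e1 m2 e2 W i : qeval (twist m1 e1 m2 e2 W) i =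
  qeval W i * (q ^+ e1 * q ^ (i%:Z * m1) - q ^+ e2 * q ^ (i%:Z * m2)).
Proof.
rewrite /qeval /twist big_cat !big_map /= -big_split mulr_suml /=.
apply: eq_bigr => -[[c e] m] _ /=.
rewrite polyCN /ofpoly tofracN !mulrDr !expfzDr ?qvar_neq0 // !exprD; ring.
Qed.

(** p is the coefficient of t^T, the previous ones being zero, in the expansion of
    some Laurent polynomial in g with coefficients in k[q] that vanishes at the q^i with
    i in S. *)
Definition lifts (S : seq nat) (T : nat) p := exists W,
  [/\ forall i, i \in S -> qeval W i = 0,
      forall j, (j < T)%N -> lead W j = 0 & lead W T = p].

(** The factor q^e1 g^m1 - q^e2 g^m2 has no constant term in t, and its linear term
    is (m1 - m2) H - (e1 - e2). *)
Lemma lead_twist_order m1 e1 m2 e2 W T :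
  (forall j, (j < T)%N -> lead W j = 0) ->
  (forall j, (j < T.+1)%N -> lead (twist m1 e1 m2 e2 W) j = 0) /\
  lead (twist m1 e1 m2 e2 W) T.+1 =
    lead W T * ((m1 - m2)%:~R *: 'X - (e1%:R - e2%:R)%:P).
Proof.
move=> W0; have dX0 : exp_coef m1%:~R e1%:R 0 - exp_coef m2%:~R e2%:R 0 = 0 :> {poly k}.
  by rewrite /exp_coef !dpow0 subrr.
split=> [j|].
  rewrite ltnS => jT; rewrite lead_twist big_ord_recl /= dX0 mulr0 add0r.
  by apply: big1 => l _; rewrite W0 ?mul0r //= /bump; have := ltn_ord l; lia.
rewrite lead_twist !big_ord_recl /= dX0 mulr0 add0r big1 ?addr0 => [|l _].
  rewrite /bump /= subSS subn0 /exp_coef !dpow1 rmorphB scalerBl polyCB /=; congr (_ * _).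
  by ring.
by rewrite W0 ?mul0r //= /bump; have := ltn_ord l; lia.
Qed.

(** Multiply by 1 - q, which starts with t. *)
Lemma lifts_raise S T p : lifts S T p -> lifts S T.+1 p.
Proof.
case=> W [WS W0 Wp]; have [h0 h1] := lead_twist_order 0 0 0 1 W0.
exists (twist 0 0 0 1 W); split=> // [i iS|].
  by rewrite qeval_twist WS // mul0r.
by rewrite h1 Wp subrr scale0r !sub0r -polyCN opprK mulr1.
Qed.

Lemma lifts_le S T T' p : (T <= T')%N -> lifts S T p -> lifts S T' p.
Proof.
move=> le h; rewrite -(subnK le); elim: (T' - T)%N => [//|d IHd].
by rewrite addSn; apply: lifts_raise.
Qed.

(** Multiply by g - q^i, which starts with t (H + i). *)
Lemma lifts_root S T p i : lifts S T p -> lifts (i :: S) T.+1 (p * ('X + i%:R%:P)).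
Proof.
case=> W [WS W0 Wp]; have [h0 h1] := lead_twist_order 1 0 0 i W0.
exists (twist 1 0 0 i W); split=> // [i'|].
  rewrite inE qeval_twist => /orP[/eqP ->|/WS ->]; last by rewrite mul0r.
  by rewrite mulr1 mulr0 expr0 expr0z mul1r mulr1 exprnP subrr mulr0.
by rewrite h1 Wp subr0 scale1r sub0r polyCN opprK.
Qed.

Lemma lifts_lin S T c p p' : lifts S T p -> lifts S T p' -> lifts S T (c *: p + p').
Proof.
case=> W [WS W0 Wp] [W' [WS' W0' Wp']].
pose V := [seq (c * w.1.1, w.1.2, w.2) | w <- W] ++ W'.
have leadV j : lead V j = c *: lead W j + lead W' j.
  rewrite /lead /V big_cat big_map scaler_sumr /=; congr (_ + _).
  by apply: eq_bigr => w _; rewrite [RHS]scalerA.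
have evalV i : qeval V i = ofpoly c%:P * qeval W i + qeval W' i.
  rewrite /qeval /V big_cat big_map mulr_sumr /=; congr (_ + _).
  by apply: eq_bigr => w _; rewrite ofpolyC_linear !mulrA.
exists V; split=> [i iS|j jT|].
- by rewrite evalV WS // WS' // mulr0 addr0.
- by rewrite leadV W0 // W0' // scaler0 addr0.
by rewrite leadV Wp Wp'.
Qed.

(** A factor H is obtained from g - 1, and a constant by adding two lifts brought
    to the same order. *)
Lemma lifts_multiple S (Q : {poly k}) :
  exists T, lifts S T (Q * \prod_(i <- S) ('X + i%:R%:P)).
Proof.
have base : lifts S (size S) (\prod_(i <- S) ('X + i%:R%:P)).
  elim: S => [|i S IHS].
    exists [:: (1, 0%N, 0)]; split=> //; rewrite /lead big_seq1 big_nil.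
    by rewrite /exp_coef dpow0 scale1r.
  by rewrite big_cons mulrC; apply: lifts_root.
set G := \prod_(i <- S) _ in base *.
elim/poly_ind: Q => [|Q c [T IHQ]].
  exists 0%N; rewrite mul0r; exists [::].
  by split=> [i _|j _|]; rewrite /qeval /lead big_nil.
(* The root i = 0 of [lifts_root] multiplies by H; its vanishing condition at 0 is
   dropped again. *)
exists (maxn T.+1 (size S)).
have -> : (Q * 'X + c%:P) * G = c *: G + Q * G * ('X + 0%:R%:P).
  by rewrite addr0 mulrDl mul_polyC addrC mulrAC.
apply: lifts_lin; first by apply: lifts_le base; rewrite leq_maxr.
apply: lifts_le (leq_maxl _ _) _.
have [W [WS W0 Wp]] := lifts_root 0 IHQ; exists W; split=> // i iS.
by apply: WS; rewrite inE iS orbT.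
Qed.

Lemma lifts_divisible (S : seq nat) p : uniq S ->
  (forall i, i \in S -> p.[- i%:R] = 0) -> exists T, lifts S T p.
Proof.
move=> uS pS; pose rs : seq k := [seq - i%:R | i : nat <- S].
have rsp : all (root p) rs.
  by apply/allP => _ /mapP[i iS ->]; apply/rootP/pS.
have urs : uniq_roots rs.
  rewrite uniq_rootsE map_inj_uniq // => i j /oppr_inj.
  exact: natr_inj_k.
have [Q ->] := uniq_roots_prod_XsubC rsp urs.
have [T h] := lifts_multiple S Q; exists T.
rewrite big_map; under eq_bigr => i _ do rewrite polyCN opprK.
exact: h.
Qed.

End LeadingTerms.

(** * The limit of calculi *)
Section Lifting.
Context {k : fieldType} (k0 : [pchar k] =i pred0).
Local Notation q := (qvar k).
Local Notation Pq := (Bq_basis (qvar_neq0 k)).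
Local Notation Pcl := (Bq_basis (oner_neq0 k)).
Local Notation Mq := (calc_str Pq (@pair_q k)).
Local Notation Mcl := (calc_str Pcl (@pair_cl k)).
Local Notation terms := (seq ((k * nat) * (nat * int))).
Implicit Types (W : terms).

(** W lists the terms c q^e X^r g^m of an element with coefficients in k[q];
    [toA W] is this element, [toS W] its expansion in t, and [toP W] gives its
    coefficients as polynomials in q. *)
Definition toA W : carrier (Uq k) :=
  \sum_(w <- W) (ofpoly w.1.1%:P * q ^+ w.1.2) *: mono (w.2 : Uq k).

Definition toS W (j : nat) : carrier (Ub k) :=
  \sum_(w <- W) w.1.1 *: Ub_XP w.2.1 (exp_coef w.2.2%:~R w.1.2%:R j).

Definition toP W (b : nat * int) : {poly k} :=
  \sum_(w <- W | w.2 == b) w.1.1 *: 'X^(w.1.2).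

Lemma ofpolyZX (c : k) n : ofpoly (c *: 'X^n) = ofpoly c%:P * q ^+ n.
Proof. by rewrite -mul_polyC /ofpoly tofracM tofracXn. Qed.

Lemma toA_coef W (b : Uq k) : (toA W)@_b = ofpoly (toP W b).
Proof.
rewrite /toA (linear_bigsum (mcoeff_linear b)) /toP /ofpoly rmorph_sum big_mkcond.
rewrite [RHS]big_mkcond; apply: eq_bigr => w _ /=.
rewrite mcoeffZ mcoeffU -ofpolyZX.
by case: eqP => _; rewrite ?mulr1 ?mulr0.
Qed.

Lemma exp_q1 (s : nat -> carrier (Ub k)) j : conv (exp_q 1) s j = s j.
Proof.
have E l : exp_q (1 : {poly k}) l = (l == 0%N)%:R.
  rewrite /exp_q size_poly1 big_ord1 coef1 mul1r oppr0.
  by case: l => [|l]; rewrite ?expr0 ?invr1 ?mulr1 // expr0n mul0r.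
rewrite /conv big_ord_recl E scale1r subn0 big1 ?addr0 // => l _.
by rewrite E scale0r.
Qed.

Lemma exp_mono_toP W b j : exp_mono (toP W b) b j =
  \sum_(w <- W | w.2 == b) w.1.1 *: Ub_XP w.2.1 (exp_coef w.2.2%:~R w.1.2%:R j).
Proof.
case: b => r m; rewrite (exp_monoE k0).
rewrite -[X in Ub_XP r X]/(plin (fun i => exp_coef m%:~R i%:R j) (toP W (r, m))) /toP.
rewrite (linear_bigsum (plin_linear _)) linear_sum; apply: eq_bigr => w /eqP E.
by rewrite (linear_scale (plin_linear _)) plin_Xn [LHS]linearZ E.
Qed.

Lemma toA_expansion W : expansion (toA W) 0 (toS W).
Proof.
exists 1, (toP W); split=> [|b|j]; first exact: oner_neq0.
  by rewrite toA_coef /ofpoly tofrac1 mul1r.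
rewrite exp_q1 ltn0 subn0; pose D := undup [seq w.2 | w <- W].
pose G b := exp_mono (toP W b) b j.
have G0 (b : Uq k) : b \notin msupp (toA W) -> G b = 0.
  move/mcoeff_outdom; rewrite toA_coef => E.
  have {}E : toP W b = 0 by apply: ofpoly_inj; rewrite E /ofpoly tofrac0.
  rewrite /G E; case: b {E} => r m.
  by rewrite (exp_monoE k0) size_poly0 big_ord0 linear0.
transitivity (\sum_(b <- D) G b).
  rewrite (eq_bigr (fun b => \sum_(w <- W | w.2 == b) w.1.1 *:
    Ub_XP w.2.1 (exp_coef w.2.2%:~R w.1.2%:R j))) => [|b _]; last exact: exp_mono_toP.
  under eq_bigr => b _ do rewrite big_mkcond.
  rewrite exchange_big /toS; apply: eq_big_seq => w wW /=.
  rewrite (bigD1_seq w.2) ?undup_uniq ?mem_undup ?map_f //= eqxx big1 ?addr0 //.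
  by move=> b; rewrite eq_sym => /negPf ->.
rewrite (bigID (fun b : Uq k => b \in msupp (toA W))) /= [X in _ + X]big1 ?addr0 //.
rewrite -big_filter; apply: perm_big; apply: uniq_perm.
- by rewrite filter_uniq ?undup_uniq.
- exact: fset_uniq.
move=> b; rewrite mem_filter; case: (boolP (b \in msupp _)) => //= bW.
rewrite mem_undup; apply: contraLR bW => nW; rewrite -mcoeff_eq0 toA_coef.
rewrite /toP big_seq_cond big1 => [|w /andP[wW /eqP E]]; first by rewrite /ofpoly tofrac0.
by case/negP: nW; apply/mapP; exists w.
Qed.

Lemma ev_toA_homog (W : seq (k * nat * int)) r r' i :
  ev Pq r' (q ^+ i) (toA [seq (w.1, (r, w.2)) | w <- W]) =
  if r == r' then qeval W i else 0.
Proof.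
rewrite /toA big_map (linear_bigsum (ev_linear _ _ _)) /qeval.
under eq_bigr => w _ do rewrite evZ -[mono _]/(mono (bx Pq r w.2)) ev_e.
case: eqP => _; last by rewrite big1 // => w _; rewrite mulr0.
by apply: eq_bigr => w _; rewrite (exprnP q i) exprz_exp.
Qed.

Lemma toS_homog (W : seq (k * nat * int)) r j :
  toS [seq (w.1, (r, w.2)) | w <- W] j = Ub_XP r (lead W j).
Proof.
rewrite /toS big_map /lead linear_sum; apply: eq_bigr => w _.
by rewrite [RHS]linearZ.
Qed.

Lemma toA_cat W W' : toA (W ++ W') = toA W + toA W'.
Proof. exact: big_cat. Qed.

Lemma toS_cat W W' j : toS (W ++ W') j = toS W j + toS W' j.
Proof. exact: big_cat. Qed.

Lemma Ub_decomp (x : carrier (Ub k)) : exists R (p : nat -> {poly k}),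
  x = \sum_(r < R) Ub_XP r (p r).
Proof.
exists (\max_(b <- msupp x) b.1).+1; set R := (X in X.+1).
exists (fun r => \sum_(b <- msupp x | b.1 == r) x@_b *: 'X^(b.2)).
rewrite {1}[x]mono_sumE.
under [RHS]eq_bigr => r _ do rewrite linear_sum big_mkcond.
rewrite exchange_big; apply: eq_big_seq => b bx.
have bR : (b.1 < R.+1)%N by rewrite ltnS /R (bigD1_seq b) ?leq_maxl.
rewrite (bigD1 (Ordinal bR)) //= eqxx big1 ?addr0 => [|r nr].
  by rewrite linearZ /= Ub_XPXn; case: b {bx bR}.
have -> : (b.1 == r :> nat) = false.
  by apply/negbTE; apply: contraNneq nr => E; apply/eqP/val_inj.
by [].
Qed.

(** Each coefficient of X^r in x vanishes at the -i with i >= r in the strings, and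
    is lifted separately; the lifts are brought to a common order in t before
    they are added. *)
Lemma limM_sup J : Mcl J `<=` limM (Mq J).
Proof.
move=> x /(MU_evu k0) Mx; have [R [p xE]] := Ub_decomp x.
have pE r c : (r < R)%N -> evu r c x = (p r).[c].
  move=> rR; rewrite xE (linear_bigsum (evu_linear _ _)) (bigD1 (Ordinal rR)) //=.
  rewrite evu_XP eqxx big1 ?addr0 // => r' nr; rewrite evu_XP.
  have -> : (r' == r :> nat) = false.
    by apply/negbTE; apply: contraNneq nr => E; apply/eqP/val_inj.
  by [].
have main R' : (R' <= R)%N -> exists T0, forall T, (T0 <= T)%N -> exists W,
    [/\ vanish_calc Pq J (toA W), forall j, (j < T)%N -> toS W j = 0 &
      toS W T = \sum_(r < R') Ub_XP r (p r)].
  elim: R' => [_|r IHr rR].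
    exists 0%N => T _; exists [::]; split=> [i r _ _|j _|].
    - by rewrite /toA big_nil ev0.
    - by rewrite /toS big_nil.
    by rewrite /toS big_nil big_ord0.
  have [T0 h0] := IHr (ltnW rR).
  pose S := undup [seq i <- 0%N :: J | (r <= i)%N].
  (* Only the strings reaching degree r constrain the coefficient of X^r. *)
  have [|i|T1 h1] := @lifts_divisible _ k0 S (p r); first exact: undup_uniq.
    rewrite mem_undup mem_filter => /andP[ri iJ].
    by rewrite -pE // Mx.
  exists (maxn T0 T1) => T; rewrite geq_max => /andP[T0T T1T].
  have [W [WM W0 WT]] := h0 _ T0T.
  have [V [VS V0 VT]] := lifts_le k0 T1T h1.
  exists (W ++ [seq (w.1, (r, w.2)) | w <- V]); split=> [i r' iJ ri|j jT|].
  - rewrite toA_cat evD WM // ev_toA_homog add0r; case: eqP => // rr'.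
    by apply: VS; rewrite mem_undup mem_filter rr' ri.
  - by rewrite toS_cat W0 // toS_homog V0 // linear0 addr0.
  by rewrite toS_cat WT toS_homog VT big_ord_recr.
have [T0 h] := main R (leqnn _); have [W [WM W0 WT]] := h _ (leqnn T0).
exists (toA W), 0%N, (toS W), T0; split=> //.
- by rewrite Mq_vanish.
- exact: toA_expansion.
by rewrite WT -xE.
Qed.

Lemma limM_calc_str J : limM (Mq J) = Mcl J.
Proof. by apply/seteqP; split; [apply: limM_sub | apply: limM_sup]. Qed.

End Lifting.

(** * The limit of tangent spaces *)
Section SpecializationAtOne.
Context {k : fieldType}.
Implicit Types (v : k) (c : kq k).

Lemma ofpoly_eq0 (p : {poly k}) : (ofpoly p == 0) = (p == 0).
Proof. exact: tofrac_eq0. Qed.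

Lemma value_at1D c c' v v' :
  value_at1 c v -> value_at1 c' v' -> value_at1 (c + c') (v + v').
Proof.
move=> [p [d [d1 -> ->]]] [p' [d' [d'1 -> ->]]].
have nz (f : {poly k}) : f.[1] != 0 -> ofpoly f != 0.
  by rewrite ofpoly_eq0; apply: contraNneq => ->; rewrite horner0.
exists (p * d' + p' * d), (d * d'); split.
- by rewrite hornerM mulf_neq0.
- by rewrite addf_div ?nz // /ofpoly tofracD !tofracM.
by rewrite hornerD !hornerM addf_div.
Qed.

Lemma value_at1C v : value_at1 (ofpoly v%:P) v.
Proof.
by exists v%:P, 1; rewrite !hornerC oner_neq0 /ofpoly tofrac1 !divr1.
Qed.

(** Values at q = 1 are well defined: the denominator does not vanish there. *)
Lemma value_at1_eq0 v : value_at1 0 v -> v = 0.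
Proof.
move=> [p [d [d1 E ->]]].
have dn : ofpoly d != 0 by rewrite ofpoly_eq0; apply: contraNneq d1 => ->; rewrite horner0.
have /eqP : ofpoly p = 0 by rewrite -[LHS](divfK dn) -E mul0r.
by rewrite ofpoly_eq0 => /eqP ->; rewrite horner0 mul0r.
Qed.

Lemma value_at1_sum (I : Type) (r : seq I) (Q : pred I) (c : I -> kq k) (v : I -> k) :
  (forall i, value_at1 (c i) (v i)) ->
  value_at1 (\sum_(i <- r | Q i) c i) (\sum_(i <- r | Q i) v i).
Proof.
move=> cv; elim: r => [|i r IHr].
  by rewrite !big_nil -[X in value_at1 X](tofrac0 {poly k}) -polyC0; apply: value_at1C.
by rewrite !big_cons; case: (Q i) => //; apply: value_at1D.
Qed.

End SpecializationAtOne.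

Section OrderedMonomials.
Context {F : fieldType} {q : F} (q0 : q != 0) (o : bool).
Local Notation P := (Bq_basis q0).

Definition ordcoef (b : nat * int) : F := if o then 1 else q ^ (- (b.2 * b.1%:Z)).

Lemma ordcoef_neq0 b : ordcoef b != 0.
Proof.
by rewrite /ordcoef; case: o; rewrite ?oner_neq0 // expfz_eq0 (negPf q0) andbF.
Qed.

Lemma ordmonoE b : ordmono q0 o b = ordcoef b *: mono (b : Bq q0).
Proof.
case: b => n m; rewrite /ordmono /ordcoef /=; case: o.
  by rewrite scale1r; apply: Bq_monoE.
have -> : Bq_X q0 ^+ n = mono ((n, 0) : Bq_alg q0).
  by rewrite -Bq_monoE -[RHS]/(Bq_X q0 ^+ n * 1) alg1r.
apply: etrans (mulg_e P m n 0) _.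
by rewrite addr0.
Qed.

Lemma ordmono_coef b (b' : Bq q0) :
  (ordmono q0 o b)@_b' = ordcoef b' * (b == b')%:R.
Proof.
rewrite ordmonoE mcoeffZ mcoeffU.
by case: eqP => [->//|_]; rewrite !mulr0.
Qed.

Lemma ordmono_eps b : eps (ordmono q0 o b : carrier (Bq q0)) = (b.1 == 0%N)%:R.
Proof.
rewrite ordmonoE (linear_scale eps_linear); case: b => n m.
have -> : eps (mono ((n, m) : Bq q0)) = (n == 0%N)%:R := bx_eps P n m.
rewrite /ordcoef /=; case: eqP => [->|_]; last by rewrite scaler0.
by rewrite mulr0 oppr0 expr0z if_same scale1r.
Qed.

Lemma ordsum_coef (r : seq (nat * int)) (c : nat * int -> F) (b : Bq q0) :
  (\sum_(b' <- r) c b' *: ordmono q0 o b' : carrier (Bq q0))@_b =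
  ordcoef b * \sum_(b' <- r | b' == b) c b'.
Proof.
rewrite (linear_bigsum (mcoeff_linear b)) [in RHS]big_mkcond mulr_sumr.
apply: eq_bigr => b' _; rewrite mcoeffZ ordmono_coef.
by case: eqP => _; rewrite ?mulr0 // mulr1 mulrC.
Qed.

Lemma ordsum_eps (r : seq (nat * int)) (c : nat * int -> F) :
  eps (\sum_(b' <- r) c b' *: ordmono q0 o b' : carrier (Bq q0)) =
  \sum_(b' <- r | b'.1 == 0%N) c b'.
Proof.
rewrite (linear_bigsum eps_linear) [in RHS]big_mkcond.
apply: eq_bigr => b' _; rewrite (linear_scale eps_linear) ordmono_eps.
by case: eqP => _; rewrite ?scaler0 // [_ *: _]mulr1.
Qed.

End OrderedMonomials.

Section LimitOfTangentSpaces.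
Context {k : fieldType} (o : bool).
Local Notation Pq := (Bq_basis (qvar_neq0 k)).
Local Notation Pcl := (Bq_basis (oner_neq0 k)).

Lemma ordcoef1 b : ordcoef (q := (1 : k)) o b = 1.
Proof. by rewrite /ordcoef; case: o => //; rewrite exp1rz. Qed.

(** The two orderings of a monomial differ by a power of q, which is invertible and
    equal to 1 at q = 1. So the conditions defining the space, the vanishing of
    coefficients and of the counit, are compared coefficientwise. *)
Lemma limL_tan_str J : limL o (tan_str Pq J) = tan_str Pcl J.
Proof.
apply/seteqP; split=> y.
  case=> x [ex Sx] [r [c [v [cv xE yE]]]]; split.
    rewrite yE ordsum_eps; apply: value_at1_eq0.
    by rewrite -ex xE ordsum_eps; apply: value_at1_sum.
  move=> b nb; rewrite yE ordsum_coef ordcoef1 mul1r; apply: value_at1_eq0.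
  have /eqP := Sx b nb; rewrite xE ordsum_coef mulf_eq0.
  rewrite (negPf (ordcoef_neq0 (qvar_neq0 k) o b)) => /eqP <-.
  exact: value_at1_sum.
move=> [ey Sy].
exists (\sum_(b <- msupp y) ofpoly (y@_b)%:P *: ordmono (qvar_neq0 k) o b).
  split=> [|b nb].
    rewrite ordsum_eps -[RHS](tofrac0 {poly k}) -polyC0 -ey [y in eps y]mono_sumE.
    rewrite (linear_bigsum eps_linear) /ofpoly !rmorph_sum big_mkcond.
    apply: eq_bigr => -[n m] _ /=; rewrite (linear_scale eps_linear).
    have -> : eps (mono ((n, m) : CB k)) = (n == 0%N)%:R := bx_eps Pcl n m.
    by case: eqP => _; rewrite ?scaler0 ?tofrac0 // [_ *: _]mulr1.
  rewrite ordsum_coef big1 ?mulr0 // => b' /eqP ->.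
  by rewrite (Sy b nb) polyC0 /ofpoly tofrac0.
exists (msupp y), (fun b => ofpoly (y@_b)%:P), (fun b => y@_b); split=> //.
  by move=> b; apply: value_at1C.
rewrite [LHS]mono_sumE; apply: eq_bigr => b _.
by rewrite ordmonoE ordcoef1 scale1r.
Qed.

End LimitOfTangentSpaces.

(** * Braided derivations *)
Section BraidedDerivations.
Context {k : fieldType}.
Local Notation UU := (carrier (tensor (Ub k) (Ub k))).
Local Notation u n m := (mono ((n%N, m%N) : Ub k)).
Local Notation X := (u 1 0).
Local Notation H := (u 0 1).
Local Notation e n m := (mono ((n%N, m) : CB k)).
Local Notation pr := (pairing (@pair_cl k)).
Implicit Types (x : carrier (CB k)) (a : carrier (Ub k)) (w : UU).

(** The braided derivation of x is [contract x] after the coproduct; separating the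
    two makes it computable by recursion on products. *)
Definition contract x w : carrier (Ub k) :=
  lin (fun p : Ub k * Ub k => pr (mono p.1) x *: mono p.2) w.

Lemma contract_linear x : linear (contract x).
Proof. exact: lin_is_linear. Qed.

Lemma contract_tns x a b : contract x (a ⊗ b) = pr a x *: b.
Proof.
apply: (mono_ext (V := carrier (Ub k)) (h := fun a => contract x (a ⊗ b))
  (h' := fun a => pr a x *: b)) a.
- by move=> c y z; rewrite tnsA_linl contract_linear.
- by move=> c y z; rewrite pairing_linl scalerDl scalerA.
move=> a; apply: (mono_ext (V := carrier (Ub k)) (h := fun b => contract x (mono a ⊗ b))
  (h' := fun b => pr (mono a) x *: b)) b.
- by move=> c y z; rewrite tnsA_linr contract_linear.
- by move=> c y z; rewrite scalerDr !scalerA mulrC.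
by move=> b; rewrite -(tns_monoE (a, b)) /contract /mono linU1.
Qed.

Lemma contract_ext (f g : UU -> carrier (Ub k)) : linear f -> linear g ->
  (forall a b, f (a ⊗ b) = g (a ⊗ b)) -> f =1 g.
Proof.
move=> fl gl E; apply: (mono_ext fl gl) => p.
by rewrite tns_monoE; apply: E.
Qed.

(** Pairing with X^j g^s evaluates at H = s after X^j, and moving H to the right of
    X^j gives s + j. *)
Lemma contract_H (j : nat) (s : int) w : contract (e j s) (prim_Delta H * w) =
  (s%:~R + j%:R) *: contract (e j s) w + (H * contract (e j s) w : carrier (Ub k)).
Proof.
move: w; apply: contract_ext.
- by move=> c y z; rewrite mul_linr contract_linear.
- by move=> c y z; rewrite contract_linear mul_linr !scalerDr !scalerA [_ * c]mulrC addrACA.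
move=> a b; rewrite prim_tns (clinD (contract_linear _)).
have E1 : contract (e j s) ((H * a) ⊗ b) = (s%:~R + j%:R) *: contract (e j s) (a ⊗ b).
  apply: etrans (contract_tns _ _ _) _; rewrite contract_tns scalerA; congr (_ *: _).
  by rewrite !pairing_evu /= evu_mul subn0 expr1 mulrCA.
have E2 : contract (e j s) (a ⊗ (H * b)) = H * contract (e j s) (a ⊗ b).
  by apply: etrans (contract_tns _ _ _) _; rewrite contract_tns scaleAr.
exact: (f_equal2 (fun y z : carrier (Ub k) => y + z) E1 E2).
Qed.

Lemma contract_X (j : nat) (s : int) w : contract (e j s) (prim_Delta X * w) =
  j%:R *: contract (e j.-1 s) w + (X * contract (e j s) w : carrier (Ub k)).
Proof.
move: w; apply: contract_ext.
- by move=> c y z; rewrite mul_linr contract_linear.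
- by move=> c y z; rewrite !contract_linear mul_linr !scalerDr !scalerA [_ * c]mulrC addrACA.
move=> a b; rewrite prim_tns (clinD (contract_linear _)).
have E1 : contract (e j s) ((X * a) ⊗ b) = j%:R *: contract (e j.-1 s) (a ⊗ b).
  apply: etrans (contract_tns _ _ _) _; rewrite contract_tns scalerA; congr (_ *: _).
  rewrite !pairing_evu /= evu_mul; case: j => [|j]; first by rewrite mulr0 mul0r.
  by rewrite /= subn1 expr0 mul1r factS natrM mulrA.
have E2 : contract (e j s) (a ⊗ (X * b)) = X * contract (e j s) (a ⊗ b).
  by apply: etrans (contract_tns _ _ _) _; rewrite contract_tns scaleAr.
exact: (f_equal2 (fun y z : carrier (Ub k) => y + z) E1 E2).
Qed.

Lemma Ub_Delta_one : Delta (u 0 0) = u 0 0 ⊗ u 0 0.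
Proof. by rewrite Delta_mono; apply: alg_exp00. Qed.

Lemma contract_DeltaX (j : nat) (s : int) (m : nat) :
  contract (e j s) (Delta (u m 0)) = (j`!%:R * 'C(m, j)%:R) *: u (m - j) 0.
Proof.
elim: m j => [|m IHm] j.
  rewrite Ub_Delta_one contract_tns.
  have -> : pr (u 0 0) (e j s) = (j`! * 'C(0, j))%:R.
    by rewrite pairing_evu evu_u; case: j => [|j]; rewrite ?mulr0 ?muln0 // bin0 muln1 mulr1.
  by rewrite natrM sub0n.
rewrite -u_mulX Ub_Delta_X contract_X !IHm scaleAr u_mulX scalerA.
case: j => [|j] /=.
  by rewrite mul0r scale0r add0r !bin0 !subn0.
have E1 : (j.+1`!%:R * 'C(m, j.+1)%:R) *: u (m - j.+1).+1 0 =
    (j.+1`!%:R * 'C(m, j.+1)%:R) *: u (m - j) 0 :> carrier (Ub k).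
  case: (ltnP m j.+1) => h; first by rewrite bin_small // mulr0 !scale0r.
  by rewrite subnSK.
have E2 : j.+1%:R * (j`!%:R * 'C(m, j)%:R) = j.+1`!%:R * 'C(m, j)%:R :> k.
  by rewrite factS natrM !mulrA.
by rewrite E1 E2 -scalerDl subSS binS natrD mulrDr addrC.
Qed.

(** p(H) X^m in normal order. *)
Definition nordH (m : nat) (p : {poly k}) : carrier (Ub k) := plin (fun s => H ^+ s * u m 0) p.

Lemma nordH_linear m : linear (nordH m).
Proof. exact: plin_linear. Qed.

Lemma mulH_nordH m p : H * nordH m p = nordH m ('X * p).
Proof.
apply: (poly_ext (V := carrier (Ub k)) (h := fun p => H * nordH m p)
  (h' := fun p => nordH m ('X * p))) p.
- by move=> c y z; rewrite nordH_linear mul_linr.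
- by move=> c y z; rewrite mulrDr -scalerAr nordH_linear.
by move=> i; rewrite -exprS /nordH !plin_Xn; apply/esym/alg_expS.
Qed.

Lemma Delta_HX (s m : nat) : Delta (H ^+ s * u m 0) = prim_Delta H ^+ s * Delta (u m 0).
Proof.
elim: s => [|s IHs]; first by rewrite !expr0 !alg1l.
by rewrite alg_expS Ub_Delta_H IHs -alg_expS.
Qed.

Lemma bderiv_linr x : linear (bderiv (@pair_cl k) x).
Proof. by move=> c y z; rewrite /bderiv Delta_linear; apply: contract_linear. Qed.

(** By [contract_DeltaX] the powers of X behave as under j derivatives, and each H
    on the left contributes H + s + j by [contract_H]. *)
Lemma bderiv_nordH (j : nat) (s : int) (m : nat) p :
  bderiv (@pair_cl k) (e j s) (nordH m p) =
  (j`!%:R * 'C(m, j)%:R) *: nordH (m - j) (p \Po ('X + (s%:~R + j%:R)%:P)).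
Proof.
have bl := bderiv_linr (e j s).
apply: (poly_ext (V := carrier (Ub k))
  (h := fun p => bderiv (@pair_cl k) (e j s) (nordH m p))
  (h' := fun p => (j`!%:R * 'C(m, j)%:R) *:
    nordH (m - j) (p \Po ('X + (s%:~R + j%:R)%:P)))) p.
- by move=> c y z; rewrite nordH_linear bl.
- move=> c y z; rewrite linearD linearZ /= nordH_linear scalerDr !scalerA.
  by rewrite [c * _]mulrC.
move=> a; rewrite {1}/nordH plin_Xn -[bderiv _ _ _]/(contract _ (Delta _)) Delta_HX.
elim: a => [|a IHa].
  rewrite !expr0 alg1l contract_DeltaX comp_polyC /nordH polyC1 plin_1.
  by rewrite expr0 alg1l.
rewrite alg_expS contract_H IHa exprS rmorphM /= comp_polyX mulrDl mul_polyC.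
rewrite (linear_add (nordH_linear _)) (linear_scale (nordH_linear _)) -mulH_nordH.
by rewrite scalerDr !scalerA [_ * (s%:~R + _)]mulrC addrC scaleAr.
Qed.

Lemma normord_nordH N (f : {poly {poly k}}) : (size f <= N)%N ->
  normord f = \sum_(m < N) nordH m f`_m.
Proof.
move=> le; have E (m : nat) (p : {poly k}) :
    \sum_(s < size p) p`_s *: (Ub_H k ^+ s * Ub_X k ^+ m) = nordH m p.
  have -> : Ub_X k ^+ m = u m 0.
    by have := Ub_monoE k m 0; rewrite expr0 alg1r.
  reflexivity.
transitivity (\sum_(m < size f) nordH m f`_m).
  by apply: eq_bigr => m _; apply: E.
rewrite (big_ord_widen _ (fun m => nordH m f`_m) le) big_mkcond.
apply: eq_bigr => m _; case: ltnP => // h.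
by rewrite nth_default // (linear_zero (nordH_linear _)).
Qed.

Lemma bderiv_linl a : linear (fun x => bderiv (@pair_cl k) x a).
Proof.
move=> c x y; rewrite /bderiv; apply: (lin_param (f := fun x (p : Ub k * Ub k) =>
  pr (mono p.1) x *: mono p.2 : carrier (Ub k))) => p {}c {}x {}y.
by rewrite pairing_linr scalerDl scalerA.
Qed.

Lemma T_H_coef (c : k) (f : {poly {poly k}}) m :
  (T_H c f)`_m = f`_m \Po ('X + c%:P).
Proof. by rewrite /T_H coef_map_id0 // comp_poly0. Qed.

Lemma size_T_H (c : k) (f : {poly {poly k}}) : (size (T_H c f) <= size f)%N.
Proof.
by apply/leq_sizeP => m h; rewrite T_H_coef nth_default // comp_poly0.
Qed.

Hypothesis k0 : [pchar k] =i pred0.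

Lemma bderiv_normord (j : nat) (s : int) (f : {poly {poly k}}) :
  bderiv (@pair_cl k) (j`!%:R^-1 *: e j s) (normord f) =
  normord (T_H (s%:~R + j%:R) ((j`!%:R^-1)%:P *: f^`(j))).
Proof.
set g := (_ *: f^`(j)); have gs : (size g <= size f)%N.
  apply/leq_sizeP => m h; rewrite coefZ coef_derivn nth_default ?mul0rn ?mulr0 //.
  by rewrite (leq_trans h) // ?leq_addl ?leq_addr.
rewrite (normord_nordH (leq_trans (size_T_H _ _) gs)).
rewrite (@normord_nordH (j + size f)); last exact: leq_addl.
have bl := bderiv_linr.
rewrite (clinS (bl _)) big_split_ord /= big1 ?add0r => [|m _]; last first.
  rewrite (linear_scale (bderiv_linl _)) bderiv_nordH bin_small ?ltn_ord //.
  by rewrite mulr0 scale0r scaler0.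
apply: eq_bigr => m _; rewrite (linear_scale (bderiv_linl _)) bderiv_nordH.
have E (p : {poly k}) : (j`!%:R^-1)%:P * (p *+ (j + m) ^_ j) = 'C(j + m, j)%:R *: p.
  rewrite mul_polyC -scaler_nat scalerA -bin_ffact natrM mulrCA mulVf ?fact_neq0 //.
  by rewrite mulr1.
rewrite addKn T_H_coef coefZ coef_derivn E comp_polyZ (linear_scale (nordH_linear _)).
by rewrite [LHS]scalerA mulrA mulVf ?fact_neq0 // mul1r.
Qed.

Lemma normordB (f g : {poly {poly k}}) : normord (f - g) = normord f - normord g.
Proof.
pose N := maxn (size f) (size g).
rewrite (@normord_nordH N (f - g)).
  rewrite (@normord_nordH N f) ?leq_maxl // (@normord_nordH N g) ?leq_maxr //.
  rewrite -sumrB; apply: eq_bigr => m _.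
  by rewrite coefB -scaleN1r addrC nordH_linear scaleN1r addrC.
by rewrite (leq_trans (size_polyD _ _)) ?size_polyN.
Qed.

Lemma bderiv_normord0 (s : int) (f : {poly {poly k}}) :
  bderiv (@pair_cl k) (e 0 s - e 0 0) (normord f) =
  normord (T_H s%:~R f - f).
Proof.
have E (s' : int) : bderiv (@pair_cl k) (e 0 s') (normord f) = normord (T_H s'%:~R f).
  have := bderiv_normord 0 s' f; rewrite invr1 scale1r polyC1 scale1r addr0.
  exact: id.
have T0 : T_H (0 : k) f = f.
  by apply/polyP => m; rewrite T_H_coef polyC0 addr0 comp_polyXr.
rewrite -scaleN1r addrC (bderiv_linl (normord f)) !E [0%:~R]/(0 : k) T0.
by rewrite scaleN1r addrC normordB.
Qed.

End BraidedDerivations.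

(** * The calculus of a single string *)
Section FirstOrderCalculus.
Context {F : fieldType} {A : hopf F}.
Local Notation AA := (carrier (tensor A A)).

Lemma calc_eq_rinv (M : set (carrier A)) (w w' : AA) m :
  M m -> w - w' = rinv m -> calc_eq M w w'.
Proof.
move=> Mm E; exists [:: (m, 1)] => [p|]; last by rewrite big_seq1.
by rewrite inE => /eqP ->.
Qed.

Lemma rinv_linear : linear (rinv : carrier A -> AA).
Proof. exact: tnsA_linl. Qed.

Lemma calc_d_prim (y : carrier A) : Delta y = prim_Delta y -> calc_d y = rinv y.
Proof.
by move=> E; rewrite /calc_d E /prim_Delta addrK.
Qed.

(** For y primitive, y (v (x) 1) = y v (x) 1 + v (x) y, and the second summand is
    the right action. *)
Lemma calc_comm_prim (y v : carrier A) :
  Delta y = prim_Delta y -> calc_comm y (rinv v) = rinv (y * v).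
Proof.
move=> E; rewrite /calc_comm /lact /ract E /rinv.
have -> : (v ⊗ 1) * (1 ⊗ y) = v ⊗ y :> AA.
  by rewrite (tns_mulE v 1 1 y) alg1r (alg1l y).
apply: etrans (f_equal2 (fun a b : AA => a - b) (prim_tns y v 1) (erefl (v ⊗ y))) _.
by rewrite (alg1r y) addrK.
Qed.

End FirstOrderCalculus.

Section DualBasis.
Context {k : fieldType} (k0 : [pchar k] =i pred0).
Local Notation u n m := (mono ((n%N, m%N) : Ub k)).
Local Notation e n m := (mono ((n%N, m) : CB k)).
Local Notation pr := (pairing (@pair_cl k)).
Local Notation Pcl := (Bq_basis (oner_neq0 k)).
Local Notation Mcl := (calc_str Pcl (@pair_cl k)).
Local Notation Lcl := (tan_str Pcl).
Variable d : nat.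
Hypothesis d0 : (0 < d)%N.

(** The scalar 1 / (-d) makes eta_0 dual to phi_0, whose pairing with H is -d. *)
Definition eta (i : nat) : carrier (Ub k) :=
  if i is 0 then (- d%:R : k)^-1 *: u 0 1 else u i 0.

Definition phi (i : nat) : carrier (CB k) :=
  if i is 0 then e 0 (- d%:Z) - e 0 0 else i`!%:R^-1 *: e i (- d%:Z).

Lemma Nd_neq0 : (- d%:R : k) != 0.
Proof. by rewrite oppr_eq0 natr_eq0_k // -lt0n. Qed.

Lemma evu_eta r c i : evu r c (eta i) =
  if r == i then (if i is 0 then c / (- d%:R) else 1) else 0.
Proof.
case: i => [|i]; rewrite /eta ?evuZ evu_u eq_sym; case: eqP => _ //.
  by rewrite expr1 mulrC.
by rewrite mulr0.
Qed.

(** The division by i! in phi_i cancels the weight of the pairing; subtracting the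
    unit from g^(-d) does not matter on the kernel of the counit. *)
Lemma pr_phi i a : eps a = 0 -> pr a (phi i) = evu i (- d%:R) a.
Proof.
move=> ea; case: i => [|i]; rewrite /phi.
  rewrite -scaleN1r addrC pairing_linr !pairing_evu /= mulrNz.
  by rewrite -[0%:~R]/(0 : k) -eps_evu ea !mul1r scaler0 add0r.
rewrite (linear_scale (pairing_linr (@pair_cl k) a)) pairing_evu /= mulrNz.
by apply: mulKf; apply: fact_neq0.
Qed.

Lemma eps_eta i : eps (eta i) = 0.
Proof.
by rewrite eps_evu evu_eta; case: i => [|i] //; rewrite mul0r.
Qed.

Lemma pr_eta_phi i j : pr (eta i) (phi j) = (i == j)%:R.
Proof.
rewrite pr_phi ?eps_eta // evu_eta eq_sym; case: eqP => // ->.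
by case: j => // ; rewrite mulfV // Nd_neq0.
Qed.

Lemma Mcl_single a : eps a = 0 ->
  (Mcl [:: d] a <-> forall i, (i < d.+1)%N -> pr a (phi i) = 0).
Proof.
move=> ea; split=> [/(MU_evu k0) Ma i id|Ma].
  by rewrite pr_phi // Ma ?inE ?eqxx ?orbT.
apply/(MU_evu k0) => i r; rewrite !inE => /orP[/eqP ->|/eqP -> rd].
  by rewrite leqn0 => /eqP ->; rewrite oppr0 -eps_evu.
by rewrite -pr_phi // Ma.
Qed.

Lemma basis_eta : basis_mod (kereps (Ub k)) (Mcl [:: d]) d.+1 eta.
Proof.
apply: (@basis_mod_dual _ _ _ _ _ _ (fun i a => pr a (phi i))).
- exact: kereps_subspace.
- by move=> i; apply: pairing_linl.
- by move=> a ea; apply: Mcl_single.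
- by move=> i _; apply: eps_eta.
by move=> i j _ _; apply: pr_eta_phi.
Qed.

Lemma phi_coef i j : (phi i)@_((j, - d%:Z) : CB k) = j`!%:R^-1 * (i == j)%:R.
Proof.
case: i => [|i]; rewrite /phi.
  have nd : (0 == - d%:Z) = false by lia.
  rewrite mcoeffB !mcoeffU !xpair_eqE eqxx andbT nd andbF subr0.
  by case: j => [|j]; rewrite ?invr1 ?mul1r ?mulr0.
rewrite mcoeffZ mcoeffU xpair_eqE eqxx andbT.
by case: eqP => [->//|_]; rewrite !mulr0.
Qed.

Lemma phi_Lcl i : (i < d.+1)%N -> Lcl [:: d] (phi i).
Proof.
move=> id; have L : supp_on (strings Pcl [:: d]) (augm (bx Pcl 0 0) (bx Pcl i (- d%:Z))).
  apply: augm_in_supp; [exact: eps_one | exact: strings1 |].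
  by rewrite strings_bx abszN absz_nat !inE eqxx orbT -ltnS id; lia.
case: i id L => [|i] id; rewrite /augm bx_eps.
  by rewrite scale1r.
rewrite scale0r subr0 => /(subspaceZ (i.+1`!%:R^-1) (supp_on_subspace _)) h.
exact: h.
Qed.

Lemma basis_phi : basis_mod (Lcl [:: d]) [set 0] d.+1 phi.
Proof.
apply: (@basis_mod_dual _ _ _ _ _ _
  (fun j (x : carrier (CB k)) => j`!%:R * x@_((j, - d%:Z) : CB k))).
- exact: supp_on_subspace.
- move=> j c x y; rewrite mcoeffD mcoeffZ mulrDr; congr (_ + _).
  exact: mulrCA.
- move=> x Sx; split=> [-> i _|x0]; first by rewrite mcoeff0 mulr0.
  rewrite /= (supp_onE (eps_one Pcl) Sx) big1 // => b nb.
  case: (boolP (strings Pcl [:: d] b)) => [|Sb]; last by rewrite (Sx.2 _ Sb) scale0r.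
  rewrite columnE => bS; have : b \in column Pcl d.
    by have : b \in bx Pcl 0 0 :: column Pcl d by []; rewrite in_cons (negPf nb).
  case/mapP=> r; rewrite mem_iota add0n => /x0 E ->.
  move/eqP: E; rewrite mulf_eq0 (negPf (fact_neq0 k0 r)) => /eqP E.
  by rewrite -[bx _ _ _]/((r, - d%:Z) : CB k) E scale0r.
- by move=> i; apply: phi_Lcl.
move=> i j _ _; rewrite phi_coef mulrA mulfV ?fact_neq0 // mul1r.
by [].
Qed.

Lemma Ub_Delta_prim : Delta (u 1 0) = prim_Delta (u 1 0) /\
  Delta (u 0 1) = prim_Delta (u 0 1).
Proof.
have D1 : Delta (1 : carrier (Ub k)) = 1 by exact: Ub_Delta_one.
split; first by have := Ub_Delta_X (1 : carrier (Ub k)); rewrite D1 !alg1r.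
by have := Ub_Delta_H (1 : carrier (Ub k)); rewrite D1 !alg1r.
Qed.

Lemma calc_dX : calc_eq (Mcl [:: d]) (calc_d (u 1 0)) (rinv (eta 1)).
Proof.
apply: (@calc_eq_rinv _ _ _ _ _ 0).
  by case: (ann_of_subspace (@pair_cl k) (strings Pcl [:: d])).
rewrite (calc_d_prim Ub_Delta_prim.1) subrr.
exact/esym/(linear_zero rinv_linear).
Qed.

Lemma calc_dH :
  calc_eq (Mcl [:: d]) (calc_d (u 0 1)) ((- d%:R : k) *: rinv (eta 0)).
Proof.
apply: (@calc_eq_rinv _ _ _ _ _ 0).
  by case: (ann_of_subspace (@pair_cl k) (strings Pcl [:: d])).
rewrite (calc_d_prim Ub_Delta_prim.2) -(clinZ rinv_linear) /eta scalerA mulfV ?Nd_neq0 //.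
rewrite scale1r subrr.
exact/esym/(linear_zero rinv_linear).
Qed.

(** H X^i = X^i (H + i), and X^i H = -d X^i modulo M for i > 0. For i = 0 the
    difference is a multiple of H (H + d), which satisfies the conditions at H = 0
    and at H = -d. *)
Lemma calc_HE i : (i < d.+1)%N ->
  calc_eq (Mcl [:: d]) (calc_comm (u 0 1) (rinv (eta i)))
    ((- d%:R + i%:R : k) *: rinv (eta i)).
Proof.
move=> id; apply: (@calc_eq_rinv _ _ _ _ _
  ((- (- d%:R + i%:R)) *: eta i + u 0 1 * eta i)).
  apply/(MU_evu k0) => j r; rewrite !inE => jJ rj.
  rewrite evuD evuZ evu_mul subn0 expr1 -mulrDl evu_eta.
  case: eqP => [ri|_]; last by rewrite mulr0.
  rewrite -ri; case: r ri rj => [|r] ri rj.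
    rewrite !addr0 opprK; case/orP: jJ => /eqP ->; last by rewrite subrr mul0r.
    by rewrite oppr0 mul0r mulr0.
  case/orP: jJ rj => /eqP -> // rj.
  by rewrite opprD opprK mulr1 addrACA subrr add0r addNr.
rewrite (calc_comm_prim _ Ub_Delta_prim.2) rinv_linear -scaleNr.
by rewrite addrC.
Qed.

(** X eta_i is X^(i+1) for i > 0, beyond the string for i = d. For i = 0 it is
    - X H / d, and X H = -d X modulo M. *)
Lemma calc_XE i : (i < d.+1)%N ->
  calc_eq (Mcl [:: d]) (calc_comm (u 1 0) (rinv (eta i)))
    (if (i < d)%N then rinv (eta i.+1) else 0).
Proof.
move=> id; pose v := if (i < d)%N then eta i.+1 else 0.
have -> : (if (i < d)%N then rinv (eta i.+1) else 0) = rinv v.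
  by rewrite /v; case: ifP => // _; apply/esym/(linear_zero rinv_linear).
apply: (@calc_eq_rinv _ _ _ _ _ (-1 *: v + u 1 0 * eta i)).
  apply/(MU_evu k0) => j r; rewrite !inE => jJ rj.
  rewrite evuD evuZ mulN1r evu_mul expr0 mul1r /v.
  case: r rj => [|r] rj; first by case: ifP => _; rewrite ?evu_eta ?evu0 /= oppr0 addr0.
  have {jJ} jd : j = d by case/orP: jJ rj => /eqP ->.
  rewrite subSS subn0 evu_eta jd; case: ifP => h.
    rewrite evu_eta eqSS; case: eqP => [->|_]; last by rewrite oppr0 addr0.
    by case: (i) => [|i']; rewrite ?mulfV ?Nd_neq0 // addNr.
  rewrite evu0 oppr0 add0r; case: eqP => // ri.
  by move: h; rewrite -ri -jd rj.
rewrite (calc_comm_prim _ Ub_Delta_prim.1) rinv_linear scaleN1r.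
by rewrite addrC.
Qed.

End DualBasis.

(** * Correspondence of calculi and tangent spaces *)
Lemma family_bij (I T U : Type) (x : I -> T) (y : I -> U) (f : T -> U) :
  (forall i, f (x i) = y i) -> (forall i j, y i = y j -> x i = x j) ->
  set_bij [set t | exists i, t = x i] [set u | exists i, u = y i] f.
Proof.
move=> fx inj; split.
- by move=> _ [i ->]; exists i.
- move=> t t' /set_mem[i ->] /set_mem[j ->]; rewrite !fx; exact: inj.
by move=> _ [i ->]; exists (x i); [exists i | exact: fx].
Qed.

Theorem proposition4p3 (k : fieldType) (hk : [pchar k] =i pred0) (o : bool) :
  (exists (GG : set (set (carrier (Ub k)))) (LL : set (set (carrier (CB k)))),
    [/\ GG `<=` fd_calculus (Ub k) /\ LL `<=` fd_tangent_space (CB k),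
        set_bij (fd_calculus (Uq k)) GG limM,
        set_bij (fd_tangent_space (CqB k)) LL (limL o),
        [/\ set_bij (fd_calculus (Uq k)) (fd_tangent_space (CqB k))
              (tangent_of (@pair_q k)),
            set_bij GG LL (tangent_of (@pair_cl k)) &
            forall M, fd_calculus (Uq k) M ->
              tangent_of (@pair_cl k) (limM M) =
              limL o (tangent_of (@pair_q k) M)] &
        (forall M M', fd_calculus (Uq k) M -> fd_calculus (Uq k) M' ->
           fd_calculus (Uq k) (M `&` M') /\
           limM (M `&` M') = limM M `&` limM M') /\
        (forall L L', fd_tangent_space (CqB k) L ->
           fd_tangent_space (CqB k) L' ->
           fd_tangent_space (CqB k) (L `&` L') /\
           limL o (L `&` L') = limL o L `&` limL o L')]) /\
  (forall (n : nat) (M : set (carrier (Uq k))) (L : set (carrier (CqB k))),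
    (2 <= n)%N ->
    fd_calculus (Uq k) M -> L = tangent_of (@pair_q k) M ->
    (coirreducible M /\ calculus_dim M n) \/
    (irreducible_tangent_space L /\ dim_mod L [set 0] n) ->
    let Gam := limM M in
    exists (eta : nat -> carrier (Ub k)) (phi : nat -> carrier (CB k)),
      [/\ basis_mod (kereps (Ub k)) Gam n eta,
          [/\ calc_eq Gam (@calc_d _ (Ub k) (Ub_X k)) (rinv (eta 1%N)),
              calc_eq Gam (@calc_d _ (Ub k) (Ub_H k))
                ((1 - n%:R : k) *: rinv (eta 0%N)),
              forall i, (i < n)%N ->
                calc_eq Gam (@calc_comm _ (Ub k) (Ub_H k) (rinv (eta i)))
                  ((1 - n%:R + i%:R : k) *: rinv (eta i)) &
              forall i, (i < n)%N ->
                calc_eq Gam (@calc_comm _ (Ub k) (Ub_X k) (rinv (eta i)))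
                  (if (i < n.-1)%N then rinv (eta i.+1) else 0)],
          basis_mod (limL o L) [set 0] n phi,
          forall i j, (i < n)%N -> (j < n)%N ->
            pairing (@pair_cl k) (eta i) (phi j) = (i == j)%:R &
          (forall i (f : {poly {poly k}}), (1 <= i < n)%N ->
            bderiv (@pair_cl k) (phi i) (normord f) =
            normord (T_H (1 - n%:R + i%:R) ((i`!%:R^-1)%:P *: f^`(i)))) /\
          (forall f : {poly {poly k}},
            bderiv (@pair_cl k) (phi 0%N) (normord f) =
            normord (T_H (1 - n%:R) f - f))]).
Proof.
pose Pq := Bq_basis (qvar_neq0 k); pose Pcl := Bq_basis (oner_neq0 k).
pose Mq := calc_str Pq (@pair_q k); pose Mcl := calc_str Pcl (@pair_cl k).
pose Lq := tan_str Pq; pose Lcl := tan_str Pcl.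
have qgen := @qvar_generic k.
have Iq := @Bq_interpolation (kq k) (qvar k) (qvar_neq0 k) qgen.
have Icl := Ub_interpolation hk.
have fdM : fd_calculus (Uq k) = [set M | exists J, M = Mq J] by exact: fd_calculus_BqE.
have fdL : fd_tangent_space (CqB k) = [set L | exists J, L = Lq J].
  exact: fd_tangent_BqE.
have limME J : limM (Mq J) = Mcl J by exact: limM_calc_str.
have limLE J : limL o (Lq J) = Lcl J by exact: limL_tan_str.
have tanq J : tangent_of (@pair_q k) (Mq J) = Lq J by exact: calc_str_tangent Iq J.
have tancl J : tangent_of (@pair_cl k) (Mcl J) = Lcl J by exact: calc_str_tangent Icl J.
have strE J J' : strings Pcl J =1 strings Pcl J' -> strings Pq J =1 strings Pq J' by [].
split.
  exists [set M | exists J, M = Mcl J], [set L | exists J, L = Lcl J].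
  rewrite fdM fdL; split.
  - split; first by move=> _ [J ->]; apply: MU_fd.
    by move=> _ [J ->]; apply: tan_str_fd.
  - apply: family_bij => // J J' /(calc_str_inj Icl) /strE E; exact: calc_str_eq.
  - apply: family_bij => // J J' /tan_str_inj /strE E; exact: tan_str_eq.
  - split.
    + apply: family_bij => // J J' /tan_str_inj E; exact: calc_str_eq.
    + apply: family_bij => // J J' /tan_str_inj E; exact: calc_str_eq.
    + by move=> _ [J ->]; rewrite limME tanq limLE tancl.
  split.
    move=> _ _ [J ->] [J' ->]; rewrite [_ `&` _]calc_str_cap !limME.
    split; first by exists (J ++ J').
    by rewrite [RHS]calc_str_cap.
  move=> _ _ [J ->] [J' ->]; rewrite [_ `&` _]tan_str_cap !limLE.
  split; first by exists [seq i <- J | i \in J'].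
  by rewrite [RHS]tan_str_cap.
move=> n M L n2; rewrite fdM => -[J ->] -> Mirr.
have {Mirr} [d d0 [nE ME]] : exists2 d, (0 < d)%N & n = d.+1 /\ Mq J = Mq [:: d].
  case: Mirr => [[Mc Md]|].
    have calcM J' : calculus (Mq J').
      by rewrite [Mq J']Mq_vanish; apply: vanish_calc_calculus; apply: qvar_neq0.
    exact: (coirreducible_single (@Bq_pr_b1 _ _ (qvar_neq0 k)) Iq calcM Mc Md).
  rewrite tanq => -[Lirr Ld].
  have tanL J' : tangent_space (Lq J').
    by apply: supp_tangent; apply: qvar_neq0.
  have [d d0 [nE LE]] := irreducible_single tanL Lirr Ld.
  by exists d => //; split=> //; apply: calc_str_eq; apply: tan_str_inj.
rewrite ME tanq limME limLE {ME} => Gam.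
have nd : 1 - n%:R = - d%:R :> k by rewrite nE -natr1 opprD addrCA subrr addr0.
exists (@eta k d), (@phi k d); rewrite nd nE; split.
- exact: basis_eta.
- split.
  + exact: calc_dX.
  + exact: calc_dH.
  + by move=> i; apply: calc_HE.
  + by move=> i; apply: calc_XE.
- exact: basis_phi.
- by move=> i j _ _; apply: pr_eta_phi.
split=> [[//|i] f _|f].
  rewrite /phi bderiv_normord // mulrNz; reflexivity.
by rewrite /phi bderiv_normord0 // mulrNz.
Qed.
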